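(* Let $1\le p<\infty$, $p\neq 2$, and let $\phi,\psi\in\mathbb{A}$. For $k\ge 0$ let $a_k\in D$ be the zero of $\psi\circ\phi_k$. Then the isometry $M_\psi U_\phi$ on $H^p$ is Crownover if and only if $(a_k)_{k=0}^\infty$ is not a Blaschke sequence.
   Context: $D$ is the open unit disc in $\mathbb{C}$, $H^p$ the Hardy space of $D$ with its usual norm. $\mathbb{A}$ is the group (under composition) of holomorphic automorphisms of $D$, i.e. the maps $\phi(z)=\frac{\lambda(z-a)}{1-\overline{a}z}$ with $a\in D$, $|\lambda|=1$. $\phi_k$ is the $k$-fold composition of $\phi$ with itself ($\phi_0(z)=z$). For $F\in H^\infty$, $M_F$ is multiplication by $F$ on $H^p$; $C_\phi f=f\circ\phi$. For $\phi(z)=\frac{\lambda(z-a)}{1-\overline{a}z}$ in $\mathbb{A}$ put $U_\phi=M_{(\overline{\lambda}\phi')^{1/p}}C_\phi$, where $\overline\lambda\phi'(z)=\frac{1-|a|^2}{(1-\overline a z)^2}$ and the $p$-th root is the principal branch $(re^{i\theta})^{1/p}=r^{1/p}e^{i\theta/p}$, $r>0$, $-\pi<\theta<\pi$. For $\phi,\psi\in\mathbb{A}$ the operator $M_\psi U_\phi$ is an isometry of $H^p$ whose range has codimension one. A codimension one isometry $S$ on $H^p$ is Crownover if $\bigcap_{n=1}^\infty S^nH^p=(0)$. A sequence $(a_k)$ in $D$ is a Blaschke sequence if $\sum_k(1-|a_k|)<\infty$. *)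

(* Defs.v *)
(* Stdlib real numbers with Coquelicot's complex numbers and total integral. *)
From Stdlib Require Import Reals Lra Psatz.
From Coquelicot Require Import Coquelicot.
Open Scope R_scope.

Definition unit_disc (z : C) : Prop := Cmod z < 1.

(* Functions on the disc are represented by functions on C whose values off the
   disc are irrelevant; equality of functions is [eq_disc]. *)
Definition eq_disc (f g : C -> C) : Prop := forall z, unit_disc z -> f z = g z.

Definition holomorphic (f : C -> C) : Prop :=
  forall z, unit_disc z -> @ex_derive C_AbsRing C_NormedModule f z.

Definition cis (t : R) : C := (cos t, sin t).

(* [Rpower 0 y] is 1 in Stdlib, hence the case distinction. *)
Definition rpow (x y : R) : R := if Req_EM_T x 0 then 0 else Rpower x y.

(* M_p(r, f) = (1/(2 pi) \int_0^{2 pi} |f(r e^{it})|^p dt)^{1/p} *)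
Definition Mp (p : R) (f : C -> C) (r : R) : R :=
  rpow (/ (2 * PI) *
        RInt (fun t => rpow (Cmod (f (Cmult (RtoC r) (cis t)))) p) 0 (2 * PI))
       (/ p).

Definition Hp (p : R) (f : C -> C) : Prop :=
  holomorphic f /\ exists M : R, forall r, 0 <= r < 1 -> Mp p f r <= M.

(* The supremum is finite, so that [real] loses nothing, when [Hp p f]. *)
Definition Hp_norm (p : R) (f : C -> C) : R :=
  real (Lub_Rbar (fun x => exists r, 0 <= r < 1 /\ x = Mp p f r)).

(* [isometry p S]: S induces a linear isometry of H^p into itself. *)
Record isometry (p : R) (S : (C -> C) -> (C -> C)) : Prop := {
  isometry_Hp : forall f, Hp p f -> Hp p (S f);
  isometry_ext : forall f g, Hp p f -> Hp p g -> eq_disc f g -> eq_disc (S f) (S g);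
  isometry_linear : forall (c d : C) f g, Hp p f -> Hp p g ->
    eq_disc (S (fun z => c * f z + d * g z)%C) (fun z => c * S f z + d * S g z)%C;
  isometry_norm : forall f, Hp p f -> Hp_norm p (S f) = Hp_norm p f }.

Definition in_range (p : R) (S : (C -> C) -> (C -> C)) (f : C -> C) : Prop :=
  exists g, Hp p g /\ eq_disc f (S g).

(* H^p / S H^p is one-dimensional, spanned by the class of [e]. *)
Definition range_codim_one (p : R) (S : (C -> C) -> (C -> C)) : Prop :=
  exists e, Hp p e /\ ~ in_range p S e /\
    forall f, Hp p f -> exists (c : C) (g : C -> C),
      Hp p g /\ eq_disc f (fun z => S g z + c * e z)%C.

Definition Crownover (p : R) (S : (C -> C) -> (C -> C)) : Prop :=
  isometry p S /\ range_codim_one p S /\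
  forall f, Hp p f ->
    (forall n : nat, (1 <= n)%nat -> in_range p (Nat.iter n S) f) ->
    eq_disc f (fun _ => RtoC 0).

(* An automorphism of the disc is given by its (unique) parameters lambda, a. *)
Record disc_aut : Type := DiscAut {
  aut_lam : C;
  aut_pt : C;
  aut_lamP : Cmod aut_lam = 1;
  aut_ptP : unit_disc aut_pt }.

Definition aut_eval (phi : disc_aut) (z : C) : C :=
  (aut_lam phi * (z - aut_pt phi) / (1 - Cconj (aut_pt phi) * z))%C.
Coercion aut_eval : disc_aut >-> Funclass.

(* The argument in (-pi, pi) of z off the closed negative real axis, by the
   half-angle formula; see [cargP]. *)
Definition carg (z : C) : R := 2 * atan (Im z / (Cmod z + Re z)).

Lemma cargP (z : C) : 0 < Cmod z + Re z ->
  - PI < carg z < PI /\ z = (RtoC (Cmod z) * cis (carg z))%C.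
Proof.
intros Hz; unfold carg, cis.
set (m := Cmod z) in *.
assert (Hm : m ^ 2 = Re z ^ 2 + Im z ^ 2) by apply Cmod2_alt.
assert (Hm0 : 0 <= m) by apply Cmod_ge_0.
assert (Hmp : 0 < m).
{ destruct Hm0 as [H|H]; [exact H|exfalso].
  rewrite <- H in *. assert (Re z = 0) by nra. lra. }
set (u := Im z / (m + Re z)).
split; [pose proof (atan_bound u); lra|].
assert (Hc : cos (atan u) ^ 2 * (1 + u ^ 2) = 1).
{ pose proof (sin2_cos2 (atan u)) as H1; unfold Rsqr in H1.
  assert (Hp : 0 < cos (atan u)) by (apply cos_gt_0; pose proof (atan_bound u); lra).
  assert (H2 : sin (atan u) = u * cos (atan u)).
  { rewrite <- (tan_atan u) at 2. unfold tan. field. lra. }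
  rewrite H2 in H1. lra. }
assert (Hs : sin (atan u) = u * cos (atan u)).
{ assert (Hp : 0 < cos (atan u)) by (apply cos_gt_0; pose proof (atan_bound u); lra).
  rewrite <- (tan_atan u) at 2. unfold tan. field. lra. }
assert (Hcc : cos (atan u) ^ 2 = (m + Re z) / (2 * m)).
{ apply (Rmult_eq_reg_r (1 + u ^ 2)); [|nra]. rewrite Hc. unfold u. field_simplify_eq; [|lra].
  replace (Im z ^ 2) with (m ^ 2 - Re z ^ 2) by lra. ring. }
assert (E1 : m * cos (2 * atan u) = Re z).
{ rewrite cos_2a_cos. replace (2 * cos (atan u) * cos (atan u)) with (2 * cos (atan u) ^ 2) by ring.
  rewrite Hcc. field. lra. }
assert (E2 : m * sin (2 * atan u) = Im z).
{ rewrite sin_2a, Hs.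
  replace (2 * (u * cos (atan u)) * cos (atan u)) with (2 * u * cos (atan u) ^ 2) by ring.
  rewrite Hcc. unfold u. field. lra. }
destruct z as [x y]; unfold Re, Im in *; simpl in *.
unfold Cmult, RtoC; simpl. f_equal; lra.
Qed.

(* The principal branch of z^{1/p}. *)
Definition croot (p : R) (z : C) : C :=
  (RtoC (rpow (Cmod z) (/ p)) * cis (carg z / p))%C.

Definition mul_op (F : C -> C) (f : C -> C) : C -> C := fun z => (F z * f z)%C.
Definition comp_op (phi : C -> C) (f : C -> C) : C -> C := fun z => f (phi z).

Definition aut_weight (phi : disc_aut) (z : C) : C :=
  (Cconj (aut_lam phi) * C_derive phi z)%C.

Lemma aut_den_bound (a y : C) : Cmod y <= 1 -> 1 - Cmod a <= Cmod (1 - Cconj a * y).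
Proof.
intros Hy.
pose proof (Cmod_triangle (1 - Cconj a * y) (Cconj a * y)) as H.
replace (1 - Cconj a * y + Cconj a * y)%C with (RtoC 1) in H by ring.
rewrite Cmod_1, Cmod_mult, Cmod_conj in H.
pose proof (Cmod_ge_0 a). pose proof (Cmod_ge_0 y). nra.
Qed.

Lemma is_derive_aut (phi : disc_aut) (z : C) : unit_disc z ->
  @is_derive C_AbsRing C_NormedModule phi z
    (aut_lam phi * (1 - aut_pt phi * Cconj (aut_pt phi))
       / (1 - Cconj (aut_pt phi) * z) ^ 2)%C.
Proof.
destruct phi as [l a Hl Ha]; unfold unit_disc; simpl; intros Hz.
assert (Hd : forall y, Cmod y <= 1 -> (1 - Cconj a * y)%C <> 0).
{ intros y Hy. apply Cmod_gt_0. pose proof (aut_den_bound a y Hy). unfold unit_disc in Ha. lra. }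
set (D := (l * (1 - a * Cconj a) / (1 - Cconj a * z) ^ 2)%C).
assert (Hrem : forall y : C, Cmod y <= 1 ->
  ((aut_eval (DiscAut l a Hl Ha) y - aut_eval (DiscAut l a Hl Ha) z) - (y - z) * D)%C
  = (D * Cconj a / (1 - Cconj a * y) * (y - z) * (y - z))%C).
{ intros y Hy. unfold aut_eval, D; simpl. field. split; apply Hd; [lra|exact Hy] || (split; apply Hd; lra). }
assert (Htri : forall y : C, Cmod y <= Cmod (y - z)%C + Cmod z).
{ intros y. replace y with (y - z + z)%C at 1 by ring. apply Cmod_triangle. }
split; [apply is_linear_scal_l|].
intros x Hx.
assert (x = z) by (symmetry; exact (@is_filter_lim_locally_unique C_AbsRing (AbsRing_NormedModule C_AbsRing) z x Hx)).
subst x. clear Hx. intros eps.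
set (K := Cmod (D * Cconj a) / (1 - Cmod a)).
unfold unit_disc in Ha.
assert (HK : 0 <= K) by (apply Rdiv_le_0_compat; [apply Cmod_ge_0|lra]).
assert (Hdel : 0 < Rmin (1 - Cmod z) (eps / (K + 1))).
{ apply Rmin_case; [lra|]. apply Rdiv_lt_0_compat; [apply cond_pos|lra]. }
exists (mkposreal _ Hdel). intros y Hy.
change (Cmod (y - z)%C < Rmin (1 - Cmod z) (eps / (K + 1))) in Hy.
change (Cmod ((aut_eval (DiscAut l a Hl Ha) y - aut_eval (DiscAut l a Hl Ha) z)
   - (y - z) * D)%C <= eps * Cmod (y - z)%C).
assert (Hy1 : Cmod y <= 1).
{ pose proof (Htri y).
  pose proof (Rmin_l (1 - Cmod z) (eps / (K + 1))). lra. }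
assert (Hy2 : Cmod (y - z) * (K + 1) <= eps).
{ pose proof (Rmin_r (1 - Cmod z) (eps / (K + 1))) as H.
  replace (pos eps) with (eps / (K + 1) * (K + 1)) by (field; lra).
  apply Rmult_le_compat_r; lra. }
rewrite Hrem by exact Hy1.
rewrite 2!Cmod_mult, Cmod_div by (apply Hd; lra).
apply Rmult_le_compat_r; [apply Cmod_ge_0|].
apply Rle_trans with (2 := Hy2). rewrite (Rmult_comm (Cmod (y - z))).
apply Rmult_le_compat_r; [apply Cmod_ge_0|].
apply Rle_trans with K; [|lra]. unfold K, Rdiv.
apply Rmult_le_compat_l; [apply Cmod_ge_0|].
apply Rinv_le_contravar; [lra|]. now apply aut_den_bound.
Qed.

(* As Re (1 - conj a z) > 0 on the disc, the weight avoids the cut of [croot]. *)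
Lemma aut_weightE (phi : disc_aut) (z : C) : unit_disc z ->
  aut_weight phi z =
  ((1 - RtoC (Cmod (aut_pt phi) ^ 2)) / (1 - Cconj (aut_pt phi) * z) ^ 2)%C.
Proof.
intros Hz; unfold aut_weight.
rewrite (is_C_derive_unique _ _ _ (is_derive_aut phi z Hz)).
rewrite Cmod2_conj.
assert (Hl : (Cconj (aut_lam phi) * aut_lam phi)%C = RtoC 1).
{ rewrite Cmult_comm, <- Cmod2_conj, (aut_lamP phi). f_equal. ring. }
unfold Cdiv. rewrite 2!Cmult_assoc, Hl. ring.
Qed.

Definition U_op (p : R) (phi : disc_aut) (f : C -> C) : C -> C :=
  mul_op (fun z => croot p (aut_weight phi z)) (comp_op phi f).

Definition Blaschke (a : nat -> C) : Prop := ex_series (fun k => 1 - Cmod (a k)).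

(* Main.v *)
Require Import Defs.
From Stdlib Require Import Reals Lra Lia Psatz.
From Coquelicot Require Import Coquelicot.
Open Scope R_scope.

(** Let S be the operator f |-> psi * U_phi f.  The Crownover property combines three facts.

    _Isometry._  Everything rests on one inequality, [subordination]: if F is holomorphic on the
    disc, phi maps a neighbourhood of |z| <= r into |z| < R < 1, and |b| < r, then the
    Poisson-weighted integral over |z| = r, with pole b, of |F o phi|^p is at most
    (R + |phi b|) / (R - |phi b|) times the integral of |F|^p over |z| = R.  Its proof writes
    F(phi z) as a Poisson integral over |z| = R, applies Jensen's inequality (here p >= 1 enters),
    exchanges the integrals, and uses that the Poisson kernel is harmonic in its pole.  With
    phi = id and b = 0 it says that the means increase with r; with phi constant it bounds point
    values; and, since |phi'| on |z| = r is at most the Poisson kernel with pole r^2 a while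
    phi(r^2 a) tends to phi(a) = 0, it shows in the limit r -> 1 that U_phi does not increase
    the norm ([U_bound]).  As U of the inverse automorphism undoes U_phi up to unimodular factors,
    U_phi preserves the norm and maps onto H^p.  Multiplication by psi preserves the norm because
    |psi| tends uniformly to 1 at the boundary.

    _Codimension one._  A function f - f(a), with a the zero of psi, is divisible by psi in H^p,
    so the range of S and the constants span H^p.

    _Intersection of the ranges._  S^n f = P_n * U_phi^n f with P_n = prod_(k < n) psi o phi_k, and
    psi o phi_k is an automorphism vanishing at a_k, hence a Blaschke factor up to a unimodular
    constant.  If f = S^n g_n for every n, then U_phi^n g_n has the norm of f, so
    |f(z)| <= C_z |P_n(z)|, and P_n(z) -> 0 when (a_k) is not a Blaschke sequence
    ([not_Blaschke_Crownover]).  If (a_k) is a Blaschke sequence, the normalised product B of the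
    psi o phi_k converges to a non-zero bounded function; B / P_n is bounded and holomorphic and
    therefore of the form U_phi^n g_n with g_n in H^p, so B lies in all ranges
    ([Blaschke_not_Crownover]).

    The function theory used (Cauchy's and Poisson's formulas, division by a zero, holomorphy of
    locally uniform limits) is derived from Goursat's theorem for rectangles, transported to
    circles by the exponential map. *)

(** * Complex differentiability *)

(** The ring C is used as a module over itself, so that the product and chain rules for
    derivatives over an arbitrary ring apply; [holomorphic_hol] relates this to [holomorphic]. *)
Definition cderiv (f : C -> C) (z l : C) : Prop :=
  @is_derive C_AbsRing (AbsRing_NormedModule C_AbsRing) f z l.

(** Both module structures on C have norm [Cmod]; an epsilon-delta form valid for either
    lets one pass between them. *)
Lemma is_derive_C_eps (V : NormedModule C_AbsRing) (f : C -> V) (z : C) (l : V) :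
  @is_derive C_AbsRing V f z l <->
  forall eps, 0 < eps -> exists del, 0 < del /\ forall w, Cmod (w - z) < del ->
    norm (minus (minus (f w) (f z)) (scal (w - z)%C l)) <= eps * Cmod (w - z).
Proof.
split.
- intros [_ H] eps He.
  destruct (H z (fun P HP => HP) (mkposreal eps He)) as [d Hd].
  exists d; split; [apply cond_pos|]. intros w Hw. exact (Hd w Hw).
- intros H. split; [apply is_linear_scal_l|].
  intros x Hx.
  assert (x = z) by (symmetry; exact (@is_filter_lim_locally_unique C_AbsRing (AbsRing_NormedModule
    C_AbsRing) z x Hx)).
  subst x. intros eps. destruct (H eps (cond_pos eps)) as [d [Hd H1]].
  exists (mkposreal d Hd). intros w Hw. exact (H1 w Hw).
Qed.

Lemma cderiv_eps f z l : cderiv f z l <->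
  forall eps, 0 < eps -> exists del, 0 < del /\ forall w, Cmod (w - z) < del ->
    Cmod (f w - f z - (w - z) * l) <= eps * Cmod (w - z).
Proof. apply (is_derive_C_eps (AbsRing_NormedModule C_AbsRing)). Qed.

Lemma cderiv_const c z : cderiv (fun _ => c) z 0.
Proof. apply (is_derive_const (K := C_AbsRing) (V := AbsRing_NormedModule C_AbsRing)). Qed.

Lemma cderiv_id z : cderiv (fun w => w) z 1.
Proof. apply (is_derive_id (K := C_AbsRing)). Qed.

Lemma cderiv_plus f g z df dg : cderiv f z df -> cderiv g z dg ->
  cderiv (fun w => f w + g w)%C z (df + dg)%C.
Proof. apply (is_derive_plus (K := C_AbsRing) (V := AbsRing_NormedModule C_AbsRing)). Qed.

Lemma cderiv_minus f g z df dg : cderiv f z df -> cderiv g z dg ->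
  cderiv (fun w => f w - g w)%C z (df - dg)%C.
Proof. apply (is_derive_minus (K := C_AbsRing) (V := AbsRing_NormedModule C_AbsRing)). Qed.

Lemma cderiv_mult f g z df dg : cderiv f z df -> cderiv g z dg ->
  cderiv (fun w => f w * g w)%C z (df * g z + f z * dg)%C.
Proof. intros; apply (is_derive_mult (K := C_AbsRing)); trivial. exact Cmult_comm. Qed.

Lemma cderiv_comp f g z df dg : cderiv f (g z) df -> cderiv g z dg ->
  cderiv (fun w => f (g w)) z (dg * df)%C.
Proof. apply (is_derive_comp (K := C_AbsRing) (V := AbsRing_NormedModule C_AbsRing)). Qed.

(** The derivatives computed from explicit formulas below all have a quadratic remainder. *)
Lemma cderiv_quad f z l del K : 0 < del ->
  (forall w, Cmod (w - z) < del -> Cmod (f w - f z - (w - z) * l) <= K * Cmod (w - z) ^ 2) ->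
  cderiv f z l.
Proof.
intros Hd H; apply cderiv_eps; intros eps He.
assert (HK : 0 < Rabs K + 1) by (pose proof (Rabs_pos K); lra).
exists (Rmin del (eps / (Rabs K + 1))); split.
{ apply Rmin_case; [lra|]. now apply Rdiv_lt_0_compat. }
intros w Hw.
pose proof (Rmin_l del (eps / (Rabs K + 1))); pose proof (Rmin_r del (eps / (Rabs K + 1))).
eapply Rle_trans; [apply H; lra|].
assert (Cmod (w - z) * (Rabs K + 1) <= eps).
{ replace eps with (eps / (Rabs K + 1) * (Rabs K + 1)) by (field; lra).
  apply Rmult_le_compat_r; lra. }
pose proof (Cmod_ge_0 (w - z)); pose proof (Rle_abs K). nra.
Qed.

Lemma cderiv_ext_loc f g z l del : 0 < del ->
  (forall w, Cmod (w - z) < del -> f w = g w) -> cderiv f z l -> cderiv g z l.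
Proof.
intros Hd He Hf; apply cderiv_eps; intros eps Heps.
destruct (proj1 (cderiv_eps f z l) Hf eps Heps) as [d [Hd1 H]].
exists (Rmin del d); split; [now apply Rmin_case|].
intros w Hw; pose proof (Rmin_l del d); pose proof (Rmin_r del d).
rewrite <- !He; [apply H; lra| |lra].
replace (z - z)%C with (RtoC 0) by ring; rewrite Cmod_0; lra.
Qed.

Lemma Cmod_sub_rev (a b : C) : Cmod (a - b) = Cmod (b - a).
Proof. rewrite <- Cmod_opp; f_equal; ring. Qed.

Lemma Cmod_triangle_sub (a b : C) : Cmod a - Cmod b <= Cmod (a - b).
Proof.
pose proof (Cmod_triangle (a - b) b) as H.
replace (a - b + b)%C with a in H by ring. lra.
Qed.

Lemma Cmod_minus_le (a b : C) : Cmod (a - b) <= Cmod a + Cmod b.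
Proof. rewrite <- (Cmod_opp b). apply Cmod_triangle. Qed.

Lemma cderiv_inv_id (z : C) : z <> 0 -> cderiv Cinv z (- / (z * z))%C.
Proof.
intros Hz. assert (Hm : 0 < Cmod z) by now apply Cmod_gt_0.
apply cderiv_quad with (Cmod z / 2) (2 / Cmod z ^ 3); [lra|].
intros w Hw. assert (Hw1 : Cmod z / 2 <= Cmod w).
{ pose proof (Cmod_triangle_sub z w). rewrite Cmod_sub_rev in H. lra. }
assert (w <> 0) by (apply Cmod_gt_0; lra).
replace (/ w - / z - (w - z) * - / (z * z))%C with ((w - z) * (w - z) / (z * z * w))%C
  by (field; auto).
rewrite Cmod_div, !Cmod_mult by (repeat apply Cmult_neq_0; auto).
set (d := Cmod (w - z)). set (m := Cmod z) in *.
replace (2 / m ^ 3 * d ^ 2) with (d * d / (m * m * (m / 2))) by (field; lra).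
unfold Rdiv at 1 2. apply Rmult_le_compat_l; [nra|].
assert (0 < m * m) by nra.
apply Rinv_le_contravar; nra.
Qed.

Lemma cderiv_inv f z df : cderiv f z df -> f z <> 0 ->
  cderiv (fun w => / f w)%C z (df * - / (f z * f z))%C.
Proof. intros; apply (cderiv_comp Cinv f); trivial. now apply cderiv_inv_id. Qed.

Lemma cderiv_div f g z df dg : cderiv f z df -> cderiv g z dg -> g z <> 0 ->
  cderiv (fun w => f w / g w)%C z (df * / g z + f z * (dg * - / (g z * g z)))%C.
Proof. intros. apply (cderiv_mult f (fun w => / g w)%C); trivial. now apply cderiv_inv. Qed.

Definition cdiff (f : C -> C) (z : C) : Prop := exists l, cderiv f z l.

Definition hol (rho : R) (f : C -> C) := forall z, Cmod z < rho -> cdiff f z.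

Lemma holomorphic_hol f : holomorphic f <-> hol 1 f.
Proof.
split; intros H z Hz; destruct (H z Hz) as [l Hl]; exists l.
- apply cderiv_eps. apply (is_derive_C_eps C_NormedModule), Hl.
- apply (is_derive_C_eps C_NormedModule). apply cderiv_eps, Hl.
Qed.

Lemma cdiff_const c z : cdiff (fun _ => c) z.
Proof. eexists; apply cderiv_const. Qed.

Lemma cdiff_id z : cdiff (fun w => w) z.
Proof. eexists; apply cderiv_id. Qed.

Lemma cdiff_plus f g z : cdiff f z -> cdiff g z -> cdiff (fun w => f w + g w)%C z.
Proof. intros [l H] [k G]; eexists; apply cderiv_plus; eassumption. Qed.

Lemma cdiff_minus f g z : cdiff f z -> cdiff g z -> cdiff (fun w => f w - g w)%C z.
Proof. intros [l H] [k G]; eexists; apply cderiv_minus; eassumption. Qed.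

Lemma cdiff_mult f g z : cdiff f z -> cdiff g z -> cdiff (fun w => f w * g w)%C z.
Proof. intros [l H] [k G]; eexists; apply cderiv_mult; eassumption. Qed.

Lemma cdiff_div f g z : cdiff f z -> cdiff g z -> g z <> 0 -> cdiff (fun w => f w / g w)%C z.
Proof. intros [l H] [k G] Hg; eexists; apply cderiv_div; eassumption. Qed.

Lemma cdiff_comp f g z : cdiff f (g z) -> cdiff g z -> cdiff (fun w => f (g w)) z.
Proof. intros [l H] [k G]; eexists; apply cderiv_comp; eassumption. Qed.

Lemma cdiff_ext_loc f g z del : 0 < del ->
  (forall w, Cmod (w - z) < del -> f w = g w) -> cdiff f z -> cdiff g z.
Proof. intros Hd H [l Hl]; exists l; eapply cderiv_ext_loc; eassumption. Qed.

(** * Continuity of complex-valued functions *)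

Lemma continuous_C_eps (f : C -> C) (z : C) :
  @continuous C_UniformSpace C_UniformSpace f z <->
  forall eps, 0 < eps -> exists del, 0 < del /\ forall w, Cmod (w - z) < del ->
    Cmod (f w - f z) < eps.
Proof.
split.
- intros H eps He.
  assert (He' : 0 < eps / sqrt 2) by (apply Rdiv_lt_0_compat; [lra|apply Rlt_sqrt2_0]).
  destruct (proj1 (filterlim_locally _ _) H (mkposreal _ He')) as [d Hd].
  exists d; split; [apply cond_pos|]. intros w Hw.
  pose proof (C_NormedModule_mixin_compat2 _ _ _ (Hd w (C_NormedModule_mixin_compat1 _ _ _ Hw)))
    as H1.
  simpl in H1. replace (sqrt 2 * (eps / sqrt 2)) with eps in H1; [exact H1|].
  field. pose proof Rlt_sqrt2_0; lra.
- intros H. apply filterlim_locally. intros eps.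
  destruct (H eps (cond_pos eps)) as [d [Hd H1]].
  assert (Hd' : 0 < d / sqrt 2) by (apply Rdiv_lt_0_compat; [lra|apply Rlt_sqrt2_0]).
  exists (mkposreal _ Hd'). intros w Hw.
  apply C_NormedModule_mixin_compat1. apply H1.
  pose proof (C_NormedModule_mixin_compat2 _ _ _ Hw) as H2.
  simpl in H2. replace (sqrt 2 * (d / sqrt 2)) with d in H2; [exact H2|].
  field. pose proof Rlt_sqrt2_0; lra.
Qed.

Lemma cdiff_continuous f z : cdiff f z -> @continuous C_UniformSpace C_UniformSpace f z.
Proof.
intros [l Hl]. apply continuous_C_eps. intros eps He.
destruct (proj1 (cderiv_eps f z l) Hl 1 Rlt_0_1) as [d [Hd H]].
pose proof (Cmod_ge_0 l) as Hl0.
exists (Rmin d (eps / (Cmod l + 1 + 1))). split.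
{ apply Rmin_case; [lra|]. apply Rdiv_lt_0_compat; lra. }
intros w Hw.
pose proof (Rmin_l d (eps / (Cmod l + 1 + 1))). pose proof (Rmin_r d (eps / (Cmod l + 1 + 1))).
assert (H2 : Cmod (w - z) * (Cmod l + 1 + 1) < eps).
{ replace eps with (eps / (Cmod l + 1 + 1) * (Cmod l + 1 + 1)) by (field; lra).
  apply Rmult_lt_compat_r; lra. }
assert (H3 := H w ltac:(lra)).
replace (f w - f z)%C with ((f w - f z - (w - z) * l) + (w - z) * l)%C by ring.
eapply Rle_lt_trans; [apply Cmod_triangle|]. rewrite Cmod_mult.
pose proof (Cmod_ge_0 (w - z)). nra.
Qed.

Section CCont.
Context {U : UniformSpace}.
Implicit Types f g : U -> C_UniformSpace.

Lemma continuous_pairC (f g : U -> R) u : continuous f u -> continuous g u ->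
  continuous (fun x => (f x, g x) : C_UniformSpace) u.
Proof.
intros Hf Hg. apply filterlim_locally. intros eps.
pose proof (proj1 (filterlim_locally _ _) Hf eps) as H1.
pose proof (proj1 (filterlim_locally _ _) Hg eps) as H2.
generalize (filter_and _ _ H1 H2). apply filter_imp. intros x [A B]. now split.
Qed.

Lemma continuous_Re f u : continuous f u -> continuous (fun x => fst (f x) : R) u.
Proof. intros. apply (continuous_comp f (fun z : R * R => fst z)); trivial. apply continuous_fst.
Qed.

Lemma continuous_Im f u : continuous f u -> continuous (fun x => snd (f x) : R) u.
Proof. intros. apply (continuous_comp f (fun z : R * R => snd z)); trivial. apply continuous_snd.
Qed.

Lemma continuous_Cplus f g u : continuous f u -> continuous g u ->
  continuous (fun x => f x + g x : C_UniformSpace)%C u.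
Proof.
intros. apply continuous_pairC.
- apply (continuous_plus (V := R_NormedModule)); now apply continuous_Re.
- apply (continuous_plus (V := R_NormedModule)); now apply continuous_Im.
Qed.

Lemma continuous_Copp f u : continuous f u -> continuous (fun x => - f x : C_UniformSpace)%C u.
Proof.
intros. apply continuous_pairC.
- apply (continuous_opp (V := R_NormedModule)); now apply continuous_Re.
- apply (continuous_opp (V := R_NormedModule)); now apply continuous_Im.
Qed.

Lemma continuous_Cminus f g u : continuous f u -> continuous g u ->
  continuous (fun x => f x - g x : C_UniformSpace)%C u.
Proof. intros. apply continuous_Cplus; trivial. now apply continuous_Copp. Qed.

Lemma continuous_Cmult f g u : continuous f u -> continuous g u ->
  continuous (fun x => f x * g x : C_UniformSpace)%C u.
Proof.
intros. unfold Cmult. apply continuous_pairC.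
- apply (continuous_minus (V := R_NormedModule)).
  + exact (continuous_mult (K := R_AbsRing) _ _ _ (continuous_Re f u H) (continuous_Re g u H0)).
  + exact (continuous_mult (K := R_AbsRing) _ _ _ (continuous_Im f u H) (continuous_Im g u H0)).
- apply (continuous_plus (V := R_NormedModule)).
  + exact (continuous_mult (K := R_AbsRing) _ _ _ (continuous_Re f u H) (continuous_Im g u H0)).
  + exact (continuous_mult (K := R_AbsRing) _ _ _ (continuous_Im f u H) (continuous_Re g u H0)).
Qed.

Lemma continuous_RtoC (f : U -> R) u : continuous f u ->
  continuous (fun x => RtoC (f x) : C_UniformSpace) u.
Proof. intros. apply continuous_pairC; trivial. apply continuous_const. Qed.

Lemma continuous_Cinv f u : continuous f u -> f u <> RtoC 0 ->
  continuous (fun x => / f x : C_UniformSpace)%C u.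
Proof.
intros. apply (continuous_comp f (fun z : C_UniformSpace => (/ z)%C : C_UniformSpace)); trivial.
apply cdiff_continuous. eexists. now apply cderiv_inv_id.
Qed.

Lemma continuous_Cdiv f g u : continuous f u -> continuous g u -> g u <> RtoC 0 ->
  continuous (fun x => f x / g x : C_UniformSpace)%C u.
Proof. intros. apply continuous_Cmult; trivial. now apply continuous_Cinv. Qed.

Lemma continuous_Cmod f u : continuous f u -> continuous (fun x => Cmod (f x)) u.
Proof.
intros. apply (continuous_comp f (fun z : C_UniformSpace => Cmod z)); trivial.
apply filterlim_locally. intros eps.
assert (Hd : 0 < eps / sqrt 2) by (apply Rdiv_lt_0_compat; [apply cond_pos|apply Rlt_sqrt2_0]).
exists (mkposreal _ Hd). intros w Hw.
pose proof (C_NormedModule_mixin_compat2 _ _ _ Hw) as H2. simpl in H2.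
replace (sqrt 2 * (eps / sqrt 2)) with (pos eps) in H2 by (field; pose proof Rlt_sqrt2_0; lra).
apply Rle_lt_trans with (2 := H2).
change (Rabs (Cmod w - Cmod (f u)) <= Cmod (w - f u)).
pose proof (Cmod_triangle_sub w (f u)). pose proof (Cmod_triangle_sub (f u) w).
rewrite (Cmod_sub_rev (f u)) in H1. apply Rabs_le; lra.
Qed.

Lemma continuous_cis (f : U -> R) u : continuous f u ->
  continuous (fun x => cis (f x) : C_UniformSpace) u.
Proof.
intros. apply continuous_pairC.
- apply (continuous_comp f cos); trivial. apply continuous_cos.
- apply (continuous_comp f sin); trivial. apply continuous_sin.
Qed.

Lemma continuous_hol F f u : cdiff F (f u) -> continuous f u ->
  continuous (fun x => F (f x) : C_UniformSpace) u.
Proof. intros. apply (continuous_comp f F); trivial. now apply cdiff_continuous. Qed.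
End CCont.

(** * Exponential, logarithm and the p-th root *)

Lemma Cmod_pair_le (x y : R) : Cmod (x, y) <= Rabs x + Rabs y.
Proof.
unfold Cmod; simpl. rewrite 2!Rmult_1_r.
pose proof (Rabs_pos x); pose proof (Rabs_pos y).
rewrite <- (sqrt_Rsqr (Rabs x + Rabs y)) by lra.
apply sqrt_le_1_alt. unfold Rsqr.
assert (Rabs x * Rabs x = x * x) by (rewrite <- Rabs_mult; apply Rabs_pos_eq; nra).
assert (Rabs y * Rabs y = y * y) by (rewrite <- Rabs_mult; apply Rabs_pos_eq; nra).
nra.
Qed.

Lemma Rabs_fst_le (z : C) : Rabs (fst z) <= Cmod z.
Proof. eapply Rle_trans; [|apply Rmax_Cmod]. apply Rmax_l. Qed.

Lemma Rabs_snd_le (z : C) : Rabs (snd z) <= Cmod z.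
Proof. eapply Rle_trans; [|apply Rmax_Cmod]. apply Rmax_r. Qed.

Lemma exp_taylor1 x : Rabs x <= / 2 -> 0 <= exp x - 1 - x <= 2 * x ^ 2.
Proof.
intros Hx. apply Rabs_le_between in Hx.
pose proof (exp_ineq1_le x). pose proof (exp_ineq1_le (- x)).
assert (exp x * exp (- x) = 1) by (rewrite <- exp_plus, Rplus_opp_r; apply exp_0).
pose proof (exp_pos x). split; [lra|].
assert (exp x * (1 - x) <= 1) by nra. nra.
Qed.

Lemma Rabs_sin_le u : Rabs (sin u) <= Rabs u.
Proof.
destruct (MVT_gen sin 0 u cos) as [c [_ H]].
- intros t _. auto_derive; trivial. ring.
- intros t _. apply continuity_sin.
- rewrite sin_0, 2!Rminus_0_r in H. rewrite H, Rabs_mult.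
  pose proof (COS_bound c). pose proof (Rabs_pos u).
  assert (Rabs (cos c) <= 1) by (apply Rabs_le; lra). nra.
Qed.

Lemma pow2_le_Rabs x y : Rabs x <= Rabs y -> x ^ 2 <= y ^ 2.
Proof. intros. rewrite <- (pow2_abs x), <- (pow2_abs y). apply pow_incr. split;
  [apply Rabs_pos|trivial]. Qed.

Lemma cos_taylor1 y : 0 <= 1 - cos y <= y ^ 2 / 2.
Proof.
pose proof (COS_bound y). split; [lra|].
replace y with (2 * (y / 2)) at 1 by field. rewrite cos_2a_sin.
pose proof (pow2_le_Rabs _ _ (Rabs_sin_le (y / 2))). nra.
Qed.

Lemma sin_taylor1 y : Rabs y <= / 2 -> Rabs (sin y - y) <= y ^ 2.
Proof.
intros Hy.
destruct (MVT_gen (fun t => sin t - t) 0 y (fun t => cos t - 1)) as [c [Hc H]].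
- intros t _. auto_derive; trivial. ring.
- intros t _. apply continuity_pt_minus;
  [apply continuity_sin|apply derivable_continuous_pt, derivable_pt_id].
- rewrite sin_0, Rminus_0_r, (Rminus_0_r y), Rminus_0_r in H. rewrite H, Rabs_mult.
  pose proof (cos_taylor1 c).
  assert (Rabs c <= Rabs y).
  { unfold Rmin, Rmax in Hc. destruct (Rle_dec 0 y).
    - rewrite 2!Rabs_pos_eq by lra. lra.
    - rewrite 2!Rabs_left1 by lra. lra. }
  assert (c ^ 2 <= y ^ 2) by (rewrite <- (pow2_abs c), <- (pow2_abs y); apply pow_incr; split;
    [apply Rabs_pos|lra]).
  rewrite (Rabs_left1 (cos c - 1)) by lra.
  pose proof (Rabs_pos y).
  apply Rle_trans with (y ^ 2 / 2 * Rabs y); [apply Rmult_le_compat_r; lra|]. nra.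
Qed.

Definition cexp (z : C) : C := (RtoC (exp (Re z)) * cis (Im z))%C.

Lemma cis_plus s t : cis (s + t) = (cis s * cis t)%C.
Proof. unfold cis, Cmult; simpl. rewrite cos_plus, sin_plus. f_equal; ring. Qed.

Lemma Cmod_cis t : Cmod (cis t) = 1.
Proof.
unfold cis, Cmod; simpl. apply (eq_trans (y := sqrt 1)); [f_equal|apply sqrt_1].
pose proof (sin2_cos2 t). unfold Rsqr in *. lra.
Qed.

Lemma cexp_plus z w : cexp (z + w) = (cexp z * cexp w)%C.
Proof.
unfold cexp. replace (Re (z + w)) with (Re z + Re w) by reflexivity.
replace (Im (z + w)) with (Im z + Im w) by reflexivity.
rewrite exp_plus, cis_plus, RtoC_mult. ring.
Qed.

Lemma cexp_taylor1 h : Cmod h < / 2 -> Cmod (cexp h - 1 - h) <= 8 * Cmod h ^ 2.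
Proof.
intros Hh. destruct h as [x y].
pose proof (Rabs_fst_le (x, y)) as Hx. pose proof (Rabs_snd_le (x, y)) as Hy. simpl in Hx, Hy.
set (m := Cmod (x, y)) in *.
replace (cexp (x, y) - 1 - (x, y))%C with (exp x * cos y - 1 - x, exp x * sin y - y).
2:{ unfold cexp, cis, Cminus, Cplus, Copp, Cmult, RtoC; simpl. f_equal; ring. }
eapply Rle_trans; [apply Cmod_pair_le|].
pose proof (exp_taylor1 x ltac:(lra)) as He. pose proof (cos_taylor1 y) as Hc.
pose proof (sin_taylor1 y ltac:(lra)) as Hs.
assert (Hx2 : x ^ 2 <= m ^ 2) by (rewrite <- (pow2_abs x); apply pow_incr; split;
  [apply Rabs_pos|lra]).
assert (Hy2 : y ^ 2 <= m ^ 2) by (rewrite <- (pow2_abs y); apply pow_incr; split;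
  [apply Rabs_pos|lra]).
assert (Hm0 : 0 <= m) by apply Cmod_ge_0.
assert (Hex : exp x <= 2) by (apply Rabs_le_between in Hx; nra).
pose proof (exp_pos x).
assert (A : Rabs (exp x * cos y - 1 - x) <= 3 * m ^ 2).
{ replace (exp x * cos y - 1 - x) with ((exp x - 1 - x) + - (exp x * (1 - cos y))) by ring.
  eapply Rle_trans; [apply Rabs_triang|]. rewrite Rabs_Ropp, Rabs_mult, 3!Rabs_pos_eq by lra. nra. }
assert (B : Rabs (exp x * sin y - y) <= 5 * m ^ 2).
{ replace (exp x * sin y - y) with ((exp x - 1) * sin y + (sin y - y)) by ring.
  eapply Rle_trans; [apply Rabs_triang|]. rewrite Rabs_mult.
  assert (Rabs (exp x - 1) <= 2 * m) by (apply Rabs_le; apply Rabs_le_between in Hx; nra).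
  assert (Rabs (sin y) <= 2 * m).
  { replace (sin y) with ((sin y - y) + y) by ring. eapply Rle_trans; [apply Rabs_triang|]. nra. }
  pose proof (Rabs_pos (sin y)). pose proof (Rabs_pos (exp x - 1)). nra. }
lra.
Qed.

Lemma cderiv_cexp z : cderiv cexp z (cexp z).
Proof.
apply cderiv_quad with (/ 2) (Cmod (cexp z) * 8); [lra|].
intros w Hw. replace w with (z + (w - z))%C at 1 by ring.
rewrite cexp_plus.
replace (cexp z * cexp (w - z) - cexp z - (w - z) * cexp z)%C with (cexp z * (cexp (w - z)
  - 1 - (w - z)))%C by ring.
rewrite Cmod_mult, Rmult_assoc. apply Rmult_le_compat_l; [apply Cmod_ge_0|].
now apply cexp_taylor1.
Qed.

Definition clog (z : C) : C := (ln (Cmod z), carg z).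

Lemma Cmod_pos_of_slit z : 0 < Cmod z + Re z -> 0 < Cmod z.
Proof. intros H. pose proof (Rabs_fst_le z). pose proof (Rle_abs (fst z)). unfold Re in H. lra. Qed.

(** The condition |z| + Re z > 0 describes C minus the closed negative real axis. *)
Lemma slit_open z w : Cmod (w - z) < (Cmod z + Re z) / 2 -> 0 < Cmod w + Re w.
Proof.
intros H. pose proof (Cmod_triangle_sub z w) as H0. rewrite Cmod_sub_rev in H0.
pose proof (Rabs_fst_le (w - z)) as H3. simpl in H3. apply Rabs_le_between in H3.
unfold Re in *. lra.
Qed.

Lemma cexp_clog z : 0 < Cmod z + Re z -> cexp (clog z) = z.
Proof.
intros H. unfold cexp, clog; simpl. rewrite exp_ln by now apply Cmod_pos_of_slit.
symmetry. apply (cargP z H).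
Qed.

Lemma continuous_clog z : 0 < Cmod z + Re z -> @continuous C_UniformSpace C_UniformSpace clog z.
Proof.
intros H. pose proof (Cmod_pos_of_slit z H) as Hm. unfold clog, carg.
assert (Hc : @continuous C_UniformSpace R_UniformSpace Cmod z)
  by (apply (continuous_Cmod (fun w => w)); apply continuous_id).
apply continuous_pairC.
- apply (continuous_comp Cmod ln); trivial.
  apply continuity_pt_filterlim, derivable_continuous_pt. exists (/ Cmod z).
  now apply derivable_pt_lim_ln.
- apply (continuous_mult (K := R_AbsRing)); [apply continuous_const|].
  apply (continuous_comp (fun w : C_UniformSpace => Im w / (Cmod w + Re w)) atan).
  + apply (continuous_mult (K := R_AbsRing)); [apply (continuous_Im (fun w => w)), continuous_id|].
    apply (continuous_comp (fun w : C_UniformSpace => Cmod w + Re w) Rinv).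
    * apply (continuous_plus (V := R_NormedModule)); trivial.
      apply (continuous_Re (fun w => w)), continuous_id.
    * apply continuous_Rinv. lra.
  + apply continuity_pt_filterlim, derivable_continuous_pt, derivable_pt_atan.
Qed.

(** The rule for inverse functions: [cexp] has the non-zero derivative z at clog z, and [clog]
    is continuous. *)
Lemma cdiff_clog z : 0 < Cmod z + Re z -> cdiff clog z.
Proof.
intros H. pose proof (Cmod_pos_of_slit z H) as Hm.
assert (Hz : z <> 0) by now apply Cmod_gt_0.
exists (/ z)%C. apply cderiv_eps. intros eps He.
set (u0 := clog z).
assert (Eu0 : cexp u0 = z) by now apply cexp_clog.
(* With u = clog w and u0 = clog z, the error of w - z = (u - u0) z + o(u - u0) is at most
   e1 |u - u0|.  The bound e1 <= |z| / 2 gives |u - u0| <= 2 |w - z| / |z|. *)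
set (e1 := Rmin (Cmod z / 2) (eps * Cmod z ^ 2 / 2)).
assert (He1 : 0 < e1) by (apply Rmin_case; [lra|]; apply Rdiv_lt_0_compat;
  [apply Rmult_lt_0_compat; [lra|apply pow_lt; lra]|lra]).
pose proof (Rmin_l (Cmod z / 2) (eps * Cmod z ^ 2 / 2)) as Hl.
pose proof (Rmin_r (Cmod z / 2) (eps * Cmod z ^ 2 / 2)) as Hr. fold e1 in Hl, Hr.
destruct (proj1 (cderiv_eps _ _ _) (cderiv_cexp u0) e1 He1) as [d1 [Hd1 D1]].
destruct (proj1 (continuous_C_eps _ _) (continuous_clog z H) d1 Hd1) as [d2 [Hd2 D2]].
set (d3 := (Cmod z + Re z) / 2).
exists (Rmin d2 d3). split; [apply Rmin_case; unfold d3; lra|].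
intros w Hw. pose proof (Rmin_l d2 d3). pose proof (Rmin_r d2 d3).
assert (Hws : 0 < Cmod w + Re w).
{ apply (slit_open z); unfold d3 in *; lra. }
specialize (D2 w ltac:(lra)). specialize (D1 _ D2). fold u0 in D1.
rewrite cexp_clog, Eu0 in D1 by assumption.
set (v := (clog w - u0)%C) in *.
assert (Hv : Cmod v * (Cmod z / 2) <= Cmod (w - z)).
{ pose proof (Cmod_triangle_sub (v * z) (w - z)) as H4. rewrite Cmod_mult in H4.
  rewrite (Cmod_sub_rev (v * z)) in H4.
  pose proof (Cmod_ge_0 v).
  nra. }
change (Cmod (v - (w - z) * / z) <= eps * Cmod (w - z)).
replace (v - (w - z) * / z)%C with (- (w - z - v * z) / z)%C by (field; auto).
rewrite Cmod_div, Cmod_opp by auto.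
apply Rmult_le_reg_r with (Cmod z); [lra|]. unfold Rdiv.
rewrite Rmult_assoc, Rinv_l, Rmult_1_r by lra.
eapply Rle_trans; [exact D1|]. pose proof (Cmod_ge_0 v).
apply Rle_trans with (eps * Cmod z ^ 2 / 2 * Cmod v); [apply Rmult_le_compat_r; lra|].
replace (eps * Cmod z ^ 2 / 2 * Cmod v) with (eps * Cmod z * (Cmod v * (Cmod z / 2))) by field.
apply Rle_trans with (eps * Cmod z * Cmod (w - z)); [|right; ring].
apply Rmult_le_compat_l; [nra|assumption].
Qed.

Lemma rpow_pos x y : 0 < x -> rpow x y = Rpower x y.
Proof. intros. unfold rpow. destruct (Req_EM_T x 0); [lra|reflexivity]. Qed.

Lemma croot_cexp p z : 0 < Cmod z + Re z -> p <> 0 -> croot p z = cexp (clog z * RtoC (/ p)).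
Proof.
intros H Hp. unfold croot, cexp, clog. rewrite rpow_pos by now apply Cmod_pos_of_slit.
unfold Rpower. simpl. f_equal; [f_equal; f_equal|f_equal]; field; trivial.
Qed.

Lemma cdiff_croot p z : 0 < Cmod z + Re z -> p <> 0 -> cdiff (croot p) z.
Proof.
intros H Hp.
apply cdiff_ext_loc with (fun w => cexp (clog w * RtoC (/ p))) ((Cmod z + Re z) / 2); [lra| |].
- intros w Hw. symmetry. apply croot_cexp; trivial.
  now apply (slit_open z).
- apply (cdiff_comp cexp (fun w => clog w * RtoC (/ p))%C).
  + eexists; apply cderiv_cexp.
  + apply (cdiff_mult clog (fun _ => RtoC (/ p))); [now apply cdiff_clog|apply cdiff_const].
Qed.

(** * Integrals of complex-valued curves *)

Definition CInt (g : R -> C) (a b : R) : C :=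
  (RInt (fun t => fst (g t)) a b, RInt (fun t => snd (g t)) a b).

Definition cont_on (g : R -> C) (a b : R) : Prop :=
  forall t, a <= t <= b -> @continuous R_UniformSpace C_UniformSpace g t.

(** The value of [RInt] has type the carrier of a normed module; [ring] and [field] expect the
    type R itself. *)
Ltac asR := match goal with |- @eq _ ?x ?y => change (@eq R x y) end.

Section CIntTheory.
Context (a b : R).
Context (Hab : a <= b).

Lemma ex_RInt_cont (f : R -> R) : (forall t, a <= t <= b -> continuous f t) -> ex_RInt f a b.
Proof. intros H. apply (ex_RInt_continuous (V := R_CompleteNormedModule)).
rewrite Rmin_left, Rmax_right by assumption. exact H. Qed.

Lemma ex_fst g : cont_on g a b -> ex_RInt (fun t => fst (g t)) a b.
Proof. intros H; apply ex_RInt_cont; intros t Ht. apply continuous_Re; auto. Qed.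

Lemma ex_snd g : cont_on g a b -> ex_RInt (fun t => snd (g t)) a b.
Proof. intros H; apply ex_RInt_cont; intros t Ht. apply continuous_Im; auto. Qed.

Lemma CInt_ext f g : (forall t, a <= t <= b -> f t = g t) -> CInt f a b = CInt g a b.
Proof.
intros H. unfold CInt. f_equal; apply RInt_ext; rewrite Rmin_left, Rmax_right by assumption;
 intros t Ht; rewrite H by lra; reflexivity.
Qed.

Lemma CInt_plus f g : cont_on f a b -> cont_on g a b ->
  CInt (fun t => f t + g t)%C a b = (CInt f a b + CInt g a b)%C.
Proof.
intros Hf Hg. unfold CInt, Cplus; simpl. f_equal.
- apply (RInt_plus (V := R_CompleteNormedModule)); now apply ex_fst.
- apply (RInt_plus (V := R_CompleteNormedModule)); now apply ex_snd.
Qed.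

Lemma RInt_extR (f g : R -> R) : (forall t, a <= t <= b -> f t = g t) -> RInt f a b = RInt g a b.
Proof.
intros H. apply RInt_ext. rewrite Rmin_left, Rmax_right by assumption. intros t Ht. apply H; lra.
Qed.

Lemma RInt_lincomb p q (f g : R -> R) : ex_RInt f a b -> ex_RInt g a b ->
  RInt (fun t => p * f t + q * g t) a b = p * RInt f a b + q * RInt g a b.
Proof.
intros Hf Hg.
pose proof (ex_RInt_scal (V := R_NormedModule) f a b p Hf) as Hf'.
pose proof (ex_RInt_scal (V := R_NormedModule) g a b q Hg) as Hg'.
etransitivity; [exact (RInt_plus (V := R_CompleteNormedModule) _ _ a b Hf' Hg')|].
rewrite 2!(RInt_scal (V := R_CompleteNormedModule)) by assumption. reflexivity.
Qed.

Lemma ex_RInt_scalR k (f : R -> R) : ex_RInt f a b -> ex_RInt (fun t => k * f t) a b.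
Proof. exact (ex_RInt_scal (V := R_NormedModule) f a b k). Qed.

Lemma RInt_scalR k (f : R -> R) : ex_RInt f a b -> RInt (fun t => k * f t) a b = k * RInt f a b.
Proof. exact (RInt_scal (V := R_CompleteNormedModule) f a b k). Qed.

Lemma RInt_constR c : RInt (fun _ => c) a b = (b - a) * c.
Proof. exact (RInt_const (V := R_CompleteNormedModule) a b c). Qed.

Lemma ex_RInt_lincomb p q (f g : R -> R) : ex_RInt f a b -> ex_RInt g a b ->
  ex_RInt (fun t => p * f t + q * g t) a b.
Proof.
intros Hf Hg.
exact (ex_RInt_plus (V := R_NormedModule) _ _ a b (ex_RInt_scal (V := R_NormedModule) f a b p Hf)
  (ex_RInt_scal (V := R_NormedModule) g a b q Hg)).
Qed.

Lemma CInt_scal c f : cont_on f a b -> CInt (fun t => c * f t)%C a b = (c * CInt f a b)%C.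
Proof.
intros Hf. pose proof (ex_fst f Hf). pose proof (ex_snd f Hf).
unfold CInt, Cmult; simpl. f_equal.
- rewrite (RInt_extR _ (fun t => fst c * fst (f t) + (- snd c) * snd (f t))) by (intros; ring).
  rewrite RInt_lincomb by assumption. asR; ring.
- now apply RInt_lincomb.
Qed.

Lemma CInt_minus f g : cont_on f a b -> cont_on g a b ->
  CInt (fun t => f t - g t)%C a b = (CInt f a b - CInt g a b)%C.
Proof.
intros Hf Hg. unfold CInt, Cminus, Cplus, Copp; simpl. f_equal.
- apply (RInt_minus (V := R_CompleteNormedModule)); now apply ex_fst.
- apply (RInt_minus (V := R_CompleteNormedModule)); now apply ex_snd.
Qed.

Lemma CInt_const c : CInt (fun _ => c) a b = (RtoC (b - a) * c)%C.
Proof.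
unfold CInt. rewrite 2!RInt_constR. unfold Cmult, RtoC; simpl. f_equal; ring.
Qed.

Lemma ex_Cmod g : cont_on g a b -> ex_RInt (fun t => Cmod (g t)) a b.
Proof. intros H; apply ex_RInt_cont; intros t Ht. apply (continuous_Cmod g); auto. Qed.

(** With I the integral, |I|^2 is the integral of Re (conj I * g), which is at most |I| times
    the integral of |g|. *)
Lemma Cmod_CInt_le g : cont_on g a b -> Cmod (CInt g a b) <= RInt (fun t => Cmod (g t)) a b.
Proof.
intros Hg. set (I := CInt g a b).
assert (H0 : 0 <= RInt (fun t => Cmod (g t)) a b).
{ apply RInt_ge_0; [assumption|now apply ex_Cmod|intros; apply Cmod_ge_0]. }
destruct (Req_dec (Cmod I) 0) as [E|E]; [lra|].
pose proof (Cmod_ge_0 I).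
apply Rmult_le_reg_l with (Cmod I); [lra|].
assert (E1 : Cmod I * Cmod I = RInt (fun t => fst I * fst (g t) + snd I * snd (g t)) a b).
{ replace (Cmod I * Cmod I) with (fst I * fst I + snd I * snd I)
    by (pose proof (Cmod2_alt I) as E1; unfold Re, Im in E1; lra).
  symmetry. apply RInt_lincomb; [now apply ex_fst|now apply ex_snd]. }
rewrite E1. rewrite <- (RInt_scal (V := R_CompleteNormedModule)) by now apply ex_Cmod.
apply RInt_le; [assumption| | |].
- apply ex_RInt_lincomb; [now apply ex_fst|now apply ex_snd].
- apply (ex_RInt_scal (V := R_NormedModule)); now apply ex_Cmod.
- intros t _. change (scal (Cmod I) (Cmod (g t))) with (Cmod I * Cmod (g t)).
  rewrite <- (Cmod_conj I), <- Cmod_mult.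
  eapply Rle_trans; [|apply Rabs_fst_le]. eapply Rle_trans; [|apply Rle_abs].
  unfold Cconj, Cmult; simpl. right; ring.
Qed.

Lemma CInt_bound g M : cont_on g a b -> (forall t, a <= t <= b -> Cmod (g t) <= M) ->
  Cmod (CInt g a b) <= (b - a) * M.
Proof.
intros Hg HM. eapply Rle_trans; [now apply Cmod_CInt_le|].
apply Rle_trans with (RInt (fun _ => M) a b).
- apply RInt_le; [assumption|now apply ex_Cmod|apply ex_RInt_const|intros; apply HM; lra].
- rewrite RInt_constR. lra.
Qed.
End CIntTheory.

Lemma CInt_Chasles g a b c : a <= b -> b <= c -> cont_on g a c ->
  CInt g a c = (CInt g a b + CInt g b c)%C.
Proof.
intros Hab Hbc Hg.
assert (cont_on g a b) by (intros t Ht; apply Hg; lra).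
assert (cont_on g b c) by (intros t Ht; apply Hg; lra).
unfold CInt, Cplus; simpl. f_equal.
- exact (eq_sym (RInt_Chasles (V := R_CompleteNormedModule) (fun t => fst (g t)) a b c
    (ex_fst a b Hab g H) (ex_fst b c Hbc g H0))).
- exact (eq_sym (RInt_Chasles (V := R_CompleteNormedModule) (fun t => snd (g t)) a b c
    (ex_snd a b Hab g H) (ex_snd b c Hbc g H0))).
Qed.

(** * Goursat's theorem on rectangles *)

(** The contour integral of H along the boundary of [x, x + w] x [y, y + h], counterclockwise. *)
Definition rect_int (H : C -> C) (x y w h : R) : C :=
  (CInt (fun t => H (t, y)) x (x + w) + Ci * CInt (fun t => H ((x + w)%R, t)) y (y + h)
   - CInt (fun t => H (t, (y + h)%R)) x (x + w) - Ci * CInt (fun t => H (x, t)) y (y + h))%C.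

Definition diff_rect (H : C -> C) x y w h :=
  forall s t, x <= s <= x + w -> y <= t <= y + h -> cdiff H (s, t).

Lemma cont_on_hor H x y w h t : diff_rect H x y w h -> y <= t <= y + h ->
  cont_on (fun s => H (s, t)) x (x + w).
Proof.
intros HD Ht s Hs. apply (continuous_hol H (fun s : R_UniformSpace => (s, t) : C)); [now apply HD|].
apply continuous_pairC; [apply continuous_id|apply continuous_const].
Qed.

Lemma cont_on_ver H x y w h s : diff_rect H x y w h -> x <= s <= x + w ->
  cont_on (fun t => H (s, t)) y (y + h).
Proof.
intros HD Hs t Ht. apply (continuous_hol H (fun t : R_UniformSpace => (s, t) : C)); [now apply HD|].
apply continuous_pairC; [apply continuous_const|apply continuous_id].
Qed.

Lemma rect_int_split H x y w h : 0 <= w -> 0 <= h -> diff_rect H x y (2 * w) (2 * h) ->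
  rect_int H x y (2 * w) (2 * h) =
  (rect_int H x y w h + rect_int H (x + w) y w h + rect_int H x (y + h) w h + rect_int H (x + w)
    (y + h) w h)%C.
Proof.
intros Hw Hh HD. unfold rect_int.
rewrite (CInt_Chasles (fun t => H (t, y)) x (x + w)) by (lra || (eapply cont_on_hor;
  [exact HD|lra])).
rewrite (CInt_Chasles (fun t => H (t, y + 2 * h)) x (x + w)) by (lra || (eapply cont_on_hor;
  [exact HD|lra])).
rewrite (CInt_Chasles (fun t => H (x, t)) y (y + h)) by (lra || (eapply cont_on_ver;
  [exact HD|lra])).
rewrite (CInt_Chasles (fun t => H (x + 2 * w, t)) y (y + h)) by (lra || (eapply cont_on_ver;
  [exact HD|lra])).
replace (x + 2 * w) with (x + w + w) by ring. replace (y + 2 * h) with (y + h + h) by ring.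
ring.
Qed.

Lemma rect_int_affine (al be : C) x y w h : 0 <= w -> 0 <= h ->
  rect_int (fun z => al + be * z)%C x y w h = 0.
Proof.
intros Hw Hh.
assert (Hlin : forall a p q d, 0 <= d ->
  CInt (fun t => p + q * RtoC t)%C a (a + d) = (RtoC d * p + RtoC (d * (a + d / 2)) * q)%C).
{ intros a p q d Hd. assert (Hid : cont_on RtoC a (a + d)) by (intros t _;
  apply (continuous_RtoC (fun t => t)), continuous_id).
  rewrite CInt_plus, CInt_const, CInt_scal; try lra; trivial.
  - replace (CInt RtoC a (a + d)) with (RtoC (d * (a + d / 2))).
    { replace (a + d - a) with d by ring. ring. }
    unfold CInt, RtoC; simpl. f_equal; symmetry.
    + replace (d * (a + d / 2)) with ((a + d) ^ 2 / 2 - a ^ 2 / 2) by field.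
      apply is_RInt_unique. apply (is_RInt_derive (V := R_CompleteNormedModule)
        (fun t => t ^ 2 / 2)).
      * intros t _. auto_derive; trivial. field.
      * intros t _. apply continuous_id.
    + rewrite RInt_constR. asR; ring.
  - intros t _. apply continuous_const.
  - intros t Ht. apply continuous_Cmult; [apply continuous_const|now apply Hid]. }
unfold rect_int.
rewrite (CInt_ext x (x + w) ltac:(lra) _ (fun t => (al + be * (RtoC y * Ci)) + be * RtoC t)%C).
2:{ intros t _. unfold Ci, RtoC, Cmult, Cplus. destruct al, be; simpl. f_equal; ring. }
rewrite (CInt_ext x (x + w) ltac:(lra) (fun t => _ + be * (t,
  (y + h)%R))%C (fun t => (al + be * (RtoC (y + h) * Ci)) + be * RtoC t)%C).
2:{ intros t _. unfold Ci, RtoC, Cmult, Cplus. destruct al, be; simpl. f_equal; ring. }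
rewrite (CInt_ext y (y + h) ltac:(lra) _ (fun t => (al + be * RtoC (x + w)) + (be * Ci)
  * RtoC t)%C).
2:{ intros t _. unfold Ci, RtoC, Cmult, Cplus. destruct al, be; simpl. f_equal; ring. }
rewrite (CInt_ext y (y + h) ltac:(lra) (fun t => _ + be * (x, t))%C (fun t => (al + be * RtoC x)
  + (be * Ci) * RtoC t)%C).
2:{ intros t _. unfold Ci, RtoC, Cmult, Cplus. destruct al, be; simpl. f_equal; ring. }
rewrite !Hlin by assumption.
assert (Hi : (Ci * Ci = - RtoC 1)%C) by (unfold Ci, RtoC, Cmult, Copp; simpl; f_equal; ring).
unfold Rdiv. rewrite !RtoC_mult, !RtoC_plus, !RtoC_mult.
ring [Hi].
Qed.

Lemma rect_int_minus F G x y w h : 0 <= w -> 0 <= h -> diff_rect F x y w h -> diff_rect G x y w h ->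
  rect_int (fun z => F z - G z)%C x y w h = (rect_int F x y w h - rect_int G x y w h)%C.
Proof.
intros Hw Hh HF HG. unfold rect_int.
rewrite !CInt_minus by match goal with
  | |- _ <= _ => lra
  | |- cont_on _ x _ => eapply cont_on_hor; [eassumption|lra]
  | |- _ => eapply cont_on_ver; [eassumption|lra]
  end.
ring.
Qed.

Lemma rect_int_bound H x y w h M : 0 <= w -> 0 <= h -> diff_rect H x y w h ->
  (forall s t, x <= s <= x + w -> y <= t <= y + h -> Cmod (H (s, t)) <= M) ->
  Cmod (rect_int H x y w h) <= 2 * (w + h) * M.
Proof.
intros Hw Hh HD HM. unfold rect_int.
assert (A : forall t, y <= t <= y + h -> Cmod (CInt (fun s => H (s, t)) x (x + w)) <= w * M).
{ intros t Ht. replace (w * M) with ((x + w - x) * M) by ring. apply CInt_bound;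
  [lra|eapply cont_on_hor; eauto|auto]. }
assert (B : forall s, x <= s <= x + w -> Cmod (CInt (fun t => H (s, t)) y (y + h)) <= h * M).
{ intros s Hs. replace (h * M) with ((y + h - y) * M) by ring. apply CInt_bound;
  [lra|eapply cont_on_ver; eauto|auto]. }
assert (Ei : forall z, Cmod (Ci * z) = Cmod z) by (intros; rewrite Cmod_mult, Cmod_Ci; ring).
eapply Rle_trans; [apply Cmod_minus_le|]. rewrite Ei.
eapply Rle_trans; [apply Rplus_le_compat_r, Cmod_minus_le|].
eapply Rle_trans; [apply Rplus_le_compat_r, Rplus_le_compat_r, Cmod_triangle|]. rewrite Ei.
pose proof (A y ltac:(lra)). pose proof (A (y + h) ltac:(lra)).
pose proof (B x ltac:(lra)). pose proof (B (x + w) ltac:(lra)). lra.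
Qed.

Lemma nested_halving_limit (u : nat -> R) d : 0 <= d ->
  (forall n, u n <= u (S n) /\ u (S n) + d / 2 ^ (S n) <= u n + d / 2 ^ n) ->
  exists X, forall n, u n <= X <= u n + d / 2 ^ n.
Proof.
intros Hd H.
assert (Hp : forall n, 0 <= d / 2 ^ n) by (intros; apply Rdiv_le_0_compat; [lra|apply pow_lt; lra]).
assert (A : forall k n, u n <= u (k + n)%nat).
{ induction k; intros n; simpl; [lra|]. pose proof (IHk n). pose proof (H (k + n)%nat). lra. }
assert (B : forall k n, u (k + n)%nat + d / 2 ^ (k + n) <= u n + d / 2 ^ n).
{ induction k; intros n; [simpl; lra|]. pose proof (IHk n). pose proof (H (k + n)%nat).
  change (S k + n)%nat with (S (k + n)). lra. }
assert (E : forall n m, u n <= u m + d / 2 ^ m).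
{ intros n m. pose proof (A m n). pose proof (B n m). rewrite (Nat.add_comm n m) in H1.
  pose proof (Hp (m + n)%nat). lra. }
destruct (completeness (fun x => exists n, x = u n)) as [X [HX1 HX2]].
- exists (u 0%nat + d / 2 ^ 0). intros x [n ->]. apply E.
- exists (u 0%nat). now exists 0%nat.
- exists X. intros n. split; [apply HX1; now exists n|]. apply HX2. intros x [m ->]. apply E.
Qed.

Section Goursat.
Context (H : C -> C) (x0 y0 w h c : R).

(** Testing three quarters suffices: the four integrals add up to the one over the whole
    rectangle, so if these three are small, the fourth is not. *)
Definition bad_quarter (n : nat) (q : R * R) : R * R :=
  let x := fst q in let y := snd q in
  let w' := w / 2 ^ S n in let h' := h / 2 ^ S n in
  let big x y := Rle_dec (c / 4 ^ S n) (Cmod (rect_int H x y w' h')) in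
  if big x y then (x, y) else if big (x + w') y then (x + w', y)
  else if big x (y + h') then (x, y + h') else (x + w', y + h').

Fixpoint bad_rect (n : nat) : R * R :=
  match n with O => (x0, y0) | S n => bad_quarter n (bad_rect n) end.
End Goursat.

(** Bisection.  If the integral is c in modulus, some quarter carries at least c / 4, and so
    on; the rectangles shrink to a point where H is affine up to o(distance).  Affine functions
    integrate to 0, so the n-th integral is o(4^(-n)), a contradiction. *)
Lemma goursat_rect H x0 y0 w h : 0 <= w -> 0 <= h -> diff_rect H x0 y0 w h ->
  rect_int H x0 y0 w h = 0.
Proof.
intros Hw Hh HD.
destruct (Ceq_dec (rect_int H x0 y0 w h) 0) as [E|E]; [exact E|exfalso].
assert (Hc : 0 < Cmod (rect_int H x0 y0 w h)) by now apply Cmod_gt_0. clear E.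
set (c := Cmod (rect_int H x0 y0 w h)) in *.
set (q := bad_rect H x0 y0 w h c).
assert (Hp : forall n, 0 < 2 ^ n) by (intros; apply pow_lt; lra).
assert (Hwn : forall n, 0 <= w / 2 ^ n) by (intros; apply Rdiv_le_0_compat; auto).
assert (Hhn : forall n, 0 <= h / 2 ^ n) by (intros; apply Rdiv_le_0_compat; auto).
assert (Hw2 : forall n, w / 2 ^ n = 2 * (w / 2 ^ S n)) by (intros; simpl; field; specialize (Hp n);
  lra).
assert (Hh2 : forall n, h / 2 ^ n = 2 * (h / 2 ^ S n)) by (intros; simpl; field; specialize (Hp n);
  lra).
assert (Hstep : forall n,
  (fst (q (S n)) = fst (q n) \/ fst (q (S n)) = fst (q n) + w / 2 ^ S n) /\
  (snd (q (S n)) = snd (q n) \/ snd (q (S n)) = snd (q n) + h / 2 ^ S n)).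
{ intros n. unfold q. simpl bad_rect. unfold bad_quarter.
  repeat destruct (Rle_dec _ _); simpl; auto. }
assert (Hin : forall n, x0 <= fst (q n) /\ fst (q n) + w / 2 ^ n <= x0 + w /\
   y0 <= snd (q n) /\ snd (q n) + h / 2 ^ n <= y0 + h).
{ induction n as [|n IH]; [simpl; lra|].
  destruct (Hstep n) as [[-> | ->] [-> | ->]]; pose proof (Hwn (S n)); pose proof (Hhn (S n));
    rewrite Hw2, Hh2 in IH; lra. }
assert (HDn : forall n, diff_rect H (fst (q n)) (snd (q n)) (w / 2 ^ n) (h / 2 ^ n)).
{ intros n s t Hs Ht. apply HD; pose proof (Hin n); lra. }
assert (Hbig : forall n, c / 4 ^ n <= Cmod (rect_int H (fst (q n)) (snd (q n)) (w / 2 ^ n)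
  (h / 2 ^ n))).
{ induction n as [|n IH]; [simpl; rewrite !Rdiv_1_r; unfold c; lra|].
  rewrite Hw2, Hh2, rect_int_split in IH; auto.
  2:{ rewrite <- Hw2, <- Hh2. apply HDn. }
  set (x := fst (q n)) in *. set (y := snd (q n)) in *.
  unfold q. simpl bad_rect. unfold bad_quarter. fold q. fold x. fold y.
  destruct (Rle_dec _ _) as [h1|h1]; [exact h1|].
  destruct (Rle_dec _ _) as [h2|h2]; [exact h2|].
  destruct (Rle_dec _ _) as [h3|h3]; [exact h3|].
  cbn [fst snd].
  assert (E4 : c / 4 ^ n = 4 * (c / 4 ^ S n)) by (simpl; field; apply pow_nonzero; lra).
  rewrite E4 in IH.
  match type of IH with _ <= Cmod (?A + ?B + ?D + ?E) =>
    pose proof (Cmod_triangle (A + B + D) E); pose proof (Cmod_triangle (A + B) D);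
      pose proof (Cmod_triangle A B) end.
  lra. }
destruct (nested_halving_limit (fun n => fst (q n)) w Hw) as [X HX].
{ intros n. destruct (Hstep n) as [[-> | ->] _]; pose proof (Hw2 n); pose proof (Hwn (S n)); lra. }
destruct (nested_halving_limit (fun n => snd (q n)) h Hh) as [Y HY].
{ intros n. destruct (Hstep n) as [_ [-> | ->]]; pose proof (Hh2 n); pose proof (Hhn (S n)); lra. }
destruct (HD X Y) as [l Hl].
{ pose proof (HX 0%nat) as HX0. simpl in HX0. lra. }
{ pose proof (HY 0%nat) as HY0. simpl in HY0. lra. }
(* Chosen so that the error bound 2 (w + h)^2 / 4^n * c / (2 S2) is less than c / 4^n. *)
set (S2 := 2 * (w + h + 1) ^ 2).
assert (HS2 : 0 < S2) by (unfold S2; nra).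
destruct (proj1 (cderiv_eps _ _ _) Hl (c / (2 * S2)) ltac:(apply Rdiv_lt_0_compat;
  lra)) as [d [Hd Hlin]].
assert (Hn : exists n, (w + h) / 2 ^ n < d).
{ destruct (pow_lt_1_zero (/ 2) ltac:(rewrite Rabs_pos_eq;
  lra) (d / (w + h + 1)) ltac:(apply Rdiv_lt_0_compat; lra)) as [n Hn].
  exists n. specialize (Hn n (Nat.le_refl n)). rewrite Rabs_pos_eq, pow_inv in Hn by (apply pow_le;
    lra).
  apply Rmult_lt_compat_r with (r := w + h + 1) in Hn; [|lra].
  replace (d / (w + h + 1) * (w + h + 1)) with d in Hn by (field; lra).
  unfold Rdiv. pose proof (Rinv_0_lt_compat _ (Hp n)). nra. }
destruct Hn as [n Hn].
set (x := fst (q n)) in *. set (y := snd (q n)) in *.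
specialize (HX n). specialize (HY n). simpl in HX, HY. fold x in HX. fold y in HY.
set (wn := w / 2 ^ n) in *. set (hn := h / 2 ^ n) in *.
assert (Ewh : (w + h) / 2 ^ n = wn + hn) by (unfold wn, hn; field; specialize (Hp n); lra).
assert (Hwn0 : 0 <= wn) by apply Hwn. assert (Hhn0 : 0 <= hn) by apply Hhn.
set (A := (H (X, Y) - l * (X, Y))%C).
assert (HA : diff_rect (fun z => A + l * z)%C x y wn hn).
{ intros s t _ _. apply (cdiff_plus (fun _ => A) (fun z => l * z)%C); [apply cdiff_const|].
  apply (cdiff_mult (fun _ => l) (fun z => z)); [apply cdiff_const|apply cdiff_id]. }
pose proof (rect_int_minus H (fun z => A + l * z)%C x y wn hn Hwn0 Hhn0 (HDn n) HA) as E.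
rewrite rect_int_affine in E by assumption.
assert (Hdist : forall s t, x <= s <= x + wn -> y <= t <= y + hn ->
  Cmod ((s, t) - (X, Y)) <= wn + hn).
{ intros s t Hs Ht. unfold Cminus, Cplus, Copp; simpl. eapply Rle_trans; [apply Cmod_pair_le|].
  apply Rplus_le_compat; apply Rabs_le; lra. }
assert (Hfin : Cmod (rect_int (fun z => H z - (A + l * z))%C x y wn hn) <= 2 * (wn + hn)
  * (c / (2 * S2) * (wn + hn))).
{ apply rect_int_bound; trivial.
  - intros s t Hs Ht. apply (cdiff_minus H (fun z => A + l * z)%C);
    [now apply (HDn n)|now apply HA].
  - intros s t Hs Ht. unfold A.
    replace (H (s, t) - (H (X, Y) - l * (X, Y) + l * (s, t)))%C with (H (s, t) - H (X, Y) - ((s, t)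
      - (X, Y)) * l)%C by ring.
    specialize (Hdist s t Hs Ht). eapply Rle_trans; [apply Hlin; lra|].
    apply Rmult_le_compat_l; [|assumption]. apply Rlt_le, Rdiv_lt_0_compat; lra. }
rewrite E in Hfin. replace (rect_int H x y wn hn - 0)%C with (rect_int H x y wn hn) in Hfin by ring.
specialize (Hbig n). fold x y wn hn in Hbig.
assert (E4 : 4 ^ n = 2 ^ n * 2 ^ n) by (rewrite <- Rpow_mult_distr; f_equal; lra).
assert (E5 : 2 * (wn + hn) * (c / (2 * S2) * (wn + hn)) = c / 4 ^ n * ((w + h) ^ 2 / S2)).
{ rewrite <- Ewh, E4. field. specialize (Hp n). lra. }
assert ((w + h) ^ 2 / S2 < 1).
{ apply Rmult_lt_reg_r with S2; [lra|]. unfold Rdiv. rewrite Rmult_assoc, Rinv_l by lra. unfold S2.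
  nra. }
assert (0 < c / 4 ^ n) by (apply Rdiv_lt_0_compat; [lra|apply pow_lt; lra]).
nra.
Qed.

(** * Integrals over circles and the mean value property *)

Definition circ (r t : R) : C := (RtoC r * cis t)%C.

Lemma Cmod_circ r t : Cmod (circ r t) = Rabs r.
Proof. unfold circ. rewrite Cmod_mult, Cmod_cis, Cmod_R. ring. Qed.

Lemma Cmod_circ_pos r t : 0 <= r -> Cmod (circ r t) = r.
Proof. intros. rewrite Cmod_circ. now apply Rabs_pos_eq. Qed.

Definition ccurve (g : R -> C) := forall t, @continuous R_UniformSpace C_UniformSpace g t.
Lemma ccurve_on g a b : ccurve g -> cont_on g a b.
Proof. intros H t _; apply H. Qed.

Lemma ccurve_circ r : ccurve (circ r).
Proof. intros t. apply continuous_Cmult; [apply continuous_const|].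
apply continuous_cis, continuous_id. Qed.

(** Angular measure: the contour integral of G(z) dz / (i z). *)
Definition circle_int (G : C -> C) (r : R) : C := CInt (fun t => G (circ r t)) 0 (2 * PI).

Lemma two_pi_pos : 0 <= 2 * PI.
Proof. pose proof PI_RGT_0; lra. Qed.
#[local] Hint Resolve two_pi_pos : core.

Lemma cis_0 : cis 0 = 1.
Proof. unfold cis. now rewrite cos_0, sin_0. Qed.

Lemma cis_2PI : cis (2 * PI) = 1.
Proof. unfold cis. now rewrite cos_2PI, sin_2PI. Qed.

Lemma Ci_mult_cancel (A B : C) : (Ci * (A - B))%C = 0 -> A = B.
Proof.
intros E. assert (Hi : (Ci * Ci = - RtoC 1)%C) by (unfold Ci, RtoC, Cmult, Copp; simpl; f_equal;
  ring).
replace A with (- (Ci * (Ci * (A - B))) + B)%C by ring [Hi]. rewrite E. ring.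
Qed.

(** The exponential map sends [ln r0, ln r1] x [0, 2 pi] to the annulus; by periodicity the two
    horizontal sides of the rectangle cancel, and the vertical sides give the circles. *)
Lemma circle_int_annulus G r0 r1 : 0 < r0 -> r0 <= r1 ->
  (forall z, r0 <= Cmod z <= r1 -> cdiff G z) -> circle_int G r0 = circle_int G r1.
Proof.
intros H0 H1 HG.
set (H := fun z => G (cexp z)).
assert (Hln : ln r0 <= ln r1) by (destruct H1 as [H1| ->]; [left; apply ln_increasing; lra|lra]).
assert (Hexp : forall s t, cexp (s, t) = circ (exp s) t) by reflexivity.
assert (HD : diff_rect H (ln r0) 0 (ln r1 - ln r0) (2 * PI)).
{ intros s t Hs _. apply (cdiff_comp G cexp); [|eexists; apply cderiv_cexp].
  apply HG. rewrite Hexp, Cmod_circ_pos by (left; apply exp_pos).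
  rewrite <- (exp_ln r0) at 1 by lra. rewrite <- (exp_ln r1) by lra.
  split.
  - destruct (proj1 Hs) as [h| <-]; [left; now apply exp_increasing|lra].
  - assert (Hs2 : s <= ln r1) by lra. destruct Hs2 as [h| ->]; [left;
    now apply exp_increasing|lra]. }
pose proof (goursat_rect H (ln r0) 0 (ln r1 - ln r0) (2 * PI) ltac:(lra) ltac:(auto) HD) as E.
unfold rect_int in E. replace (ln r0 + (ln r1 - ln r0)) with (ln r1) in E by ring.
rewrite Rplus_0_l in E.
rewrite (CInt_ext (ln r0) (ln r1) ltac:(lra) (fun t => H (t, 2 * PI)) (fun t => H (t, 0))) in E.
2:{ intros t _. unfold H. rewrite !Hexp. unfold circ. now rewrite cis_0, cis_2PI. }
assert (E2 : (Ci * (CInt (fun t => H (ln r1, t)) 0 (2 * PI) - CInt (fun t => H (ln r0, t))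
  0 (2 * PI)))%C = 0).
{ rewrite <- E. ring. }
apply Ci_mult_cancel in E2. rename E2 into E3.
unfold H in E3.
rewrite (CInt_ext 0 (2 * PI) ltac:(auto) (fun t => G (cexp (ln r1, t))) (fun t => G (circ r1 t)))
  in E3
  by (intros; rewrite Hexp, exp_ln by lra; reflexivity).
rewrite (CInt_ext 0 (2 * PI) ltac:(auto) (fun t => G (cexp (ln r0, t))) (fun t => G (circ r0 t)))
  in E3
  by (intros; rewrite Hexp, exp_ln by lra; reflexivity).
now symmetry.
Qed.

Definition ccont (G : C -> C) z := @continuous C_UniformSpace C_UniformSpace G z.

Lemma ccurve_comp G r rho : 0 <= r < rho -> (forall z, Cmod z < rho -> ccont G z) ->
  ccurve (fun t => G (circ r t)).
Proof.
intros Hr HG t. apply (continuous_comp (circ r) G); [apply ccurve_circ|]. apply HG.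
rewrite Cmod_circ_pos; lra.
Qed.

Lemma circle_int_continuous G rho r0 : (forall z, Cmod z < rho -> ccont G z) -> 0 <= r0 < rho ->
  forall eps, 0 < eps -> exists del, 0 < del /\
   forall r, 0 <= r < rho -> Rabs (r - r0) < del -> Cmod (circle_int G r - circle_int G r0) < eps.
Proof.
intros HG Hr0 eps He.
set (r1 := (r0 + rho) / 2).
assert (Hc : forall x y, 0 <= x <= r1 ->
  @continuous (prod_UniformSpace R_UniformSpace R_UniformSpace)
    C_UniformSpace (fun q => G (circ (fst q) (snd q))) (x, y)).
{ intros x y Hx. apply (continuous_comp (fun q : prod_UniformSpace R_UniformSpace R_UniformSpace =>
  circ (fst q) (snd q)) G).
  - apply continuous_Cmult; [apply continuous_RtoC, continuous_fst|apply continuous_cis,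
    continuous_snd].
  - apply HG. simpl. rewrite Cmod_circ_pos by lra. unfold r1 in Hx. lra. }
assert (He8 : 0 < eps / (8 * PI)) by (apply Rdiv_lt_0_compat; pose proof PI_RGT_0; lra).
destruct (uniform_continuity_2d (fun x y => fst (G (circ x y))) 0 r1 0 (2 * PI)) with (eps :=
  mkposreal _ He8) as [d1 D1].
{ intros x y Hx _. apply continuity_2d_pt_filterlim. exact (continuous_Re _ _ (Hc x y Hx)). }
destruct (uniform_continuity_2d (fun x y => snd (G (circ x y))) 0 r1 0 (2 * PI)) with (eps :=
  mkposreal _ He8) as [d2 D2].
{ intros x y Hx _. apply continuity_2d_pt_filterlim. exact (continuous_Im _ _ (Hc x y Hx)). }
exists (Rmin (Rmin d1 d2) ((rho - r0) / 2)). split.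
{ pose proof (cond_pos d1). pose proof (cond_pos d2). repeat apply Rmin_case; lra. }
intros r Hr Hd.
pose proof (Rmin_l (Rmin d1 d2) ((rho - r0) / 2)).
pose proof (Rmin_r (Rmin d1 d2) ((rho - r0) / 2)).
pose proof (Rmin_l d1 d2). pose proof (Rmin_r d1 d2).
assert (Hr1 : 0 <= r <= r1) by (apply Rabs_lt_between in Hd; unfold r1; lra).
assert (Hr01 : 0 <= r0 <= r1) by (unfold r1; lra).
unfold circle_int. rewrite <- CInt_minus by (auto || (apply ccurve_on; apply (ccurve_comp G _ rho);
  auto; lra)).
eapply Rle_lt_trans; [apply (CInt_bound _ _ ltac:(auto) _ (eps / (4 * PI)))|].
- intros t Ht. apply continuous_Cminus; apply (ccurve_comp G _ rho); auto; lra.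
- intros t Ht.
  assert (Et : Rabs (t - t) < Rmin d1 d2) by (rewrite Rminus_diag, Rabs_R0; apply Rmin_case;
    apply cond_pos).
  specialize (D1 r0 t r t Hr01 Ht Hr1 Ht ltac:(lra) ltac:(lra)).
  specialize (D2 r0 t r t Hr01 Ht Hr1 Ht ltac:(lra) ltac:(lra)). simpl in D1, D2.
  destruct (G (circ r t)) as [a b], (G (circ r0 t)) as [a' b'].
  eapply Rle_trans; [apply Cmod_pair_le|]. simpl in *.
  replace (eps / (4 * PI)) with (eps / (8 * PI) + eps / (8 * PI)) by (field; apply PI_neq0).
  unfold Rminus in *. lra.
- replace ((2 * PI - 0) * (eps / (4 * PI))) with (eps / 2) by (field; apply PI_neq0). lra.
Qed.

Lemma circle_int_0 G : circle_int G 0 = (RtoC (2 * PI) * G 0)%C.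
Proof.
unfold circle_int. rewrite (CInt_ext 0 (2 * PI) ltac:(auto) _ (fun _ => G 0)).
- rewrite CInt_const, Rminus_0_r by auto. reflexivity.
- intros t _. f_equal. unfold circ. ring.
Qed.

Lemma Cminus_eq_0 (a b : C) : (a - b)%C = 0 -> a = b.
Proof. intros H. replace a with (a - b + b)%C by ring. rewrite H. ring. Qed.

Lemma Cmod_small_eq0 (a : C) : (forall eps, 0 < eps -> Cmod a < eps) -> a = 0.
Proof.
intros H. apply Cmod_eq_0. destruct (Cmod_ge_0 a) as [h|h]; [|now symmetry].
specialize (H _ h). lra.
Qed.

(** The exceptional point w, at which only continuity is required, makes the statement
    applicable to difference quotients in Cauchy's formula.  The circle integral is constant for
    radii on either side of |w| and continuous in the radius, so it equals its value at 0. *)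
Lemma mean_value G w rho r : (forall z, Cmod z < rho -> ccont G z) ->
  (forall z, Cmod z < rho -> z <> w -> cdiff G z) -> 0 <= r < rho ->
  circle_int G r = (RtoC (2 * PI) * G 0)%C.
Proof.
intros Hc HD Hr. rewrite <- circle_int_0.
assert (Hlim : forall s c, 0 <= s < rho ->
  (forall del, 0 < del -> exists s', 0 <= s' < rho /\ Rabs (s' - s) < del /\ circle_int G s' = c)
    -> circle_int G s = c).
{ intros s c Hs H. symmetry. apply Cminus_eq_0, Cmod_small_eq0. intros eps He.
  destruct (circle_int_continuous G rho s Hc Hs eps He) as [d [Hd Hcd]].
  destruct (H d Hd) as [s' [Hs' [Hss E]]]. rewrite <- E. auto. }
assert (Hann : forall r0 r1, 0 < r0 -> r0 <= r1 -> r1 < rho -> r1 < Cmod w \/ Cmod w < r0 ->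
  circle_int G r0 = circle_int G r1).
{ intros r0 r1 H0 H01 H1 Hw. apply circle_int_annulus; trivial. intros z Hz. apply HD; [lra|].
  intros E; subst z. lra. }
assert (Hin : forall s, 0 <= s < rho -> s < Cmod w -> circle_int G s = circle_int G 0).
{ intros s Hs Hsw. symmetry. apply Hlim; [lra|]. intros d Hd.
  destruct (Rle_lt_or_eq_dec 0 s (proj1 Hs)) as [h|h].
  - exists (Rmin s (d / 2)). pose proof (Rmin_l s (d / 2)). pose proof (Rmin_r s (d / 2)).
    assert (0 < Rmin s (d / 2)) by (apply Rmin_case; lra).
    split; [lra|]. split; [rewrite Rminus_0_r, Rabs_pos_eq; lra|]. apply Hann; lra.
  - exists s. subst s. rewrite Rminus_diag, Rabs_R0. auto. }
assert (Hat : Cmod w < rho -> circle_int G (Cmod w) = circle_int G 0).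
{ intros Hw. pose proof (Cmod_ge_0 w). destruct H as [h|h]; [|now rewrite <- h].
  apply Hlim; [lra|]. intros d Hd.
  exists (Rmax 0 (Cmod w - d / 2)).
  assert (0 <= Rmax 0 (Cmod w - d / 2) < Cmod w) by (split; [apply Rmax_l|apply Rmax_lub_lt; lra]).
  pose proof (Rmax_r 0 (Cmod w - d / 2)).
  split; [lra|]. split; [apply Rabs_lt_between; lra|]. apply Hin; lra. }
destruct (Rtotal_order r (Cmod w)) as [h|[h|h]].
- apply Hin; lra.
- rewrite h. apply Hat. lra.
- rewrite <- Hat by lra. symmetry. apply Hlim; [pose proof (Cmod_ge_0 w); lra|].
  intros d Hd. exists (Rmin r (Cmod w + d / 2)). pose proof (Cmod_ge_0 w).
  pose proof (Rmin_l r (Cmod w + d / 2)). pose proof (Rmin_r r (Cmod w + d / 2)).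
  assert (Cmod w < Rmin r (Cmod w + d / 2)) by (apply Rmin_case; lra).
  split; [lra|]. split; [apply Rabs_lt_between; lra|]. apply Hann; lra.
Qed.

Lemma circ_neq R w t : Cmod w < R -> (circ R t - w)%C <> 0.
Proof.
intros H. apply Cmod_gt_0. pose proof (Cmod_triangle_sub (circ R t) w). pose proof (Cmod_ge_0 w).
rewrite Cmod_circ_pos in H0; lra.
Qed.

Lemma circ_dist R w t : Cmod w < R -> R - Cmod w <= Cmod (circ R t - w).
Proof.
intros H. pose proof (Cmod_triangle_sub (circ R t) w). pose proof (Cmod_ge_0 w).
rewrite Cmod_circ_pos in H0; lra.
Qed.

Lemma circle_int_const c R : circle_int (fun _ => c) R = (RtoC (2 * PI) * c)%C.
Proof. unfold circle_int. rewrite CInt_const, Rminus_0_r by auto. reflexivity. Qed.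

Lemma ccurve_cauchy g R w : Cmod w < R -> ccurve g -> ccurve (fun t => g t / (circ R t - w))%C.
Proof.
intros Hw Hg t. apply continuous_Cdiv; [apply Hg| |now apply circ_neq].
apply continuous_Cminus; [apply ccurve_circ|apply continuous_const].
Qed.

Lemma cdiff_id_minus w z : cdiff (fun x => x - w)%C z.
Proof. apply (cdiff_minus (fun x => x) (fun _ => w)); [apply cdiff_id|apply cdiff_const]. Qed.

Lemma Cminus_neq_0 (z w : C) : z <> w -> (z - w)%C <> 0.
Proof. intros H E. apply H, Cminus_eq_0, E. Qed.

(** The integral is the same for all larger radii, and the integrand tends to 1 at infinity. *)
Lemma circle_int_kernel R w : Cmod w < R -> circle_int (fun z => z / (z - w))%C R = RtoC (2 * PI).
Proof.
intros Hw. pose proof (Cmod_ge_0 w).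
assert (HA : forall R', R <= R' ->
  circle_int (fun z => z / (z - w))%C R' = circle_int (fun z => z / (z - w))%C R).
{ intros R' HR. symmetry. apply circle_int_annulus; [lra|lra|]. intros z Hz.
  apply (cdiff_div (fun z => z) (fun z => z - w)%C); [apply cdiff_id|apply cdiff_id_minus|].
  apply Cminus_neq_0. intros ->. lra. }
assert (HB : forall R', R <= R' -> Cmod (circle_int (fun z => z / (z - w))%C R' - RtoC (2 * PI))
  <= 2 * PI * (Cmod w / (R' - Cmod w))).
{ intros R' HR.
  assert (C1 : ccurve (fun t => w / (circ R' t - w))%C) by (apply (ccurve_cauchy (fun _ => w));
    [lra|intros t; apply continuous_const]).
  replace (circle_int (fun z => z / (z - w))%C R' - RtoC (2 * PI))%C with (CInt (fun t => w / (circ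
    R' t - w))%C 0 (2 * PI)).
  - replace (2 * PI * _) with ((2 * PI - 0) * (Cmod w / (R' - Cmod w))) by ring.
    apply CInt_bound; [auto|now apply ccurve_on|].
    intros t _. rewrite Cmod_div by (apply circ_neq; lra). apply Rmult_le_compat_l; [lra|].
    apply Rinv_le_contravar; [lra|]. apply circ_dist; lra.
  - assert (E1 : circle_int (fun _ => 1) R' = RtoC (2 * PI)) by (rewrite circle_int_const; ring).
    rewrite <- E1. unfold circle_int. rewrite <- CInt_minus.
    + apply CInt_ext; [auto|]. intros t _. field. apply circ_neq; lra.
    + auto.
    + apply ccurve_on, ccurve_cauchy; [lra|apply ccurve_circ].
    + intros t _. apply continuous_const. }
apply Cminus_eq_0, Cmod_small_eq0. intros eps He.
set (R' := R + (2 * PI * Cmod w + 1) / eps).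
assert (0 < (2 * PI * Cmod w + 1) / eps) by (apply Rdiv_lt_0_compat; pose proof two_pi_pos; nra).
rewrite <- (HA R') by (unfold R'; lra).
eapply Rle_lt_trans; [apply HB; unfold R'; lra|].
apply Rmult_lt_reg_r with (R' - Cmod w); [unfold R'; lra|].
replace (2 * PI * (Cmod w / (R' - Cmod w)) * (R' - Cmod w)) with (2 * PI * Cmod w) by (field;
  unfold R'; lra).
replace (eps * (R' - Cmod w)) with (eps * (R - Cmod w) + (2 * PI * Cmod w + 1)) by (unfold R';
  field; lra).
nra.
Qed.

(** * Cauchy's formula and Cauchy transforms *)

(** [mean_value] for z * (F z - F w) / (z - w), extended by F'(w) * w at w, gives integral 0;
    the rest is [circle_int_kernel]. *)
Theorem cauchy_formula F rho R w : hol rho F -> Cmod w < R -> R < rho ->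
  circle_int (fun z => F z * (z / (z - w)))%C R = (RtoC (2 * PI) * F w)%C.
Proof.
intros HF Hw HR. pose proof (Cmod_ge_0 w) as Hw0.
destruct (HF w ltac:(lra)) as [l Hl].
set (q := fun z => if Ceq_dec z w then l else ((F z - F w) / (z - w))%C).
assert (Hq : forall z, z <> w -> q z = ((F z - F w) / (z - w))%C)
  by (intros z Hz; unfold q; destruct (Ceq_dec z w); [contradiction|reflexivity]).
assert (HqD : forall z, Cmod z < rho -> z <> w -> cdiff q z).
{ intros z Hz Hzw. assert (Hzw' := Cminus_neq_0 z w Hzw).
  apply cdiff_ext_loc with (fun z => ((F z - F w) / (z - w))%C) (Cmod (z - w));
    [now apply Cmod_gt_0| |].
  - intros x Hx. symmetry. apply Hq. intros ->. rewrite Cmod_sub_rev in Hx. lra.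
  - apply (cdiff_div (fun z => F z - F w)%C (fun z => z - w)%C); [|apply cdiff_id_minus|assumption].
    apply (cdiff_minus F (fun _ => F w)); [auto|apply cdiff_const]. }
assert (Hqc : forall z, Cmod z < rho -> ccont q z).
{ intros z Hz. destruct (Ceq_dec z w) as [->|Hzw].
  - apply continuous_C_eps. intros eps He.
    destruct (proj1 (cderiv_eps _ _ _) Hl (eps / 2) ltac:(lra)) as [d [Hd H]].
    exists d. split; [assumption|]. intros x Hx.
    assert (Eq : q w = l) by (unfold q; destruct (Ceq_dec w w); congruence). rewrite Eq.
    destruct (Ceq_dec x w) as [->|Hxw].
    + rewrite Eq. replace (l - l)%C with (RtoC 0) by ring. rewrite Cmod_0; lra.
    + rewrite Hq by assumption. assert (Hxw' := Cminus_neq_0 x w Hxw).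
      replace ((F x - F w) / (x - w) - l)%C with ((F x - F w - (x - w) * l) / (x - w))%C by (field;
        assumption).
      rewrite Cmod_div by assumption. apply Cmod_gt_0 in Hxw'.
      apply Rle_lt_trans with (eps / 2); [|lra].
      apply Rmult_le_reg_r with (Cmod (x - w)); [assumption|].
      unfold Rdiv at 1. rewrite Rmult_assoc, Rinv_l, Rmult_1_r by lra. now apply H.
  - apply cdiff_continuous, HqD; assumption. }
assert (E : circle_int (fun z => q z * z)%C R = 0).
{ rewrite (mean_value _ w rho R); [ring| | |lra].
  - intros z Hz. apply (continuous_Cmult q (fun z => z)); [now apply Hqc|apply continuous_id].
  - intros z Hz Hzw. apply (cdiff_mult q (fun z => z)); [now apply HqD|apply cdiff_id]. }
assert (Cz : ccurve (fun t => circ R t / (circ R t - w))%C) by (apply ccurve_cauchy;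
  [lra|apply ccurve_circ]).
assert (CF : ccurve (fun t => F (circ R t))).
{ apply (ccurve_comp F R rho); [lra|]. intros; apply cdiff_continuous; auto. }
apply Cminus_eq_0. rewrite <- E.
replace (RtoC (2 * PI) * F w)%C with (F w * circle_int (fun z => z / (z - w))
  R)%C by (rewrite circle_int_kernel by assumption; ring).
unfold circle_int. rewrite <- CInt_scal, <- CInt_minus; auto.
- apply CInt_ext; [auto|]. intros t _. rewrite Hq by (intros Ew; apply (circ_neq R w t Hw);
  rewrite Ew; ring).
  field. now apply circ_neq.
- intros t _. apply continuous_Cmult; [apply CF|apply Cz].
- intros t _. apply continuous_Cmult; [apply continuous_const|apply Cz].
- now apply ccurve_on.
Qed.

Definition cauchy_transform (g : R -> C) (R : R) (w : C) : C :=
  CInt (fun t => g t / (circ R t - w))%C 0 (2 * PI).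

Lemma ccurve_bounded g : ccurve g -> exists M, 0 <= M /\ forall t, 0 <= t <= 2 * PI ->
  Cmod (g t) <= M.
Proof.
intros Hg. destruct (continuity_ab_maj (fun t => Cmod (g t)) 0 (2 * PI)) as [m [Hm _]]; [auto| |].
- intros c _. apply continuity_pt_filterlim. apply (continuous_Cmod g). apply Hg.
- exists (Cmod (g m)). split; [apply Cmod_ge_0|exact Hm].
Qed.

(** Differentiation under the integral sign, with the explicit remainder
    (v - w)^2 / ((zeta - w)^2 (zeta - v)).  It yields removable singularities and
    locally uniform limits, as both are represented by Cauchy transforms. *)
Lemma cdiff_cauchy_transform g R w : ccurve g -> Cmod w < R -> cdiff (cauchy_transform g R) w.
Proof.
intros Hg Hw. destruct (ccurve_bounded g Hg) as [M [HM0 HM]].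
exists (CInt (fun t => g t / (circ R t - w) / (circ R t - w))%C 0 (2 * PI)).
set (d := (R - Cmod w) / 2).
apply cderiv_quad with d (2 * PI * (M / (4 * d * d * d))); [unfold d; lra|].
intros v Hv.
assert (Hvw : Cmod v < R) by (pose proof (Cmod_triangle_sub v w); unfold d in Hv; lra).
assert (C1 : ccurve (fun t => g t / (circ R t - w))%C) by now apply ccurve_cauchy.
assert (C2 : ccurve (fun t => g t / (circ R t - w) / (circ R t - w))%C) by now apply ccurve_cauchy.
assert (C3 : ccurve (fun t => g t / (circ R t - w) / (circ R t - w) / (circ R t - v))%C)
  by now apply ccurve_cauchy.
assert (C4 : ccurve (fun t => g t / (circ R t - v))%C) by now apply ccurve_cauchy.
set (J := CInt (fun t => g t / (circ R t - w) / (circ R t - w) / (circ R t - v))%C 0 (2 * PI)).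
replace (cauchy_transform g R v - cauchy_transform g R w - _)%C with ((v - w) * (v - w) * J)%C.
- rewrite !Cmod_mult. rewrite Rmult_comm. simpl pow. rewrite Rmult_1_r.
  apply Rmult_le_compat_r; [pose proof (Cmod_ge_0 (v - w)); nra|].
  match goal with |- _ <= _ * ?X => replace (2 * PI * X) with ((2 * PI - 0) * X) by ring end.
  apply CInt_bound; [auto|now apply ccurve_on|].
  intros t Ht. pose proof (circ_neq R w t Hw). pose proof (circ_neq R v t Hvw).
  rewrite !Cmod_div by assumption. pose proof (circ_dist R w t Hw) as D1.
  assert (D2 : d <= Cmod (circ R t - v)).
  { pose proof (circ_dist R v t Hvw). pose proof (Cmod_triangle_sub v w). unfold d in *. lra. }
  assert (Hd : 0 < d) by (unfold d; lra).
  replace (R - Cmod w) with (2 * d) in D1 by (unfold d; field).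
  specialize (HM t Ht). set (x := Cmod (circ R t - w)) in *. set (y := Cmod (circ R t - v)) in *.
  replace (Cmod (g t) / x / x / y) with (Cmod (g t) / (x * x * y)) by (field; lra).
  apply Rle_trans with (M / (x * x * y)).
  + apply Rmult_le_compat_r; [left; apply Rinv_0_lt_compat; repeat apply Rmult_lt_0_compat;
    lra|assumption].
  + apply Rmult_le_compat_l; [assumption|]. apply Rinv_le_contravar;
    [repeat apply Rmult_lt_0_compat; lra|].
    apply Rmult_le_compat; nra.
- unfold cauchy_transform, J. rewrite <- !CInt_scal by (auto || now apply ccurve_on).
  rewrite <- !CInt_minus; auto; try (now apply ccurve_on).
  + apply CInt_ext; [auto|]. intros t _. field. split; now apply circ_neq.
  + intros t _. apply continuous_Cminus; [apply C4|apply C1].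
  + intros t _. apply continuous_Cmult; [apply continuous_const|apply C2].
Qed.

(** * Poisson's formula *)

(** The Poisson kernel of the disc of radius R with pole w, at a point z with |z| = R. *)
Definition poisson (R : R) (w z : C) := (R ^ 2 - Cmod w ^ 2) / Cmod (z - w) ^ 2.

Lemma neq_of_Cmod_lt (w z : C) R : Cmod w < R -> Cmod z = R -> (z - w)%C <> 0.
Proof. intros H1 H2. apply Cminus_neq_0. intros ->. lra. Qed.

(** On |z| = R the kernel is the Cauchy kernel plus a function of z that is holomorphic in the
    closed disc and vanishes at 0; the second term does not contribute to the integral of a
    holomorphic function. *)
Lemma poisson_complex R w z : Cmod w < R -> Cmod z = R ->
  RtoC (poisson R w z) = (z / (z - w) + Cconj w * (z / (RtoC (R ^ 2) - Cconj w * z)))%C.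
Proof.
intros Hw Hz. pose proof (Cmod_ge_0 w) as Hw0.
assert (Hzw := neq_of_Cmod_lt w z R Hw Hz).
assert (Hz0 : z <> 0) by (apply Cmod_gt_0; lra).
assert (Hc : (Cconj z - Cconj w)%C <> 0).
{ apply Cmod_gt_0. replace (Cconj z - Cconj w)%C with (Cconj (z - w)).
  - rewrite Cmod_conj. now apply Cmod_gt_0.
  - unfold Cconj, Cminus, Cplus, Copp; simpl; f_equal; ring. }
unfold poisson. rewrite <- Hz, RtoC_div, RtoC_minus, !Cmod2_conj.
2:{ apply pow_nonzero. apply Cmod_gt_0 in Hzw. lra. }
replace (Cconj (z - w)) with (Cconj z - Cconj w)%C by (unfold Cconj, Cminus, Cplus, Copp; simpl;
  f_equal; ring).
replace (z * Cconj z - Cconj w * z)%C with (z * (Cconj z - Cconj w))%C by ring.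
field. repeat split; assumption.
Qed.

Lemma continuous_poisson_circ R w : Cmod w < R ->
  forall t, continuous (fun t => poisson R w (circ R t)) t.
Proof.
intros Hw t. unfold poisson.
apply (continuous_mult (K := R_AbsRing)); [apply continuous_const|].
apply (continuous_comp (fun t => Cmod (circ R t - w) ^ 2) Rinv).
- apply (continuous_mult (K := R_AbsRing)); [|apply (continuous_mult (K := R_AbsRing));
  [|apply continuous_const]];
  apply (continuous_Cmod (fun t => circ R t - w)%C); (apply continuous_Cminus;
    [apply ccurve_circ|apply continuous_const]).
- apply continuous_Rinv. apply pow_nonzero. pose proof (circ_neq R w t Hw) as H.
  apply Cmod_gt_0 in H. lra.
Qed.

Theorem poisson_formula F rho R w : hol rho F -> Cmod w < R -> R < rho ->
  CInt (fun t => RtoC (poisson R w (circ R t)) * F (circ R t))%C 0 (2 * PI) = (RtoC (2 * PI)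
    * F w)%C.
Proof.
intros HF Hw HR. pose proof (Cmod_ge_0 w) as Hw0.
set (G := fun z => (F z * Cconj w * (z / (RtoC (R ^ 2) - Cconj w * z)))%C).
set (rho' := Rmin rho (2 * R - Cmod w)).
assert (Hrho' : R < rho') by (unfold rho'; apply Rmin_case; lra).
assert (Hden : forall z, Cmod z < rho' -> (RtoC (R ^ 2) - Cconj w * z)%C <> 0).
{ intros z Hz. apply Cmod_gt_0. pose proof (Cmod_triangle_sub (RtoC (R ^ 2)) (Cconj w * z)) as H.
  rewrite Cmod_mult, Cmod_conj, Cmod_R, Rabs_pos_eq in H by nra.
  assert (Cmod z <= 2 * R - Cmod w) by (pose proof (Rmin_r rho (2 * R - Cmod w));
    unfold rho' in Hz; lra).
  pose proof (Cmod_ge_0 z). nra. }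
assert (HG : forall z, Cmod z < rho' -> cdiff G z).
{ intros z Hz. assert (Hz' : Cmod z < rho) by (pose proof (Rmin_l rho (2 * R - Cmod w));
  unfold rho' in Hz; lra).
  apply (cdiff_mult (fun z => F z * Cconj w)%C (fun z => z / (RtoC (R ^ 2) - Cconj w * z))%C).
  - apply (cdiff_mult F (fun _ => Cconj w)); [auto|apply cdiff_const].
  - apply (cdiff_div (fun z => z) (fun z => RtoC (R ^ 2) - Cconj w * z)%C); [apply cdiff_id| |auto].
    apply (cdiff_minus (fun _ => RtoC (R ^ 2)) (fun z => Cconj w * z)%C); [apply cdiff_const|].
    apply (cdiff_mult (fun _ => Cconj w) (fun z => z)); [apply cdiff_const|apply cdiff_id]. }
assert (CG : ccurve (fun t => G (circ R t))).
{ apply (ccurve_comp G R rho'); [lra|]. intros; apply cdiff_continuous; auto. }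
assert (CF : ccurve (fun t => F (circ R t))).
{ apply (ccurve_comp F R rho); [lra|]. intros; apply cdiff_continuous; auto. }
assert (CK : ccurve (fun t => F (circ R t) * (circ R t / (circ R t - w)))%C).
{ intros t. apply continuous_Cmult; [apply CF|]. apply (ccurve_cauchy (circ R));
  [assumption|apply ccurve_circ]. }
rewrite (CInt_ext 0 (2 * PI) ltac:(auto) _ (fun t => F (circ R t) * (circ R t / (circ R t - w))
  + G (circ R t))%C).
- rewrite CInt_plus by (auto || now apply ccurve_on).
  pose proof (cauchy_formula F rho R w HF Hw HR) as E1. unfold circle_int in E1. rewrite E1.
  assert (E2 : circle_int G R = (RtoC (2 * PI) * G 0)%C).
  { apply (mean_value G w rho'); [intros; apply cdiff_continuous; auto|auto|lra]. }
  unfold circle_int in E2. rewrite E2. unfold G, Cdiv. ring.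
- intros t _. rewrite poisson_complex by (trivial; apply Cmod_circ_pos; lra). unfold G. ring.
Qed.

Lemma poisson_pos R w z : Cmod w < R -> Cmod z = R -> 0 < poisson R w z.
Proof.
intros Hw Hz. pose proof (neq_of_Cmod_lt w z R Hw Hz) as H. apply Cmod_gt_0 in H.
pose proof (Cmod_ge_0 w).
apply Rdiv_lt_0_compat; [nra|]. apply pow_lt; lra.
Qed.

Lemma poisson_le R w z : Cmod w < R -> Cmod z = R -> poisson R w z <= (R + Cmod w) / (R - Cmod w).
Proof.
intros Hw Hz. pose proof (Cmod_ge_0 w) as H0. pose proof (Cmod_triangle_sub z w) as H1.
rewrite Hz in H1.
replace ((R + Cmod w) / (R - Cmod w)) with ((R ^ 2 - Cmod w ^ 2) / (R - Cmod w) ^ 2) by (field;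
  lra).
apply Rmult_le_compat_l; [nra|]. apply Rinv_le_contravar; [apply pow_lt; lra|]. apply pow_incr. lra.
Qed.

(** This form shows that the kernel is harmonic in its pole w. *)
Lemma poisson_Re R w z : Cmod w < R -> Cmod z = R -> poisson R w z = fst ((z + w) / (z - w))%C.
Proof.
intros Hw Hz. pose proof (neq_of_Cmod_lt w z R Hw Hz) as H.
unfold poisson. rewrite <- Hz.
assert (H2 : Cmod (z - w) ^ 2 <> 0) by (apply pow_nonzero; apply Cmod_gt_0 in H; lra).
rewrite !Cmod2_alt in *. destruct z as [a b], w as [c d].
unfold Cdiv, Cmult, Cinv, Re, Im in *; simpl in *. field.
intros E; apply H2; rewrite <- E; ring.
Qed.

Lemma RInt_poisson R w : Cmod w < R -> RInt (fun t => poisson R w (circ R t)) 0 (2 * PI) = 2 * PI.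
Proof.
intros Hw. pose proof (poisson_formula (fun _ => 1) (R + 1) R w (fun z _ => cdiff_const 1 z)
  Hw ltac:(lra)) as E.
apply (f_equal fst) in E. unfold CInt in E. simpl in E.
rewrite (RInt_extR 0 (2 * PI) ltac:(auto) _ (fun t => poisson R w (circ R t))) in E by (intros;
  ring).
rewrite E. asR; ring.
Qed.

(** As a function of its pole, the kernel is the real part of a holomorphic function, so its
    composition with phi is reproduced by the Poisson integral. *)
Lemma RInt_poisson_pole r rho R b (phi : C -> C) zeta :
  (forall z, Cmod z < rho -> cdiff phi z /\ Cmod (phi z) < R) -> Cmod b < r -> r < rho ->
    Cmod zeta = R ->
  RInt (fun t => poisson r b (circ r t) * poisson R (phi (circ r t)) zeta) 0 (2 * PI)
    = 2 * PI * poisson R (phi b) zeta.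
Proof.
intros Hphi Hb Hr Hz. pose proof (Cmod_ge_0 b).
assert (Hne : forall z, Cmod z < rho -> (zeta - phi z)%C <> 0).
{ intros z Hz1. apply (neq_of_Cmod_lt _ _ R); [now apply Hphi|assumption]. }
pose proof (poisson_formula (fun z => (zeta + phi z) / (zeta - phi z))%C rho r b) as E.
assert (Hd : forall z, Cmod z < rho -> cdiff (fun z => (zeta + phi z) / (zeta - phi z))%C z).
{ intros z Hz1. apply (cdiff_div (fun z => zeta + phi z)%C (fun z => zeta - phi z)%C);
  [| |now apply Hne].
  - apply (cdiff_plus (fun _ => zeta) phi); [apply cdiff_const|now apply Hphi].
  - apply (cdiff_minus (fun _ => zeta) phi); [apply cdiff_const|now apply Hphi]. }
specialize (E Hd Hb Hr). apply (f_equal fst) in E. unfold CInt in E. cbn [fst] in E.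
rewrite (RInt_extR 0 (2 * PI) ltac:(auto) _ (fun t => poisson r b (circ r t)
  * poisson R (phi (circ r t)) zeta)) in E.
- rewrite E, (poisson_Re R (phi b) zeta); [|apply Hphi; lra|assumption]. simpl. asR; ring.
- intros t _. rewrite (poisson_Re R (phi (circ r t)) zeta); [|apply Hphi; rewrite Cmod_circ_pos;
  lra|assumption].
  simpl. asR; ring.
Qed.

(** * Fubini's theorem for continuous functions *)

Definition cont2 (f : R -> R -> R) := forall x y,
  @continuous (prod_UniformSpace R_UniformSpace R_UniformSpace) R_UniformSpace (fun q => f (fst q)
    (snd q)) (x, y).

Lemma cont2_1 f y : cont2 f -> forall x, continuous (fun x => f x y) x.
Proof.
intros H x. apply (continuous_comp (fun x => (x, y)
  : prod_UniformSpace R_UniformSpace R_UniformSpace) (fun q => f (fst q) (snd q))); [|apply H].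
apply (continuous_pairC (fun x => x) (fun _ => y)); [apply continuous_id|apply continuous_const].
Qed.

Lemma cont2_2 f x : cont2 f -> forall y, continuous (fun y => f x y) y.
Proof.
intros H y. apply (continuous_comp (fun y => (x, y)
  : prod_UniformSpace R_UniformSpace R_UniformSpace) (fun q => f (fst q) (snd q))); [|apply H].
apply (continuous_pairC (fun _ => x) (fun y => y)); [apply continuous_const|apply continuous_id].
Qed.

Lemma ex_RInt_all (f : R -> R) a b : (forall t, continuous f t) -> ex_RInt f a b.
Proof. intros H. apply (ex_RInt_continuous (V := R_CompleteNormedModule)). auto. Qed.

Lemma continuous_RInt_param (f : R -> R -> R) a b x : a <= b -> cont2 f ->
  continuous (fun x => RInt (f x) a b) x.
Proof.
intros Hab Hf. apply filterlim_locally. intros eps.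
assert (He : 0 < eps / (b - a + 1)) by (apply Rdiv_lt_0_compat; [apply cond_pos|lra]).
destruct (uniform_continuity_2d f (x - 1) (x + 1) a b) with (eps := mkposreal _ He) as [d D].
{ intros u v _ _. apply continuity_2d_pt_filterlim, Hf. }
assert (Hd : 0 < Rmin d 1) by (apply Rmin_case; [apply cond_pos|lra]).
exists (mkposreal _ Hd). intros y Hy. change (Rabs (y - x) < Rmin d 1) in Hy.
pose proof (Rmin_l d 1). pose proof (Rmin_r d 1).
change (Rabs (RInt (f y) a b - RInt (f x) a b) < eps).
assert (Ey : forall z, ex_RInt (f z) a b) by (intros; apply ex_RInt_all, cont2_2, Hf).
assert (E : RInt (fun t => f y t - f x t) a b = RInt (f y) a b - RInt (f x) a b)
  by exact (RInt_minus (V := R_CompleteNormedModule) _ _ a b (Ey y) (Ey x)).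
rewrite <- E. eapply Rle_lt_trans; [apply abs_RInt_le_const with (M := eps / (b - a + 1));
  trivial|].
- exact (ex_RInt_minus (V := R_NormedModule) _ _ a b (Ey y) (Ey x)).
- intros t Ht. left. apply Rabs_lt_between in Hy as Hy'.
  apply (D x t y t); try lra. rewrite Rminus_diag, Rabs_R0. apply cond_pos.
- pose proof (cond_pos eps). apply Rmult_lt_reg_r with (b - a + 1); [lra|].
  replace ((b - a) * (eps / (b - a + 1)) * (b - a + 1)) with ((b - a) * eps) by (field; lra). nra.
Qed.

Lemma is_derive_RInt_upper (g : R -> R) a x : (forall t, continuous g t) ->
  is_derive (fun x => RInt g a x) x (g x).
Proof.
intros Hg. apply (is_derive_RInt (V := R_NormedModule) g (fun x => RInt g a x) a).
- apply filter_forall. intros y. apply (RInt_correct (V := R_CompleteNormedModule)), ex_RInt_all,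
  Hg.
- apply Hg.
Qed.

(** Both sides, as functions of the upper limit b, have the same derivative and vanish at a. *)
Theorem fubini (f : R -> R -> R) a b c d : a <= b -> c <= d -> cont2 f ->
  RInt (fun x => RInt (fun y => f x y) c d) a b = RInt (fun y => RInt (fun x => f x y) a b) c d.
Proof.
intros Hab Hcd Hf.
set (L := fun x => RInt (fun x => RInt (fun y => f x y) c d) a x).
set (Rr := fun x => RInt (fun y => RInt (fun u => f u y) a x) c d).
assert (HD : forall x y, Derive (fun u => RInt (fun u => f u y) a u) x = f x y).
{ intros x y. apply is_derive_unique, (is_derive_RInt_upper (fun u => f u y)), cont2_1, Hf. }
assert (HL : forall x, is_derive L x (RInt (fun y => f x y) c d)).
{ intros x. apply (is_derive_RInt_upper (fun x => RInt (fun y => f x y) c d)). intros t.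
  now apply continuous_RInt_param. }
assert (HRr : forall x, is_derive Rr x (RInt (fun y => f x y) c d)).
{ intros x.
  replace (RInt (fun y => f x y) c d) with (RInt (fun y => Derive (fun u => RInt (fun u => f u y)
    a u) x) c d)
    by (apply RInt_extR; auto).
  apply (is_derive_RInt_param (fun x y => RInt (fun u => f u y) a x)).
  - apply filter_forall. intros u t _. exists (f u t).
    apply (is_derive_RInt_upper (fun u => f u t)), cont2_1, Hf.
  - intros t _. apply continuity_2d_pt_ext with f; [intros; now rewrite HD|].
    apply continuity_2d_pt_filterlim, Hf.
  - apply filter_forall. intros u. apply ex_RInt_all. intros y.
    assert (Hsw : cont2 (fun y u => f u y)).
    { intros y' x'. apply (continuous_comp (fun q : prod_UniformSpace R_UniformSpace R_UniformSpace
      => (snd q, fst q) : prod_UniformSpace R_UniformSpace R_UniformSpace) (fun q => f (fst q)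
      (snd q))); [|apply Hf].
      apply (continuous_pairC (U := prod_UniformSpace R_UniformSpace R_UniformSpace)
        (fun q => snd q) (fun q => fst q)); [apply continuous_snd|apply continuous_fst]. }
    destruct (Rle_dec a u) as [h|h]; [now apply (continuous_RInt_param (fun y u => f u y))|].
    apply continuous_ext with (fun y => - RInt (fun t => f t y) u a).
    + intros z. apply (opp_RInt_swap (V := R_CompleteNormedModule) (fun t => f t z)), ex_RInt_all,
      cont2_1, Hf.
    + apply (continuous_opp (V := R_NormedModule)).
      apply (continuous_RInt_param (fun y u => f u y)); [lra|assumption]. }
change (L b = Rr b).
assert (E0 : L a - Rr a = 0).
{ unfold L, Rr. rewrite (RInt_point (V := R_CompleteNormedModule)).
  rewrite (RInt_extR c d Hcd _ (fun _ => 0)) by (intros;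
    apply (RInt_point (V := R_CompleteNormedModule))).
  rewrite RInt_constR. unfold zero; simpl. ring. }
destruct (MVT_gen (fun x => L x - Rr x) a b (fun _ => 0)) as [e [_ He]].
- intros x _. replace 0 with (RInt (fun y => f x y) c d - RInt (fun y => f x y) c d) by ring.
  apply (is_derive_minus (K := R_AbsRing) (V := R_NormedModule)); auto.
- intros x _. apply continuity_pt_filterlim.
  apply (continuous_minus (V := R_NormedModule));
    apply (ex_derive_continuous (K := R_AbsRing) (V := R_NormedModule)); eexists; eauto.
- rewrite Rmult_0_l in He. lra.
Qed.

(** * Powers and Jensen's inequality *)

(** Hides integrals behind variables of type R, so that [field] accepts the goal. *)
Ltac absRInt := repeat match goal with |- context [@RInt ?V ?f ?a ?b] =>
  let I := fresh "I" in pose (I := (@RInt V f a b : R)); change (@RInt V f a b) with I;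
    clearbody I end.
Ltac fieldR := absRInt; asR; field.

Lemma rpow_0 y : rpow 0 y = 0.
Proof. unfold rpow. destruct (Req_EM_T 0 0); congruence. Qed.

Lemma rpow_ge0 x y : 0 <= rpow x y.
Proof. unfold rpow. destruct (Req_EM_T x 0); [lra|]. unfold Rpower. left; apply exp_pos. Qed.

Lemma rpow_gt0 x y : 0 < x -> 0 < rpow x y.
Proof. intros. rewrite rpow_pos by assumption. apply exp_pos. Qed.

Lemma rpow_le x y p : 0 < p -> 0 <= x -> x <= y -> rpow x p <= rpow y p.
Proof.
intros Hp [Hx| <-] Hxy; [|rewrite rpow_0; apply rpow_ge0].
rewrite !rpow_pos by lra. apply Rle_Rpower_l; lra.
Qed.

Lemma rpow_mult x y p : 0 <= x -> 0 <= y -> rpow (x * y) p = rpow x p * rpow y p.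
Proof.
intros [Hx| <-] [Hy| <-]; rewrite ?Rmult_0_l, ?Rmult_0_r, ?rpow_0, ?Rmult_0_l, ?Rmult_0_r; trivial.
rewrite !rpow_pos by nra. symmetry. now apply Rpower_mult_distr.
Qed.

Lemma rpow_rpow x p q : 0 <= x -> p * q = 1 -> rpow (rpow x p) q = x.
Proof.
intros [Hx| <-] H; [|now rewrite !rpow_0].
rewrite (rpow_pos (rpow x p)) by now apply rpow_gt0. rewrite rpow_pos by assumption.
rewrite Rpower_mult, H. now apply Rpower_1.
Qed.

Lemma rpow_inv x p : 0 <= x -> 0 < p -> rpow (rpow x (/ p)) p = x.
Proof. intros. apply rpow_rpow; trivial. field; lra. Qed.

Lemma rpow_inv' x p : 0 <= x -> 0 < p -> rpow (rpow x p) (/ p) = x.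
Proof. intros. apply rpow_rpow; trivial. field; lra. Qed.

Lemma continuous_rpow_Cmod {U : UniformSpace} (f : U -> C_UniformSpace) u p : 0 < p ->
  continuous f u ->
  continuous (fun x => rpow (Cmod (f x)) p) u.
Proof.
intros Hp Hf. pose proof (continuous_Cmod f u Hf) as Hm.
destruct (Rle_lt_or_eq_dec 0 (Cmod (f u)) (Cmod_ge_0 _)) as [h|h].
- apply (continuous_comp (fun x => Cmod (f x)) (fun y => rpow y p)); [assumption|].
  apply continuous_ext_loc with (fun y => Rpower y p).
  + exists (mkposreal _ h). intros y Hy. change (Rabs (y - Cmod (f u)) < Cmod (f u)) in Hy.
    apply Rabs_lt_between in Hy. symmetry. apply rpow_pos. lra.
  + apply (ex_derive_continuous (K := R_AbsRing) (V := R_NormedModule)). unfold Rpower.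
    auto_derive. lra.
- apply filterlim_locally. intros eps. rewrite <- h, rpow_0.
  assert (He : 0 < rpow eps (/ p)) by apply rpow_gt0, cond_pos.
  pose proof (proj1 (filterlim_locally _ _) Hm (mkposreal _ He)) as H. revert H.
  apply filter_imp. intros x Hx. rewrite <- h in Hx.
  change (Rabs (Cmod (f x) - 0) < rpow eps (/ p)) in Hx.
  change (Rabs (rpow (Cmod (f x)) p - 0) < eps).
  rewrite Rminus_0_r in *. rewrite Rabs_pos_eq in * by (apply Cmod_ge_0 || apply rpow_ge0).
  destruct (Rle_lt_or_eq_dec 0 (Cmod (f x)) (Cmod_ge_0 _)) as [h2|h2].
  + rewrite <- (rpow_inv eps p) by (trivial; left; apply cond_pos).
    rewrite !(rpow_pos _ p) by lra. apply Rlt_Rpower_l; lra.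
  + rewrite <- h2, rpow_0. apply cond_pos.
Qed.

(** With s = y^p this is the concavity bound s^(1/p) <= 1 + (s - 1) / p, obtained here from
    1 + x <= exp x at two points. *)
Lemma bernoulli y p : 0 < y -> 1 <= p -> 1 + p * (y - 1) <= Rpower y p.
Proof.
intros Hy Hp. set (u := p * ln y).
assert (Hs : Rpower y p = exp u) by reflexivity.
assert (Ey : y = exp (u / p)) by (unfold u; replace (p * ln y / p) with (ln y) by (field; lra);
  now rewrite exp_ln).
set (v := u / p) in *. assert (Eu : u = p * v) by (unfold v; field; lra).
pose proof (exp_ineq1_le (u - v)) as H1. pose proof (exp_ineq1_le (- v)) as H2.
pose proof (exp_pos v) as Hv.
assert (E1 : exp u = exp v * exp (u - v)) by (rewrite <- exp_plus; f_equal; ring).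
assert (E2 : 1 = exp v * exp (- v)) by (rewrite <- exp_plus, Rplus_opp_r; now rewrite exp_0).
assert (A1 : exp v * (1 + (u - v)) <= exp u) by (rewrite E1; apply Rmult_le_compat_l; lra).
assert (A2 : exp v * (1 + - v) <= 1) by (rewrite E2 at 2; apply Rmult_le_compat_l; lra).
rewrite Hs, Ey.
assert (E3 : exp v * (1 + (u - v)) + (p - 1) * (exp v * (1 + - v)) = p * exp v) by (rewrite Eu;
  ring).
nra.
Qed.

Lemma rpow_tangent x m p : 0 <= x -> 0 < m -> 1 <= p ->
  rpow m p + p * rpow m p / m * (x - m) <= rpow x p.
Proof.
intros Hx Hm Hp. pose proof (rpow_gt0 m p Hm) as Hmp.
assert (H : 1 + p * (x / m - 1) <= rpow (x / m) p).
{ destruct Hx as [Hx| <-].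
  - rewrite rpow_pos by now apply Rdiv_lt_0_compat. apply bernoulli; trivial.
    now apply Rdiv_lt_0_compat.
  - unfold Rdiv. rewrite Rmult_0_l, rpow_0. lra. }
replace (rpow x p) with (rpow m p * rpow (x / m) p).
- replace (rpow m p + p * rpow m p / m * (x - m)) with (rpow m p * (1 + p * (x / m - 1)))
  by (field; lra).
  apply Rmult_le_compat_l; lra.
- rewrite <- rpow_mult; [f_equal; field; lra|lra|]. apply Rdiv_le_0_compat; lra.
Qed.

(** Integrate the tangent-line inequality [rpow_tangent] at m, the weighted mean of u. *)
Lemma jensen (k u : R -> R) p a b L : a <= b -> 1 <= p -> 0 < L ->
  (forall t, continuous k t) -> (forall t, continuous u t) ->
    (forall t, continuous (fun t => rpow (u t) p) t) ->
  (forall t, a <= t <= b -> 0 <= k t /\ 0 <= u t) -> RInt k a b = L ->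
  rpow (RInt (fun t => k t * u t) a b / L) p <= RInt (fun t => k t * rpow (u t) p) a b / L.
Proof.
intros Hab Hp HL Ck Cu Cup Hpos HkL.
assert (Cku : forall t, continuous (fun t => k t * u t) t) by (intros;
  apply (continuous_mult (K := R_AbsRing)); auto).
assert (Ckp : forall t, continuous (fun t => k t * rpow (u t) p) t) by (intros;
  apply (continuous_mult (K := R_AbsRing)); auto).
assert (Hm0 : 0 <= RInt (fun t => k t * u t) a b).
{ apply RInt_ge_0; [assumption|now apply ex_RInt_all|]. intros t Ht. destruct (Hpos t ltac:(lra)).
  nra. }
set (m := RInt (fun t => k t * u t) a b / L).
assert (Hm : 0 <= m) by (apply Rdiv_le_0_compat; lra).
apply Rmult_le_reg_r with L; [assumption|]. unfold Rdiv at 1.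
rewrite Rmult_assoc, Rinv_l, Rmult_1_r by lra.
destruct Hm as [Hm|Hm].
- set (c := p * rpow m p / m).
  apply Rle_trans with (RInt (fun t => (rpow m p - c * m) * k t + c * (k t * u t)) a b).
  + rewrite RInt_lincomb by now apply ex_RInt_all. rewrite HkL.
    replace (RInt (fun t => k t * u t) a b) with (m * L) by (unfold m; fieldR; lra). lra.
  + apply RInt_le; [assumption| |now apply ex_RInt_all|].
    * apply ex_RInt_lincomb; now apply ex_RInt_all.
    * intros t Ht. destruct (Hpos t ltac:(lra)) as [H1 H2].
      pose proof (rpow_tangent (u t) m p H2 Hm Hp) as H. fold c in H.
      replace ((rpow m p - c * m) * k t + c * (k t * u t)) with (k t * (rpow m p + c * (u t - m)))
        by ring.
      now apply Rmult_le_compat_l.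
- rewrite <- Hm, rpow_0, Rmult_0_l. apply RInt_ge_0; [assumption|now apply ex_RInt_all|].
  intros t Ht. destruct (Hpos t ltac:(lra)). pose proof (rpow_ge0 (u t) p). nra.
Qed.

(** * Subordination for integral means *)

Definition p_integral (p : R) (f : C -> C) (r : R) := RInt (fun t => rpow (Cmod (f (circ r t))) p)
  0 (2 * PI).

Lemma hol_ccurve F rho r : hol rho F -> 0 <= r < rho -> ccurve (fun t => F (circ r t)).
Proof. intros HF Hr. apply (ccurve_comp F r rho); [lra|]. intros; apply cdiff_continuous; auto. Qed.

Lemma continuous_rpow_curve p g : 0 < p -> ccurve g ->
  forall t, continuous (fun t => rpow (Cmod (g t)) p) t.
Proof. intros Hp Hg t. apply (continuous_rpow_Cmod g); trivial. Qed.

Lemma p_integral_ge0 p F r rho : 0 < p -> hol rho F -> 0 <= r < rho -> 0 <= p_integral p F r.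
Proof.
intros. apply RInt_ge_0; [auto| |intros; apply rpow_ge0].
apply ex_RInt_all, (continuous_rpow_curve p (fun t => F (circ r t))); trivial. eapply hol_ccurve;
  eauto.
Qed.

Lemma rpow_poisson p F rho R w : 1 <= p -> hol rho F -> Cmod w < R -> R < rho ->
  rpow (Cmod (F w)) p <= RInt (fun t => poisson R w (circ R t) * rpow (Cmod (F (circ R t))) p)
    0 (2 * PI) / (2 * PI).
Proof.
intros Hp HF Hw HR. pose proof (Cmod_ge_0 w). pose proof PI_RGT_0.
assert (CF : ccurve (fun t => F (circ R t))) by (eapply hol_ccurve; [eassumption|lra]).
assert (CP := continuous_poisson_circ R w Hw).
eapply Rle_trans; [|apply (jensen (fun t => poisson R w (circ R t))
  (fun t => Cmod (F (circ R t)))); auto; try lra].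
- apply rpow_le; [lra|apply Cmod_ge_0|].
  apply Rmult_le_reg_l with (2 * PI); [lra|].
  replace (2 * PI * (_ / _)) with (RInt (fun t => poisson R w (circ R t) * Cmod (F (circ R t)))
    0 (2 * PI)) by (fieldR; lra).
  replace (2 * PI * Cmod (F w)) with (Cmod (RtoC (2 * PI) * F w)) by (rewrite Cmod_mult, Cmod_R,
    Rabs_pos_eq; lra).
  rewrite <- (poisson_formula F rho R w) by assumption.
  eapply Rle_trans; [apply Cmod_CInt_le; [auto|]|].
  + intros t _. apply continuous_Cmult; [apply (continuous_RtoC (fun t => poisson R w (circ R t)));
    apply CP|apply CF].
  + right. apply RInt_extR; [auto|]. intros t _. rewrite Cmod_mult, Cmod_R, Rabs_pos_eq; trivial.
    left; apply poisson_pos; trivial. apply Cmod_circ_pos; lra.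
- intros t. apply (continuous_Cmod (fun t => F (circ R t))), CF.
- apply continuous_rpow_curve; [lra|assumption].
- intros t _. split; [left; apply poisson_pos; trivial; apply Cmod_circ_pos; lra|apply Cmod_ge_0].
- now apply RInt_poisson.
Qed.

Lemma continuous_poisson {U : UniformSpace} R (f g : U -> C_UniformSpace) u : continuous f u ->
  continuous g u ->
  (g u - f u)%C <> 0 -> continuous (fun x => poisson R (f x) (g x)) u.
Proof.
intros Hf Hg Hne. unfold poisson.
assert (Hsq : forall h : U -> C_UniformSpace, continuous h u ->
  continuous (fun x => Cmod (h x) ^ 2) u).
{ intros h Hh. apply (continuous_mult (K := R_AbsRing));
  [|apply (continuous_mult (K := R_AbsRing)); [|apply continuous_const]];
  now apply (continuous_Cmod h). }
apply (continuous_mult (K := R_AbsRing)).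
- apply (continuous_minus (V := R_NormedModule)); [apply continuous_const|now apply Hsq].
- apply (continuous_comp (fun x => Cmod (g x - f x) ^ 2) Rinv).
  + apply (Hsq (fun x => g x - f x)%C). now apply continuous_Cminus.
  + apply continuous_Rinv. apply pow_nonzero. apply Cmod_gt_0 in Hne. lra.
Qed.

(** Bound |F(phi z)|^p by [rpow_poisson], exchange the integrals, and evaluate the inner one with
    [RInt_poisson_pole]. *)
Theorem subordination p F rho R r b (phi : C -> C) : 1 <= p -> hol 1 F -> R < 1 ->
  (forall z, Cmod z < rho -> cdiff phi z /\ Cmod (phi z) < R) -> Cmod b < r -> r < rho ->
  RInt (fun t => poisson r b (circ r t) * rpow (Cmod (F (phi (circ r t)))) p) 0 (2 * PI)
   <= (R + Cmod (phi b)) / (R - Cmod (phi b)) * p_integral p F R.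
Proof.
intros Hp HF HR Hphi Hb Hr. pose proof (Cmod_ge_0 b). pose proof PI_RGT_0.
assert (Hphib : Cmod (phi b) < R) by (apply Hphi; lra).
pose proof (Cmod_ge_0 (phi b)).
assert (Cphi : ccurve (fun t => phi (circ r t))).
{ apply (hol_ccurve phi rho); [|lra]. intros z Hz; now apply Hphi. }
assert (Hin : forall t, Cmod (phi (circ r t)) < R) by (intros; apply Hphi; rewrite Cmod_circ_pos;
  lra).
assert (CF : ccurve (fun t => F (circ R t))) by (eapply hol_ccurve; [eassumption|lra]).
assert (CV := continuous_rpow_curve p _ ltac:(lra) CF).
assert (CB := continuous_poisson_circ r b Hb).
assert (CFphi : ccurve (fun t => F (phi (circ r t)))).
{ intros t. apply (continuous_hol F (fun t => phi (circ r t))); [|apply Cphi]. apply HF.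
  specialize (Hin t). lra. }
set (V := fun tau => rpow (Cmod (F (circ R tau))) p) in *.
set (f := fun t tau => poisson r b (circ r t) * poisson R (phi (circ r t)) (circ R tau) * V tau).
assert (Hf : cont2 f).
{ intros t tau. unfold f.
  apply (continuous_mult (K := R_AbsRing)); [apply (continuous_mult (K := R_AbsRing))|].
  - apply (continuous_comp (fun q : prod_UniformSpace R_UniformSpace R_UniformSpace => fst q)
    (fun t => poisson r b (circ r t))); [apply continuous_fst|apply CB].
  - apply continuous_poisson.
    + apply (continuous_comp (fun q : prod_UniformSpace R_UniformSpace R_UniformSpace => fst q)
      (fun t => phi (circ r t))); [apply continuous_fst|apply Cphi].
    + apply (continuous_comp (fun q : prod_UniformSpace R_UniformSpace R_UniformSpace => snd q)
      (circ R)); [apply continuous_snd|apply ccurve_circ].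
    + apply circ_neq, Hin.
  - apply (continuous_comp (fun q : prod_UniformSpace R_UniformSpace R_UniformSpace => snd q) V);
    [apply continuous_snd|apply CV]. }
assert (Hcirc : forall s tau, 0 <= s -> Cmod (circ s tau) = s) by (intros; now apply Cmod_circ_pos).
apply Rle_trans with (RInt (fun t => RInt (fun tau => f t tau) 0 (2 * PI)) 0 (2 * PI) / (2 * PI)).
- apply Rmult_le_reg_l with (2 * PI); [lra|].
  replace (2 * PI * (_ / _)) with (RInt (fun t => RInt (fun tau => f t tau) 0 (2 * PI)) 0 (2 * PI))
    by (fieldR; lra).
  assert (Ex : ex_RInt (fun t => poisson r b (circ r t) * rpow (Cmod (F (phi (circ r t)))) p)
    0 (2 * PI)).
  { apply ex_RInt_all. intros t. apply (continuous_mult (K := R_AbsRing)); [apply CB|].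
    apply (continuous_rpow_curve p (fun t => F (phi (circ r t)))); [lra|assumption]. }
  assert (E : RInt (fun t => 2 * PI * (poisson r b (circ r t) * rpow (Cmod (F (phi (circ r t))))
    p)) 0 (2 * PI) =
   2 * PI * RInt (fun t => poisson r b (circ r t) * rpow (Cmod (F (phi (circ r t)))) p) 0 (2 * PI))
   by now apply RInt_scalR.
  rewrite <- E. apply RInt_le; [auto|now apply ex_RInt_scalR| |].
  + apply ex_RInt_all. intros t. now apply continuous_RInt_param.
  + intros t _. unfold f.
    assert (Ext : ex_RInt (fun tau => poisson R (phi (circ r t)) (circ R tau) * V tau) 0 (2 * PI)).
    { apply ex_RInt_all. intros tau. apply (continuous_mult (K := R_AbsRing));
      [apply continuous_poisson_circ, Hin|apply CV]. }
    rewrite (RInt_extR 0 (2 * PI) ltac:(auto) _ (fun tau => poisson r b (circ r t)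
      * (poisson R (phi (circ r t)) (circ R tau) * V tau)))
      by (intros; asR; ring).
    assert (E2 : RInt (fun tau => poisson r b (circ r t) * (poisson R (phi (circ r t)) (circ R tau)
      * V tau)) 0 (2 * PI) =
      poisson r b (circ r t) * RInt (fun tau => poisson R (phi (circ r t)) (circ R tau) * V tau)
        0 (2 * PI))
      by now apply RInt_scalR.
    rewrite E2. pose proof (rpow_poisson p F 1 R (phi (circ r t)) Hp HF (Hin t) HR) as HJ.
    pose proof (poisson_pos r b (circ r t) Hb ltac:(apply Hcirc; lra)) as HP. fold V in HJ.
    apply Rmult_le_compat_l with (r := 2 * PI) in HJ; [|lra].
    replace (2 * PI * (RInt (fun t0 => poisson R (phi (circ r t)) (circ R t0)
      * rpow (Cmod (F (circ R t0))) p) 0 (2 * PI) / (2 * PI)))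
      with (RInt (fun t0 => poisson R (phi (circ r t)) (circ R t0) * V t0) 0 (2 * PI))
        in HJ by (unfold V; fieldR; lra).
    rewrite (Rmult_comm (2 * PI)), Rmult_assoc, (Rmult_comm _ (2 * PI)).
    apply Rmult_le_compat_l; lra.
- rewrite (fubini f) by auto.
  assert (Exb : ex_RInt (fun tau => poisson R (phi b) (circ R tau) * V tau) 0 (2 * PI)).
  { apply ex_RInt_all. intros tau. apply (continuous_mult (K := R_AbsRing));
    [now apply continuous_poisson_circ|apply CV]. }
  rewrite (RInt_extR 0 (2 * PI) ltac:(auto) _ (fun tau => 2 * PI * (poisson R (phi b) (circ R tau)
    * V tau))).
  + assert (E : RInt (fun tau => 2 * PI * (poisson R (phi b) (circ R tau) * V tau)) 0 (2 * PI) =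
      2 * PI * RInt (fun tau => poisson R (phi b) (circ R tau) * V tau) 0 (2 * PI))
      by now apply RInt_scalR.
    rewrite E. replace (2 * PI * _ / (2 * PI)) with (RInt (fun tau => poisson R (phi b)
      (circ R tau) * V tau) 0 (2 * PI)) by (fieldR; lra).
    assert (ExV : ex_RInt V 0 (2 * PI)) by now apply ex_RInt_all.
    set (K := (R + Cmod (phi b)) / (R - Cmod (phi b))).
    assert (E3 : RInt (fun tau => K * V tau) 0 (2 * PI) = K * p_integral p F R)
      by now apply RInt_scalR.
    rewrite <- E3. apply RInt_le; [auto|assumption|now apply ex_RInt_scalR|].
    intros tau _. apply Rmult_le_compat_r; [apply rpow_ge0|]. apply poisson_le; trivial.
    apply Hcirc; lra.
  + intros tau _. unfold f.
    assert (Ext : ex_RInt (fun t => poisson r b (circ r t) * poisson R (phi (circ r t))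
      (circ R tau)) 0 (2 * PI)).
    { apply ex_RInt_all. intros t. apply (continuous_mult (K := R_AbsRing)); [apply CB|].
      apply (continuous_poisson R (fun t => phi (circ r t)) (fun _ => circ R tau));
        [apply Cphi|apply continuous_const|apply circ_neq, Hin]. }
    rewrite (RInt_extR 0 (2 * PI) ltac:(auto) _ (fun t => V tau * (poisson r b (circ r t)
      * poisson R (phi (circ r t)) (circ R tau))))
      by (intros; asR; ring).
    assert (E : RInt (fun t => V tau * (poisson r b (circ r t) * poisson R (phi (circ r t))
      (circ R tau))) 0 (2 * PI) =
      V tau * RInt (fun t => poisson r b (circ r t) * poisson R (phi (circ r t)) (circ R tau))
        0 (2 * PI))
      by now apply RInt_scalR.
    rewrite E, (RInt_poisson_pole r rho R b phi (circ R tau)); trivial; [ring|apply Hcirc; lra].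
Qed.

(** The case of constant phi. *)
Corollary point_bound p F R w : 1 <= p -> hol 1 F -> R < 1 -> Cmod w < R ->
  2 * PI * rpow (Cmod (F w)) p <= (R + Cmod w) / (R - Cmod w) * p_integral p F R.
Proof.
intros Hp HF HR Hw. pose proof (Cmod_ge_0 w).
eapply Rle_trans; [|apply (subordination p F 1 R (1/2) 0 (fun _ => w)); trivial; rewrite ?Cmod_0;
  try lra].
- right. pose proof (RInt_poisson (1/2) 0) as E. rewrite Cmod_0 in E. specialize (E ltac:(lra)).
  assert (Ex : ex_RInt (fun t => poisson (1/2) 0 (circ (1/2) t)) 0 (2 * PI)) by (apply ex_RInt_all,
    continuous_poisson_circ; rewrite Cmod_0; lra).
  rewrite (RInt_extR 0 (2 * PI) ltac:(auto) _ (fun t => rpow (Cmod (F w)) p * poisson (1/2)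
    0 (circ (1/2) t))) by (intros; asR; ring).
  assert (E2 : RInt (fun t => rpow (Cmod (F w)) p * poisson (1/2) 0 (circ (1/2) t)) 0 (2 * PI) =
    rpow (Cmod (F w)) p * RInt (fun t => poisson (1/2) 0 (circ (1/2) t)) 0 (2 * PI))
    by now apply RInt_scalR.
  rewrite E2, E. asR; ring.
- intros z _. split; [apply cdiff_const|assumption].
Qed.

(** The case phi = id, b = 0; for r = 0 the circle is a point. *)
Corollary p_integral_mono p F r R : 1 <= p -> hol 1 F -> 0 <= r -> r <= R -> R < 1 ->
  p_integral p F r <= p_integral p F R.
Proof.
intros Hp HF Hr HrR HR.
destruct HrR as [HrR| ->]; [|lra]. destruct Hr as [Hr| <-].
- eapply Rle_trans; [|eapply Rle_trans; [apply (subordination p F R R r 0 (fun z => z));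
  rewrite ?Cmod_0; trivial|]].
  + right. apply RInt_extR; [auto|]. intros t _.
    replace (poisson r 0 (circ r t)) with 1; [asR; ring|]. unfold poisson.
    replace (circ r t - 0)%C with (circ r t) by ring. rewrite Cmod_circ_pos, Cmod_0 by lra. field.
    lra.
  + intros z Hz. split; [apply cdiff_id|assumption].
  + rewrite Cmod_0. right. field. lra.
- pose proof (point_bound p F R 0 Hp HF HR ltac:(rewrite Cmod_0; lra)) as H.
  rewrite Cmod_0 in H. replace ((R + 0) / (R - 0)) with 1 in H by (field; lra).
  rewrite Rmult_1_l in H.
  eapply Rle_trans; [|exact H]. right. unfold p_integral.
  rewrite (RInt_extR 0 (2 * PI) ltac:(auto) _ (fun _ => rpow (Cmod (F 0)) p)).
  + rewrite RInt_constR. asR; ring.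
  + intros t _. do 3 f_equal. unfold circ. ring.
Qed.

(** * Automorphisms of the disc *)

Lemma aut_den_neq0 (phi : disc_aut) z : Cmod z <= 1 -> (1 - Cconj (aut_pt phi) * z)%C <> 0.
Proof.
intros Hz. apply Cmod_gt_0. pose proof (aut_den_bound (aut_pt phi) z Hz).
pose proof (aut_ptP phi) as H1. unfold unit_disc in H1. lra.
Qed.

Lemma Cmod_aut_sqr phi z : Cmod z <= 1 ->
  1 - Cmod (aut_eval phi z) ^ 2 =
  (1 - Cmod (aut_pt phi) ^ 2) * (1 - Cmod z ^ 2) / Cmod (1 - Cconj (aut_pt phi) * z) ^ 2.
Proof.
intros Hz. pose proof (aut_den_neq0 phi z Hz) as Hd. unfold aut_eval.
rewrite Cmod_div, Cmod_mult, (aut_lamP phi) by assumption.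
assert (Hd2 : Cmod (1 - Cconj (aut_pt phi) * z) ^ 2 <> 0) by (apply pow_nonzero;
  apply Cmod_gt_0 in Hd; lra).
unfold Rdiv at 1. rewrite Rmult_1_l, Rpow_mult_distr, pow_inv.
apply Rmult_eq_reg_r with (2 := Hd2). field_simplify; [|intros E; apply Hd2; rewrite E; ring ..].
rewrite !Cmod2_alt. destruct z as [x y], (aut_pt phi) as [u v]. unfold Re, Im; simpl. ring.
Qed.

Lemma Cmod_aut_lt phi z : Cmod z < 1 -> Cmod (aut_eval phi z) < 1.
Proof.
intros Hz. pose proof (Cmod_aut_sqr phi z ltac:(lra)) as E.
pose proof (aut_ptP phi) as Ha. unfold unit_disc in Ha.
assert (0 < (1 - Cmod (aut_pt phi) ^ 2) * (1 - Cmod z ^ 2) / Cmod (1 - Cconj (aut_pt phi) * z) ^ 2).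
{ pose proof (Cmod_ge_0 z). pose proof (Cmod_ge_0 (aut_pt phi)).
  apply Rdiv_lt_0_compat; [apply Rmult_lt_0_compat; nra|].
  apply pow_lt, Cmod_gt_0, aut_den_neq0; lra. }
pose proof (Cmod_ge_0 (aut_eval phi z)). nra.
Qed.

Lemma cdiff_aut phi z : Cmod z <= 1 -> cdiff (aut_eval phi) z.
Proof.
intros Hz. unfold aut_eval.
apply (cdiff_div (fun z => aut_lam phi * (z - aut_pt phi))%C (fun z => 1 - Cconj (aut_pt phi)
  * z)%C).
- apply (cdiff_mult (fun _ => aut_lam phi) (fun z => z - aut_pt phi)%C);
  [apply cdiff_const|apply cdiff_id_minus].
- apply (cdiff_minus (fun _ => 1) (fun z => Cconj (aut_pt phi) * z)%C); [apply cdiff_const|].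
  apply (cdiff_mult (fun _ => Cconj (aut_pt phi)) (fun z => z)); [apply cdiff_const|apply cdiff_id].
- now apply aut_den_neq0.
Qed.

Lemma aut_inv_lamP (phi : disc_aut) : Cmod (Cconj (aut_lam phi)) = 1.
Proof. rewrite Cmod_conj. apply aut_lamP. Qed.

Lemma aut_inv_ptP (phi : disc_aut) : unit_disc (- (aut_lam phi * aut_pt phi)).
Proof. unfold unit_disc. rewrite Cmod_opp, Cmod_mult, (aut_lamP phi), Rmult_1_l. apply aut_ptP. Qed.

Definition aut_inv (phi : disc_aut) : disc_aut := DiscAut _ _ (aut_inv_lamP phi) (aut_inv_ptP phi).

Lemma unimod_conj l : Cmod l = 1 -> (l * Cconj l)%C = 1.
Proof. intros H. rewrite <- Cmod2_conj, H. f_equal. ring. Qed.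

Lemma Cconj_invol z : Cconj (Cconj z) = z.
Proof. destruct z; unfold Cconj; simpl. f_equal; ring. Qed.

Lemma Cconj_opp z : Cconj (- z) = (- Cconj z)%C.
Proof. destruct z; unfold Cconj, Copp; simpl. f_equal; ring. Qed.

Lemma Cconj_plus z w : Cconj (z + w) = (Cconj z + Cconj w)%C.
Proof. destruct z, w; unfold Cconj, Cplus; simpl. f_equal; ring. Qed.

Lemma Cconj_neq0 (z : C) : z <> 0 -> Cconj z <> 0.
Proof. intros H. apply Cmod_gt_0. rewrite Cmod_conj. apply Cmod_gt_0, H. Qed.

Lemma Cconj_RtoC x : Cconj (RtoC x) = RtoC x.
Proof. unfold Cconj, RtoC; simpl. f_equal; ring. Qed.

Lemma Cconj_inv (z : C) : z <> 0 -> Cconj (/ z) = (/ Cconj z)%C.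
Proof.
intros Hz. pose proof (Cconj_neq0 z Hz).
replace (Cconj (/ z)) with (/ Cconj z * Cconj (z * / z))%C by (rewrite Cmult_conj; field;
  assumption).
rewrite Cinv_r, Cconj_RtoC by assumption. ring.
Qed.

Lemma pt_den_neq0 phi : (1 - Cconj (aut_pt phi) * aut_pt phi)%C <> 0.
Proof. apply aut_den_neq0. pose proof (aut_ptP phi) as H. unfold unit_disc in H. lra. Qed.

(** The denominator that turns the weight of phi at phi^(-1)(z) into the reciprocal of the
    weight of the inverse at z. *)
Lemma aut_inv_den phi z : Cmod z <= 1 ->
  (1 - Cconj (aut_pt phi) * aut_eval (aut_inv phi) z)%C =
  ((1 - Cconj (aut_pt phi) * aut_pt phi) / (1 - Cconj (aut_pt (aut_inv phi)) * z))%C.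
Proof.
intros Hz. pose proof (aut_den_neq0 (aut_inv phi) z Hz) as H.
unfold aut_eval. pose proof (unimod_conj _ (aut_lamP phi)) as Hl. simpl in *.
rewrite Cconj_opp, Cmult_conj in *. field_simplify_eq; [|assumption].
set (l := aut_lam phi) in *. set (a := aut_pt phi) in *.
ring [Hl].
Qed.

Lemma aut_invK phi z : Cmod z <= 1 -> aut_eval phi (aut_eval (aut_inv phi) z) = z.
Proof.
intros Hz. pose proof (aut_den_neq0 (aut_inv phi) z Hz) as H. pose proof (pt_den_neq0 phi) as H2.
pose proof (aut_inv_den phi z Hz) as E.
unfold aut_eval at 1. rewrite E. unfold aut_eval.
pose proof (unimod_conj _ (aut_lamP phi)) as Hl. simpl in *.
rewrite Cconj_opp, Cmult_conj in *.
set (l := aut_lam phi) in *. set (a := aut_pt phi) in *.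
field_simplify_eq; [ring [Hl]|split; assumption].
Qed.

Lemma aut_invK' phi z : Cmod z <= 1 -> aut_eval (aut_inv phi) (aut_eval phi z) = z.
Proof.
intros Hz. pose proof (aut_den_neq0 phi z Hz) as H. pose proof (pt_den_neq0 phi) as H2.
unfold aut_eval.
pose proof (unimod_conj _ (aut_lamP phi)) as Hl. simpl in *.
rewrite Cconj_opp, Cmult_conj in *.
set (l := aut_lam phi) in *. set (a := aut_pt phi) in *.
assert (E1 : (l * (z - a) / (1 - Cconj a * z) - - (l * a) = l * z * (1 - Cconj a * a)
  / (1 - Cconj a * z))%C) by (field; assumption).
assert (E2 : (1 - - (Cconj l * Cconj a) * (l * (z - a) / (1 - Cconj a * z)) = (1 - Cconj a * a)
  / (1 - Cconj a * z))%C).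
{ field_simplify_eq; [ring [Hl]|assumption]. }
rewrite E1, E2.
field_simplify_eq; [ring [Hl]|split; assumption].
Qed.

(** * The operator U_phi *)

(** |phi'(z)|, the modulus of the weight. *)
Definition weight_mod (phi : disc_aut) z := (1 - Cmod (aut_pt phi) ^ 2)
  / Cmod (1 - Cconj (aut_pt phi) * z) ^ 2.

Lemma pt_sq_lt phi : 0 < 1 - Cmod (aut_pt phi) ^ 2.
Proof. pose proof (aut_ptP phi) as H. unfold unit_disc in H. pose proof (Cmod_ge_0 (aut_pt phi)).
nra. Qed.

Lemma Cmod_weight phi z : Cmod z < 1 -> Cmod (aut_weight phi z) = weight_mod phi z.
Proof.
intros Hz. rewrite aut_weightE by exact Hz.
pose proof (aut_den_neq0 phi z ltac:(lra)) as H.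
rewrite Cmod_div by now apply Cpow_nz. rewrite <- RtoC_minus, Cmod_R, Cmod_pow,
  Rabs_pos_eq by (left; apply pt_sq_lt).
reflexivity.
Qed.

Lemma weight_mod_pos phi z : Cmod z <= 1 -> 0 < weight_mod phi z.
Proof. intros. apply Rdiv_lt_0_compat; [apply pt_sq_lt|]. apply pow_lt, Cmod_gt_0, aut_den_neq0;
  assumption. Qed.

(** The chain rule for |(phi^(-1))'|. *)
Lemma weight_mod_inv phi z : Cmod z <= 1 ->
  weight_mod (aut_inv phi) z * weight_mod phi (aut_eval (aut_inv phi) z) = 1.
Proof.
intros Hz. unfold weight_mod. rewrite aut_inv_den by assumption.
pose proof (aut_den_neq0 (aut_inv phi) z Hz) as H. rewrite Cmod_div by assumption.
assert (E : Cmod (1 - Cconj (aut_pt phi) * aut_pt phi) = 1 - Cmod (aut_pt phi) ^ 2).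
{ rewrite Cmult_comm, <- Cmod2_conj, <- RtoC_minus, Cmod_R, Rabs_pos_eq; trivial. left;
  apply pt_sq_lt. }
rewrite E. apply Cmod_gt_0 in H.
replace (Cmod (aut_pt (aut_inv phi))) with (Cmod (aut_pt phi)) by (simpl;
  rewrite Cmod_opp, Cmod_mult, (aut_lamP phi); ring).
pose proof (pt_sq_lt phi). field. split; lra.
Qed.

(** |1 / d^2| + Re (1 / d^2) = 2 (Re d)^2 / |d|^4. *)
Lemma weight_slit (c : R) (d : C) : 0 < c -> 0 < Re d ->
  0 < Cmod (RtoC c / d ^ 2) + Re (RtoC c / d ^ 2).
Proof.
intros Hc Hd. assert (Hd0 : d <> 0) by (intros ->; simpl in Hd; lra).
assert (Hd2 : (d ^ 2)%C <> 0) by now apply Cpow_nz.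
rewrite Cmod_div, Cmod_R, Rabs_pos_eq, Cmod_pow, Cmod2_alt by (trivial; lra).
destruct d as [x y]. unfold Re, Im in *. simpl in Hd.
assert (Hs : 0 < x ^ 2 + y ^ 2) by nra.
assert (E : fst (RtoC c / (x, y) ^ 2)%C = c * (x ^ 2 - y ^ 2) / (x ^ 2 + y ^ 2) ^ 2).
{ simpl. field. split; [nra|]. intros E. assert ((x ^ 2 + y ^ 2) ^ 2 = 0) by (rewrite <- E; ring).
  nra. }
rewrite E. simpl fst; simpl snd.
replace (c / (x ^ 2 + y ^ 2) + c * (x ^ 2 - y ^ 2) / (x ^ 2 + y ^ 2) ^ 2)
  with (2 * c * x ^ 2 / (x ^ 2 + y ^ 2) ^ 2) by (field; lra).
apply Rdiv_lt_0_compat; [|now apply pow_lt]. apply Rmult_lt_0_compat; [lra|apply pow_lt; lra].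
Qed.

Lemma Re_den_pos phi z : Cmod z < 1 -> 0 < Re (1 - Cconj (aut_pt phi) * z)%C.
Proof.
intros Hz. pose proof (Rabs_fst_le (Cconj (aut_pt phi) * z)) as H.
rewrite Cmod_mult, Cmod_conj in H.
pose proof (aut_ptP phi) as Ha. unfold unit_disc in Ha. pose proof (Cmod_ge_0 z).
pose proof (Cmod_ge_0 (aut_pt phi)).
replace (Re (1 - Cconj (aut_pt phi) * z)) with (1 - fst (Cconj (aut_pt phi) * z)%C) by reflexivity.
pose proof (Rle_abs (fst (Cconj (aut_pt phi) * z)%C)). nra.
Qed.

Lemma disc_nbhd z : Cmod z < 1 -> forall w, Cmod (w - z) < 1 - Cmod z -> Cmod w < 1.
Proof. intros Hz w Hw. pose proof (Cmod_triangle_sub w z). lra. Qed.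

Lemma weight_off_cut phi z : Cmod z < 1 -> 0 < Cmod (aut_weight phi z) + Re (aut_weight phi z).
Proof.
intros Hz. rewrite aut_weightE by exact Hz. rewrite <- RtoC_minus. apply weight_slit;
  [apply pt_sq_lt|now apply Re_den_pos].
Qed.

Lemma cdiff_root_weight p phi z : p <> 0 -> Cmod z < 1 ->
  cdiff (fun z => croot p (aut_weight phi z)) z.
Proof.
intros Hp Hz.
set (W := fun z => ((1 - RtoC (Cmod (aut_pt phi) ^ 2)) / (1 - Cconj (aut_pt phi) * z) ^ 2)%C).
apply cdiff_ext_loc with (fun z => croot p (W z)) (1 - Cmod z); [lra| |].
- intros w Hw. unfold W. rewrite aut_weightE; trivial. now apply (disc_nbhd z).
- apply (cdiff_comp (croot p) W).
  + apply cdiff_croot; trivial. pose proof (weight_off_cut phi z Hz) as H.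
    now rewrite aut_weightE in H.
  + apply (cdiff_div (fun _ => _) (fun z => (1 - Cconj (aut_pt phi) * z) ^ 2)%C);
    [apply cdiff_const| |].
    * assert (Hden : cdiff (fun z => 1 - Cconj (aut_pt phi) * z)%C z).
      { apply (cdiff_minus (fun _ => 1) (fun z => Cconj (aut_pt phi) * z)%C); [apply cdiff_const|].
        apply (cdiff_mult (fun _ => Cconj (aut_pt phi)) (fun z => z));
          [apply cdiff_const|apply cdiff_id]. }
      apply (cdiff_mult (fun z => 1 - Cconj (aut_pt phi) * z)%C (fun z => (1 - Cconj (aut_pt phi)
        * z) * 1)%C); trivial.
      apply (cdiff_mult _ (fun _ => 1)); [trivial|apply cdiff_const].
    * apply Cpow_nz, aut_den_neq0. lra.
Qed.

Lemma Cmod_root_weight p phi z : 0 < p -> Cmod z < 1 ->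
  rpow (Cmod (croot p (aut_weight phi z))) p = weight_mod phi z.
Proof.
intros Hp Hz. unfold croot. rewrite Cmod_mult, Cmod_cis, Cmod_R, Rmult_1_r,
  Rabs_pos_eq by apply rpow_ge0.
rewrite rpow_inv by (trivial; apply Cmod_ge_0). now apply Cmod_weight.
Qed.

Lemma root_weight_neq0 p phi z : 0 < p -> Cmod z < 1 -> croot p (aut_weight phi z) <> 0.
Proof.
intros Hp Hz E. pose proof (Cmod_root_weight p phi z Hp Hz) as H. rewrite E, Cmod_0, rpow_0 in H.
pose proof (weight_mod_pos phi z ltac:(lra)). lra.
Qed.

Lemma hol_comp_aut phi f : hol 1 f -> hol 1 (fun z => f (aut_eval phi z)).
Proof.
intros Hf z Hz. apply (cdiff_comp f (aut_eval phi)); [apply Hf, Cmod_aut_lt, Hz|apply cdiff_aut;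
  lra].
Qed.

Lemma hol_U p phi f : 0 < p -> hol 1 f -> hol 1 (U_op p phi f).
Proof.
intros Hp Hf z Hz. apply (cdiff_mult (fun z => croot p (aut_weight phi z))
  (fun z => f (aut_eval phi z))).
- apply cdiff_root_weight; trivial. lra.
- now apply hol_comp_aut.
Qed.

Lemma rpow_U p phi f z : 0 < p -> Cmod z < 1 ->
  rpow (Cmod (U_op p phi f z)) p = weight_mod phi z * rpow (Cmod (f (aut_eval phi z))) p.
Proof.
intros Hp Hz. unfold U_op, mul_op, comp_op. rewrite Cmod_mult, rpow_mult by apply Cmod_ge_0.
now rewrite Cmod_root_weight.
Qed.

(** On |z| = r one has |z - r^2 a| = r |1 - conj a z|, so both sides have the same denominator
    and the numerators are 1 - |a|^2 and 1 - r^2 |a|^2. *)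
Lemma weight_mod_le_poisson phi r z : 0 < r < 1 -> Cmod z = r ->
  weight_mod phi z <= poisson r (RtoC (r ^ 2) * aut_pt phi) z.
Proof.
intros Hr Hz. pose proof (pt_sq_lt phi) as Ha. pose proof (Cmod_ge_0 (aut_pt phi)) as Ha0.
pose proof (aut_den_neq0 phi z ltac:(lra)) as Hd. apply Cmod_gt_0 in Hd.
unfold weight_mod, poisson. rewrite Cmod_mult, Cmod_R, Rabs_pos_eq by nra.
assert (E : Cmod (z - RtoC (r ^ 2) * aut_pt phi) ^ 2 = r ^ 2 * Cmod (1 - Cconj (aut_pt phi) * z)
  ^ 2).
{ assert (Hz2 : r ^ 2 = Re z ^ 2 + Im z ^ 2) by (rewrite <- Hz; apply Cmod2_alt).
  rewrite !Cmod2_alt. rewrite Hz2. destruct z as [x y], (aut_pt phi) as [u v]. unfold Re, Im;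
    simpl. ring. }
rewrite E.
replace ((r ^ 2 - (r ^ 2 * Cmod (aut_pt phi)) ^ 2) / (r ^ 2 * Cmod (1 - Cconj (aut_pt phi) * z)
  ^ 2))
 with ((1 - r ^ 2 * Cmod (aut_pt phi) ^ 2) / Cmod (1 - Cconj (aut_pt phi) * z) ^ 2) by (field; lra).
apply Rmult_le_compat_r; [left; apply Rinv_0_lt_compat, pow_lt; lra|].
assert (r ^ 2 * Cmod (aut_pt phi) ^ 2 <= 1 * Cmod (aut_pt phi) ^ 2) by (apply Rmult_le_compat_r;
  nra). lra.
Qed.

Lemma aut_compact phi rho : 0 <= rho < 1 -> exists R0, 0 <= R0 < 1 /\ forall z, Cmod z < rho ->
  Cmod (aut_eval phi z) <= R0.
Proof.
intros Hrho. pose proof (pt_sq_lt phi) as Ha.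
set (q := 1 - (1 - Cmod (aut_pt phi) ^ 2) * (1 - rho ^ 2) / 4).
exists ((1 + q) / 2).
assert (Hq : 0 <= q < 1).
{ unfold q. pose proof (pow2_ge_0 (Cmod (aut_pt phi))). assert (0 < 1 - rho ^ 2) by nra.
  assert (rho ^ 2 >= 0) by nra. nra. }
split; [lra|]. intros z Hz.
pose proof (Cmod_aut_sqr phi z ltac:(lra)) as E. pose proof (Cmod_ge_0 z).
assert (Hd : 0 < Cmod (1 - Cconj (aut_pt phi) * z) <= 2).
{ split; [apply Cmod_gt_0, aut_den_neq0; lra|]. eapply Rle_trans; [apply Cmod_minus_le|].
  rewrite Cmod_1, Cmod_mult, Cmod_conj. pose proof (Cmod_ge_0 (aut_pt phi)). nra. }
assert (Hge : (1 - Cmod (aut_pt phi) ^ 2) * (1 - rho ^ 2) / 4 <= 1 - Cmod (aut_eval phi z) ^ 2).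
{ rewrite E. unfold Rdiv. apply Rmult_le_compat; [|lra| |].
  - apply Rmult_le_pos; nra.
  - apply Rmult_le_compat_l; nra.
  - apply Rinv_le_contravar; [apply pow_lt; lra|nra]. }
fold q in Hge. assert (Cmod (aut_eval phi z) ^ 2 <= q) by (unfold q; lra). nra.
Qed.

Lemma le_of_approx X M K : 0 <= K -> (forall del, 0 < del < / 4 -> X <= M + K * del) -> X <= M.
Proof.
intros HK H. apply Rnot_lt_le. intros Hlt.
set (d := Rmin (/ 8) ((X - M) / (2 * (K + 1)))).
assert (Hd : 0 < d) by (unfold d; apply Rmin_case; [lra|apply Rdiv_lt_0_compat; lra]).
pose proof (Rmin_l (/ 8) ((X - M) / (2 * (K + 1)))).
pose proof (Rmin_r (/ 8) ((X - M) / (2 * (K + 1)))). fold d in H0, H1.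
specialize (H d ltac:(lra)).
assert (d * (2 * (K + 1)) <= X - M).
{ replace (X - M) with ((X - M) / (2 * (K + 1)) * (2 * (K + 1))) by (field; lra).
  apply Rmult_le_compat_r; lra. }
nra.
Qed.

(** Upper bounds stand in for the suprema in the norm: an inequality between norms becomes an
    implication between bounds. *)
Definition bounded_means p f M := forall r, 0 <= r < 1 -> p_integral p f r <= M.

(** The choice b = r^2 a of the pole comes from [weight_mod_le_poisson]. *)
Lemma p_integral_U_le p phi f r R : 1 <= p -> hol 1 f -> 0 < r < 1 -> R < 1 ->
  (forall z, Cmod z < (1 + r) / 2 -> Cmod (aut_eval phi z) < R) ->
  let c := Cmod (aut_eval phi (RtoC (r ^ 2) * aut_pt phi)%C) in
  c < R /\ p_integral p (U_op p phi f) r <= (R + c) / (R - c) * p_integral p f R.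
Proof.
intros Hp Hf Hr HR Hphi c. pose proof (Cmod_ge_0 (aut_pt phi)).
pose proof (aut_ptP phi) as Ha. unfold unit_disc in Ha.
set (b := (RtoC (r ^ 2) * aut_pt phi)%C) in *.
assert (Hb : Cmod b < r).
{ unfold b. rewrite Cmod_mult, Cmod_R, Rabs_pos_eq by nra. nra. }
split; [apply Hphi; lra|].
eapply Rle_trans; [|apply (subordination p f ((1 + r) / 2) R r b (aut_eval phi) Hp Hf HR)]; try lra.
- apply RInt_le; [auto| | |].
  + apply ex_RInt_all, (continuous_rpow_curve p (fun t => U_op p phi f (circ r t))); [lra|].
    apply (hol_ccurve _ 1); [apply hol_U; [lra|assumption]|lra].
  + apply ex_RInt_all. intros t. apply (continuous_mult (K := R_AbsRing));
    [now apply continuous_poisson_circ|].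
    apply (continuous_rpow_curve p (fun t => f (aut_eval phi (circ r t)))); [lra|].
    apply (hol_ccurve (fun z => f (aut_eval phi z)) 1); [now apply hol_comp_aut|lra].
  + intros t _. assert (Hc : Cmod (circ r t) = r) by (apply Cmod_circ_pos; lra).
    rewrite rpow_U by lra. apply Rmult_le_compat_r; [apply rpow_ge0|].
    now apply weight_mod_le_poisson.
- intros z Hz. split; [apply cdiff_aut; lra|now apply Hphi].
Qed.

Lemma aut_near_zero phi r : 0 <= r <= 1 ->
  Cmod (aut_eval phi (RtoC (r ^ 2) * aut_pt phi)%C) <= 2 * (1 - r) / (1 - Cmod (aut_pt phi)).
Proof.
intros Hr. pose proof (aut_ptP phi) as Ha. unfold unit_disc in Ha.
pose proof (Cmod_ge_0 (aut_pt phi)).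
assert (Hb : Cmod (RtoC (r ^ 2) * aut_pt phi) <= 1) by (rewrite Cmod_mult, Cmod_R,
  Rabs_pos_eq by nra; nra).
unfold aut_eval. rewrite Cmod_div by now apply aut_den_neq0.
rewrite Cmod_mult, (aut_lamP phi), Rmult_1_l.
pose proof (aut_den_bound (aut_pt phi) _ Hb).
replace (RtoC (r ^ 2) * aut_pt phi - aut_pt phi)%C with (RtoC (r ^ 2 - 1)
  * aut_pt phi)%C by (rewrite RtoC_minus; ring).
rewrite Cmod_mult, Cmod_R, Rabs_left1 by nra.
assert (Hu : 0 <= - (r ^ 2 - 1) <= 2 * (1 - r)) by nra.
apply Rmult_le_compat; [apply Rmult_le_pos; lra|left; apply Rinv_0_lt_compat; lra|nra|].
apply Rinv_le_contravar; lra.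
Qed.

(** In [p_integral_U_le] the factor (R + c) / (R - c) tends to 1 as r -> 1 and R -> 1, because
    c = |phi(r^2 a)| tends to |phi(a)| = 0; the means of U f increase with r. *)
Theorem U_bound p phi f M : 1 <= p -> hol 1 f -> bounded_means p f M ->
  bounded_means p (U_op p phi f) M.
Proof.
intros Hp Hf HM s Hs.
assert (HUf : hol 1 (U_op p phi f)) by (apply hol_U; trivial; lra).
assert (HM0 : 0 <= M) by (eapply Rle_trans; [apply (p_integral_ge0 p f 0 1); trivial; lra|apply HM;
  lra]).
pose proof (aut_ptP phi) as Ha. unfold unit_disc in Ha. pose proof (Cmod_ge_0 (aut_pt phi)).
apply le_of_approx with (8 * M); [lra|]. intros d Hd.
(* r is chosen with phi(r^2 a) = O(1 - r) at most d, then R with 1 - R at most d. *)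
set (r := Rmax s (1 - d * (1 - Cmod (aut_pt phi)) / 2)).
assert (Hr : 0 < r < 1).
{ split; [eapply Rlt_le_trans; [|apply Rmax_r]; nra|]. apply Rmax_lub_lt; [lra|nra]. }
assert (Hsr : s <= r) by apply Rmax_l.
assert (Hc : Cmod (aut_eval phi (RtoC (r ^ 2) * aut_pt phi)%C) <= d).
{ eapply Rle_trans; [apply aut_near_zero; lra|].
  pose proof (Rmax_r s (1 - d * (1 - Cmod (aut_pt phi)) / 2)). fold r in H0.
  apply Rmult_le_reg_r with (1 - Cmod (aut_pt phi)); [lra|]. unfold Rdiv.
  rewrite Rmult_assoc, Rinv_l; lra. }
destruct (aut_compact phi ((1 + r) / 2) ltac:(lra)) as [R0 [HR0 HR0']].
set (R := (1 + Rmax R0 (1 - d)) / 2).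
assert (HR : R0 < R < 1 /\ 1 - d < R).
{ unfold R. pose proof (Rmax_l R0 (1 - d)). pose proof (Rmax_r R0 (1 - d)).
  assert (Rmax R0 (1 - d) < 1) by (apply Rmax_lub_lt; lra). lra. }
destruct (p_integral_U_le p phi f r R Hp Hf Hr ltac:(lra)) as [HcR HI].
{ intros z Hz. specialize (HR0' z Hz). lra. }
set (c := Cmod (aut_eval phi (RtoC (r ^ 2) * aut_pt phi)%C)) in *.
assert (Hc0 : 0 <= c) by apply Cmod_ge_0.
eapply Rle_trans; [apply (p_integral_mono p _ s r); trivial; lra|].
eapply Rle_trans; [exact HI|].
(* As c <= d, R > 1 - d and d < 1/4, the quotient is at most 1 + 8 d. *)
apply Rle_trans with ((1 + 8 * d) * M); [|lra].
apply Rmult_le_compat; [apply Rdiv_le_0_compat; lra|apply (p_integral_ge0 p f R 1); trivial;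
  lra| |apply HM; lra].
apply Rmult_le_reg_r with (R - c); [lra|]. unfold Rdiv.
rewrite Rmult_assoc, Rinv_l, Rmult_1_r by lra. nra.
Qed.

Lemma p_integral_ext p f g r : (forall z, Cmod z < 1 -> Cmod (f z) = Cmod (g z)) -> 0 <= r < 1 ->
  p_integral p f r = p_integral p g r.
Proof.
intros H Hr. apply RInt_extR; [auto|]. intros t _. rewrite H; trivial. rewrite Cmod_circ_pos; lra.
Qed.

Lemma Cmod_U_comp_inv p phi f z : 0 < p -> Cmod z < 1 ->
  Cmod (U_op p (aut_inv phi) (U_op p phi f) z) = Cmod (f z).
Proof.
intros Hp Hz.
rewrite <- (rpow_inv' (Cmod (f z)) p), <- (rpow_inv' (Cmod (U_op _ _ _ _)) p) by (trivial;
  apply Cmod_ge_0).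
f_equal. rewrite rpow_U, rpow_U by (trivial; now apply Cmod_aut_lt).
rewrite <- Rmult_assoc, weight_mod_inv, aut_invK by lra. ring.
Qed.

(** U of the inverse automorphism brings U f back to f up to a unimodular factor. *)
Theorem U_bound_rev p phi f M : 1 <= p -> hol 1 f -> bounded_means p (U_op p phi f) M ->
  bounded_means p f M.
Proof.
intros Hp Hf HM r Hr.
rewrite (p_integral_ext p f (U_op p (aut_inv phi) (U_op p phi f))); trivial.
- apply U_bound; trivial. apply hol_U; trivial; lra.
- intros z Hz. symmetry. apply Cmod_U_comp_inv; trivial; lra.
Qed.

Lemma U_surj p phi g : 1 <= p -> hol 1 g -> exists h, hol 1 h /\ (forall z, Cmod z < 1 ->
  U_op p phi h z = g z).
Proof.
intros Hp Hg.
exists (fun z => (g (aut_eval (aut_inv phi) z) / croot p (aut_weight phi (aut_eval (aut_inv phi)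
  z)))%C).
split.
- intros z Hz. pose proof (Cmod_aut_lt (aut_inv phi) z Hz) as H1.
  apply (hol_comp_aut (aut_inv phi) (fun z => g z / croot p (aut_weight phi z))%C); trivial.
  intros w Hw. apply (cdiff_div g (fun z => croot p (aut_weight phi z)));
    [now apply Hg|apply cdiff_root_weight; trivial; lra|].
  apply root_weight_neq0; trivial; lra.
- intros z Hz. unfold U_op, mul_op, comp_op. rewrite aut_invK' by lra. field.
  apply root_weight_neq0; trivial; lra.
Qed.

(** * Multiplication by an automorphism *)

Lemma hol_mul_aut psi f : hol 1 f -> hol 1 (mul_op (aut_eval psi) f).
Proof. intros Hf z Hz. apply (cdiff_mult (aut_eval psi) f); [apply cdiff_aut; lra|now apply Hf].
Qed.

Theorem mul_bound p psi f M : 1 <= p -> hol 1 f -> bounded_means p f M ->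
  bounded_means p (mul_op (aut_eval psi) f) M.
Proof.
intros Hp Hf HM r Hr. eapply Rle_trans; [|apply (HM r Hr)].
apply RInt_le; [auto| | |].
- apply ex_RInt_all, (continuous_rpow_curve p (fun t => mul_op (aut_eval psi) f (circ r t)));
  [lra|].
  apply (hol_ccurve _ 1); [now apply hol_mul_aut|lra].
- apply ex_RInt_all, (continuous_rpow_curve p (fun t => f (circ r t))); [lra|].
  now apply (hol_ccurve _ 1).
- intros t _. apply rpow_le; [lra|apply Cmod_ge_0|]. unfold mul_op. rewrite Cmod_mult.
  pose proof (Cmod_aut_lt psi (circ r t) ltac:(rewrite Cmod_circ_pos; lra)).
  pose proof (Cmod_ge_0 (f (circ r t))). nra.
Qed.

(** 1 - |psi|^2 = (1 - |a|^2) (1 - |z|^2) / |1 - conj a z|^2. *)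
Lemma aut_lower psi z : Cmod z <= 1 -> 1 - 2 * (1 - Cmod z) / (1 - Cmod (aut_pt psi))
  ^ 2 <= Cmod (aut_eval psi z).
Proof.
intros Hz. pose proof (Cmod_aut_sqr psi z Hz) as E. pose proof (pt_sq_lt psi) as Ha.
pose proof (aut_ptP psi) as Ha1. unfold unit_disc in Ha1. pose proof (Cmod_ge_0 z).
pose proof (aut_den_bound (aut_pt psi) z Hz) as Hd. pose proof (Cmod_ge_0 (aut_pt psi)).
assert (H1 : 1 - Cmod (aut_eval psi z) ^ 2 <= 2 * (1 - Cmod z) / (1 - Cmod (aut_pt psi)) ^ 2).
{ rewrite E. apply Rmult_le_compat; [apply Rmult_le_pos; nra|left; apply Rinv_0_lt_compat, pow_lt;
  lra| |].
  - apply Rle_trans with (1 * (1 - Cmod z ^ 2)); [apply Rmult_le_compat_r; nra|nra].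
  - apply Rinv_le_contravar; [apply pow_lt; lra|]. apply pow_incr; lra. }
pose proof (Cmod_ge_0 (aut_eval psi z)).
destruct (Rle_dec (Cmod (aut_eval psi z)) 1) as [h|h]; [nra|].
assert (0 <= 2 * (1 - Cmod z) / (1 - Cmod (aut_pt psi)) ^ 2); [|lra].
apply Rdiv_le_0_compat; [lra|apply pow_lt; lra].
Qed.

(** The integral of |f|^p over |z| = s is at most that over a larger circle |z| = r, where |psi|
    is close to 1. *)
Theorem mul_bound_rev p psi f M : 1 <= p -> hol 1 f ->
  bounded_means p (mul_op (aut_eval psi) f) M -> bounded_means p f M.
Proof.
intros Hp Hf HM s Hs.
pose proof (aut_ptP psi) as Ha. unfold unit_disc in Ha. pose proof (Cmod_ge_0 (aut_pt psi)).
set (k := (1 - Cmod (aut_pt psi)) ^ 2). assert (Hk : 0 < k) by (apply pow_lt; lra).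
assert (Hk1 : k <= 1) by (unfold k; nra).
assert (HM0 : 0 <= M).
{ eapply Rle_trans; [|apply (HM 0); lra]. apply (p_integral_ge0 p _ 0 1);
  [lra|now apply hol_mul_aut|lra]. }
apply le_of_approx with (2 * M); [lra|]. intros d Hd.
(* By aut_lower, |psi| >= 1 - d / p on |z| = r, and (1 - d / p)^p >= 1 - d by Bernoulli. *)
set (r := Rmax s (1 - d * k / (2 * p))).
assert (Hdk : 0 < d * k / (2 * p) < 1).
{ split; [apply Rdiv_lt_0_compat; nra|]. apply Rmult_lt_reg_r with (2 * p); [lra|]. unfold Rdiv.
  rewrite Rmult_assoc, Rinv_l; nra. }
assert (Hr : 0 < r < 1) by (split; [eapply Rlt_le_trans; [|apply Rmax_r]; lra|apply Rmax_lub_lt;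
  lra]).
assert (Hsr : s <= r) by apply Rmax_l.
assert (Hlow : forall z, Cmod z = r -> 1 - d / p <= Cmod (aut_eval psi z)).
{ intros z Hz. eapply Rle_trans; [|apply aut_lower; lra]. rewrite Hz. fold k.
  pose proof (Rmax_r s (1 - d * k / (2 * p))) as H1. fold r in H1.
  assert (2 * (1 - r) / k <= d / p); [|lra].
  apply Rmult_le_reg_r with k; [lra|]. unfold Rdiv at 1. rewrite Rmult_assoc, Rinv_l by lra.
  replace (d / p * k) with (2 * (d * k / (2 * p))) by (field; lra). lra. }
eapply Rle_trans; [apply (p_integral_mono p f s r); trivial; lra|].
assert (Hdp : 0 < d / p <= d).
{ split; [apply Rdiv_lt_0_compat; lra|]. apply Rmult_le_reg_r with p; [lra|]. unfold Rdiv.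
  rewrite Rmult_assoc, Rinv_l; nra. }
assert (HB : 1 - d <= rpow (1 - d / p) p).
{ rewrite rpow_pos by lra. replace (1 - d) with (1 + p * (1 - d / p - 1)) by (field; lra).
  apply bernoulli; lra. }
assert (Hex : ex_RInt (fun t => rpow (Cmod (f (circ r t))) p) 0 (2 * PI)).
{ apply ex_RInt_all, (continuous_rpow_curve p (fun t => f (circ r t))); [lra|].
  apply (hol_ccurve _ 1); [assumption|lra]. }
assert (HI : (1 - d) * p_integral p f r <= M).
{ eapply Rle_trans; [|apply (HM r); lra].
  assert (E : RInt (fun t => (1 - d) * rpow (Cmod (f (circ r t))) p) 0 (2 * PI) = (1 - d)
    * p_integral p f r)
    by now apply RInt_scalR.
  rewrite <- E. apply RInt_le; [auto|now apply ex_RInt_scalR| |].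
  - apply ex_RInt_all, (continuous_rpow_curve p (fun t => mul_op (aut_eval psi) f (circ r t)));
    [lra|].
    apply (hol_ccurve _ 1); [now apply hol_mul_aut|lra].
  - intros t _. unfold mul_op. rewrite Cmod_mult, rpow_mult by apply Cmod_ge_0.
    apply Rmult_le_compat_r; [apply rpow_ge0|]. eapply Rle_trans; [exact HB|].
    apply rpow_le; [lra|lra|]. apply Hlow. apply Cmod_circ_pos; lra. }
apply Rmult_le_reg_l with (1 - d); [lra|]. assert (0 <= M * d) by nra. nra.
Qed.

(** * The Hardy space through integral means *)

Lemma bounded_ge0 p f M : 0 < p -> hol 1 f -> bounded_means p f M -> 0 <= M.
Proof. intros Hp Hf HM. eapply Rle_trans; [apply (p_integral_ge0 p f 0 1); trivial; lra|apply HM;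
  lra]. Qed.

Lemma Mp_le_iff p f r X : 1 <= p -> hol 1 f -> 0 <= r < 1 -> 0 <= X ->
  Mp p f r <= X <-> p_integral p f r <= 2 * PI * rpow X p.
Proof.
intros Hp Hf Hr HX. pose proof PI_RGT_0 as HPI.
pose proof (p_integral_ge0 p f r 1 ltac:(lra) Hf Hr) as H0.
assert (Hp' : 0 < / p) by (apply Rinv_0_lt_compat; lra).
change (Mp p f r) with (rpow (/ (2 * PI) * p_integral p f r) (/ p)).
assert (H1 : 0 <= / (2 * PI) * p_integral p f r) by (apply Rmult_le_pos; [left;
  apply Rinv_0_lt_compat; lra|assumption]).
split; intros H.
- apply (rpow_le _ _ p) in H; [|lra|apply rpow_ge0]. rewrite rpow_inv in H by lra.
  apply Rmult_le_reg_l with (/ (2 * PI)); [apply Rinv_0_lt_compat; lra|].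
  rewrite <- (Rmult_assoc (/ (2 * PI))), Rinv_l, Rmult_1_l by lra. exact H.
- rewrite <- (rpow_inv' X p) by lra. apply rpow_le; trivial.
  apply Rmult_le_reg_l with (2 * PI); [lra|]. rewrite <- Rmult_assoc, Rinv_r, Rmult_1_l by lra.
  exact H.
Qed.

Lemma Hp_iff p f : 1 <= p -> Hp p f <-> hol 1 f /\ exists M, bounded_means p f M.
Proof.
intros Hp1. unfold Hp. rewrite holomorphic_hol. pose proof PI_RGT_0. split; intros [Hf [M HM]];
  (split; [exact Hf|]).
- exists (2 * PI * rpow (Rmax M 0) p). intros r Hr. apply Mp_le_iff; trivial; [apply Rmax_r|].
  eapply Rle_trans; [apply HM; lra|apply Rmax_l].
- pose proof (bounded_ge0 p f M ltac:(lra) Hf HM).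
  exists (rpow (M / (2 * PI)) (/ p)). intros r Hr. apply Mp_le_iff; trivial; [apply rpow_ge0|].
  rewrite rpow_inv by (lra || (apply Rdiv_le_0_compat; lra)).
  replace (2 * PI * (M / (2 * PI))) with M by (field; lra). now apply HM.
Qed.

(** The norms are suprema of sets of numbers with the same upper bounds. *)
Lemma Hp_norm_eq p f g : 1 <= p -> hol 1 f -> hol 1 g ->
  (forall M, bounded_means p f M <-> bounded_means p g M) -> Hp_norm p f = Hp_norm p g.
Proof.
intros Hp1 Hf Hg Hfg. unfold Hp_norm. f_equal.
assert (Hub : forall f g, hol 1 f -> hol 1 g -> (forall M, bounded_means p f M <->
  bounded_means p g M) ->
  forall l, is_ub_Rbar (fun x => exists r, 0 <= r < 1 /\ x = Mp p f r) l ->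
            is_ub_Rbar (fun x => exists r, 0 <= r < 1 /\ x = Mp p g r) l).
{ clear f g Hf Hg Hfg. intros f g Hf Hg Hfg l Hl.
  assert (Hl0 : Rbar_le (Mp p f 0) l) by (apply Hl; exists 0; split; [lra|reflexivity]).
  destruct l as [X| |]; [|intros x _; exact I|contradiction]. simpl in Hl0.
  assert (HX : 0 <= X) by (eapply Rle_trans; [apply rpow_ge0|exact Hl0]).
  intros x [r [Hr ->]]. simpl. apply Mp_le_iff; trivial. revert r Hr. apply Hfg. intros r Hr.
  apply Mp_le_iff; trivial.
  assert (Hx : Rbar_le (Mp p f r) X) by (apply Hl; exists r; split; [lra|reflexivity]). exact Hx. }
apply is_lub_Rbar_unique. destruct (Lub_Rbar_correct (fun x => exists r, 0 <= r < 1 /\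
  x = Mp p g r)) as [H1 H2].
split.
- apply (Hub g f); trivial. intros M; symmetry; apply Hfg.
- intros l Hl. apply H2. now apply (Hub f g).
Qed.

Lemma bounded_ext p f g M : (forall z, Cmod z < 1 -> f z = g z) -> bounded_means p f M ->
  bounded_means p g M.
Proof. intros H HM r Hr. rewrite (p_integral_ext p g f); auto. intros z Hz. now rewrite H. Qed.

Lemma bounded_fun p f K : 1 <= p -> hol 1 f -> (forall z, Cmod z < 1 -> Cmod (f z) <= K) ->
  bounded_means p f (2 * PI * rpow K p).
Proof.
intros Hp1 Hf HK r Hr. unfold p_integral.
assert (E : RInt (fun _ => rpow K p) 0 (2 * PI) = 2 * PI * rpow K p).
{ rewrite RInt_constR. asR; ring. }
rewrite <- E. apply RInt_le; [auto| |apply ex_RInt_const|].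
- apply ex_RInt_all, (continuous_rpow_curve p (fun t => f (circ r t))); [lra|].
  now apply (hol_ccurve _ 1).
- intros t _. apply rpow_le; [lra|apply Cmod_ge_0|]. apply HK. rewrite Cmod_circ_pos; lra.
Qed.

Lemma Hp_bounded p f K : 1 <= p -> hol 1 f -> (forall z, Cmod z < 1 -> Cmod (f z) <= K) -> Hp p f.
Proof. intros Hp1 Hf HK. apply Hp_iff; trivial. split; trivial. eexists;
  now apply (bounded_fun p f K). Qed.

(** * The operator f |-> psi * U_phi f *)

(** Subtracting Cauchy's formulas at z and a writes (f z - f a) / (z - a) as a Cauchy transform,
    which is differentiable at a as well. *)
Lemma divide_zero f a : hol 1 f -> Cmod a < 1 -> exists q, hol 1 q /\ forall z, Cmod z < 1 ->
  f z = (f a + (z - a) * q z)%C.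
Proof.
intros Hf Ha. set (R := (1 + Cmod a) / 2).
assert (HR : Cmod a < R < 1) by (unfold R; lra).
assert (Cf : ccurve (fun t => f (circ R t))) by (apply (hol_ccurve f 1); trivial;
  pose proof (Cmod_ge_0 a); lra).
set (g := fun t => (/ RtoC (2 * PI) * (f (circ R t) * circ R t) / (circ R t - a))%C).
assert (Cg : ccurve g).
{ apply (ccurve_cauchy (fun t => / RtoC (2 * PI) * (f (circ R t) * circ R t))%C); [lra|].
  intros t. apply continuous_Cmult; [apply continuous_const|]. apply continuous_Cmult;
    [apply Cf|apply ccurve_circ]. }
set (T := cauchy_transform g R).
assert (H2pi : RtoC (2 * PI) <> 0) by (intros E; apply RtoC_inj in E; pose proof PI_RGT_0; lra).
assert (HT : forall w, Cmod w < R -> (f w = f a + (w - a) * T w)%C).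
{ intros w Hw.
  assert (Cw : forall v, Cmod v < R -> ccurve (fun t => f (circ R t)
    * (circ R t / (circ R t - v)))%C).
  { intros v Hv t. apply continuous_Cmult; [apply Cf|]. now apply (ccurve_cauchy (circ R));
    [|apply ccurve_circ]. }
  pose proof (cauchy_formula f 1 R w Hf Hw ltac:(lra)) as E1.
  pose proof (cauchy_formula f 1 R a Hf ltac:(lra) ltac:(lra)) as E2.
  unfold circle_int in E1, E2.
  assert (E3 : ((w - a) * T w = / RtoC (2 * PI) * (RtoC (2 * PI) * f w - RtoC (2 * PI) * f a))%C).
  { rewrite <- E1, <- E2, <- CInt_minus by (auto; apply ccurve_on, Cw; lra).
    unfold T, cauchy_transform. rewrite <- !CInt_scal; auto.
    - apply CInt_ext; [auto|]. intros t _. unfold g. field. repeat split; trivial; apply circ_neq;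
      lra.
    - apply ccurve_on. intros t. apply continuous_Cminus; apply Cw; lra.
    - now apply ccurve_on, ccurve_cauchy. }
  rewrite E3. field. assumption. }
exists (fun z => if Ceq_dec z a then T z else (f z - f a) / (z - a))%C.
split.
- intros z Hz. destruct (Ceq_dec z a) as [->|Hza].
  + apply cdiff_ext_loc with T (R - Cmod a); [lra| |apply cdiff_cauchy_transform; trivial; lra].
    intros w Hw. destruct (Ceq_dec w a) as [->|Hwa]; [reflexivity|].
    rewrite (HT w); [field; now apply Cminus_neq_0|]. pose proof (Cmod_triangle_sub w a). lra.
  + apply cdiff_ext_loc with (fun z => (f z - f a) / (z - a))%C (Cmod (z - a)); [apply Cmod_gt_0;
    now apply Cminus_neq_0| |].
    * intros w Hw. destruct (Ceq_dec w a) as [->|Hwa]; [|reflexivity]. rewrite Cmod_sub_rev in Hw.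
      lra.
    * apply (cdiff_div (fun z => f z - f a)%C (fun z => z - a)%C);
      [|apply cdiff_id_minus|now apply Cminus_neq_0].
      apply (cdiff_minus f (fun _ => f a)); [now apply Hf|apply cdiff_const].
- intros z Hz. destruct (Ceq_dec z a) as [->|Hza]; [ring|]. field. now apply Cminus_neq_0.
Qed.

Lemma iter_swap {A} (f : A -> A) n x : Nat.iter n f (f x) = f (Nat.iter n f x).
Proof. induction n; simpl; congruence. Qed.

Section Operator.
Context (p : R) (phi psi : disc_aut).
Context (Hp1 : 1 <= p).

Definition MU_op (f : C -> C) : C -> C := mul_op (aut_eval psi) (U_op p phi f).

Lemma p_pos : 0 < p. Proof. lra. Qed.
#[local] Hint Extern 1 (0 < p) => exact p_pos : core.

Lemma hol_MU f : hol 1 f -> hol 1 (MU_op f).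
Proof. intros. apply hol_mul_aut, hol_U; auto. Qed.

Lemma MU_bounded_iff f M : hol 1 f -> bounded_means p (MU_op f) M <-> bounded_means p f M.
Proof.
intros Hf. split; intros H.
- apply (U_bound_rev p phi); trivial. apply (mul_bound_rev p psi); trivial. apply hol_U; auto.
- apply mul_bound; trivial; [apply hol_U; auto|]. now apply U_bound.
Qed.

Lemma U_bounded_iff f M : hol 1 f -> bounded_means p (U_op p phi f) M <-> bounded_means p f M.
Proof. intros Hf. split; intros H; [now apply (U_bound_rev p phi)|now apply U_bound]. Qed.

Lemma U_ext f g z : (forall w, Cmod w < 1 -> f w = g w) -> Cmod z < 1 ->
  U_op p phi f z = U_op p phi g z.
Proof. intros H Hz. unfold U_op, mul_op, comp_op. rewrite H; trivial. now apply Cmod_aut_lt. Qed.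

Lemma MU_isometry : isometry p MU_op.
Proof.
constructor.
- intros f Hf. apply Hp_iff in Hf as [Hf [M HM]]; trivial. apply Hp_iff; trivial. split;
  [now apply hol_MU|]. exists M. now apply MU_bounded_iff.
- intros f g _ _ H z Hz. unfold MU_op, mul_op. f_equal. now apply U_ext.
- intros c d f g _ _ z _. unfold MU_op, U_op, mul_op, comp_op. ring.
- intros f Hf. apply Hp_iff in Hf as [Hf _]; trivial. apply Hp_norm_eq; trivial;
  [now apply hol_MU|]. intros M. now apply MU_bounded_iff.
Qed.

(** The constant 1 spans a complement: S g vanishes at the zero of psi, and f - f(a) is in the
    range by [divide_zero] and [U_surj]. *)
Lemma MU_codim_one : range_codim_one p MU_op.
Proof.
pose proof (aut_ptP psi) as Ha. unfold unit_disc in Ha.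
assert (Hlam : aut_lam psi <> 0) by (apply Cmod_gt_0; rewrite (aut_lamP psi); lra).
assert (Hpsi0 : aut_eval psi (aut_pt psi) = 0) by (unfold aut_eval; unfold Cdiv; ring).
exists (fun _ => 1). split; [|split].
- apply (Hp_bounded p _ 1); trivial; [intros z _; apply cdiff_const|]. intros z _. rewrite Cmod_1;
  lra.
- intros [g [_ H]]. specialize (H _ (aut_ptP psi)). unfold MU_op, mul_op in H. rewrite Hpsi0 in H.
  rewrite Cmult_0_l in H. apply RtoC_inj in H. lra.
- intros f Hf. apply Hp_iff in Hf as [Hf [M HM]]; trivial.
  destruct (divide_zero f (aut_pt psi) Hf Ha) as [q [Hq Eq]].
  (* psi z = lam (z - a) / (1 - conj a z), so q (z - a) = psi g1 for this g1. *)
  set (g1 := fun z => (q z * ((1 - Cconj (aut_pt psi) * z) / aut_lam psi))%C).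
  assert (Hg1 : hol 1 g1).
  { intros z Hz. apply (cdiff_mult q (fun z => (1 - Cconj (aut_pt psi) * z) / aut_lam psi)%C);
    [now apply Hq|].
    apply (cdiff_div (fun z => 1 - Cconj (aut_pt psi) * z)%C (fun _ => aut_lam psi));
      [|apply cdiff_const|trivial].
    apply (cdiff_minus (fun _ => 1) (fun z => Cconj (aut_pt psi) * z)%C); [apply cdiff_const|].
    apply (cdiff_mult (fun _ => Cconj (aut_pt psi)) (fun z => z));
      [apply cdiff_const|apply cdiff_id]. }
  destruct (U_surj p phi g1 Hp1 Hg1) as [g [Hg Eg]].
  exists (f (aut_pt psi)), g.
  assert (Ef : forall z, Cmod z < 1 -> f z = (MU_op g z + f (aut_pt psi) * 1)%C).
  { intros z Hz. unfold MU_op, mul_op. rewrite Eg by assumption. rewrite (Eq z Hz) at 1.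
    unfold g1, aut_eval.
    field. split; [trivial|]. apply aut_den_neq0; lra. }
  split; [|exact Ef].
  apply Hp_iff; trivial. split; trivial.
  (* |f - c|^p <= (2 max(|f|, |c|))^p <= 2^p (|f|^p + |c|^p) *)
  exists (rpow 2 p * (M + 2 * PI * rpow (Cmod (f (aut_pt psi))) p)).
  refine (proj1 (MU_bounded_iff g _ Hg) _). intros r Hr.
  set (c := f (aut_pt psi)) in *.
  assert (Cf : ccurve (fun t => f (circ r t))) by now apply (hol_ccurve f 1).
  assert (Cfp := continuous_rpow_curve p _ p_pos Cf).
  assert (Ex : ex_RInt (fun t => rpow 2 p * rpow (Cmod (f (circ r t))) p + rpow 2 p * rpow (Cmod c)
    p) 0 (2 * PI)).
  { apply (ex_RInt_lincomb 0 (2 * PI) (rpow 2 p) (rpow 2 p) _ (fun _ => rpow (Cmod c) p));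
    [now apply ex_RInt_all|apply ex_RInt_const]. }
  apply Rle_trans with (RInt (fun t => rpow 2 p * rpow (Cmod (f (circ r t)))
    p + rpow 2 p * rpow (Cmod c) p) 0 (2 * PI)).
  + apply RInt_le; [auto| |exact Ex|].
    * apply ex_RInt_all, (continuous_rpow_curve p (fun t => MU_op g (circ r t))); [exact p_pos|].
      apply (hol_ccurve _ 1); [now apply hol_MU|lra].
    * intros t _. assert (Hc : Cmod (circ r t) < 1) by (rewrite Cmod_circ_pos; lra).
      replace (MU_op g (circ r t)) with (f (circ r t) - c)%C by (rewrite (Ef _ Hc); ring).
      set (x := Cmod (f (circ r t))). pose proof (Cmod_ge_0 (f (circ r t))) as Hx. fold x in Hx.
      pose proof (Cmod_ge_0 c). pose proof (rpow_ge0 x p). pose proof (rpow_ge0 (Cmod c) p).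
      pose proof (rpow_ge0 2 p).
      apply Rle_trans with (rpow (2 * Rmax x (Cmod c)) p).
      { apply rpow_le; [lra|apply Cmod_ge_0|]. eapply Rle_trans; [apply Cmod_minus_le|]. fold x.
        pose proof (Rmax_l x (Cmod c)). pose proof (Rmax_r x (Cmod c)). lra. }
      rewrite rpow_mult by (lra || (eapply Rle_trans; [exact Hx|apply Rmax_l])).
      assert (rpow (Rmax x (Cmod c)) p <= rpow x p + rpow (Cmod c) p) by (apply Rmax_case; lra).
      nra.
  + rewrite (RInt_lincomb 0 (2 * PI) (rpow 2 p) (rpow 2 p) (fun t => rpow (Cmod (f (circ r t))) p)
    (fun _ => rpow (Cmod c) p));
      [|now apply ex_RInt_all|apply ex_RInt_const].
    rewrite RInt_constR.
    specialize (HM r Hr). unfold p_integral in HM. pose proof (rpow_ge0 2 p). rewrite Rminus_0_r.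
    nra.
Qed.

Fixpoint orbit_prod (n : nat) (z : C) : C :=
  match n with O => 1 | S n => (aut_eval psi z * orbit_prod n (aut_eval phi z))%C end.

Lemma orbit_prod_S n z : orbit_prod (S n)
  z = (orbit_prod n z * aut_eval psi (Nat.iter n (aut_eval phi) z))%C.
Proof.
revert z. induction n as [|n IH]; intros z; [simpl; ring|].
change (orbit_prod (S (S n)) z) with (aut_eval psi z * orbit_prod (S n) (aut_eval phi z))%C.
rewrite IH, iter_swap. simpl. ring.
Qed.

(** U_phi (h f) = (h o phi) U_phi f. *)
Lemma iter_MU n g z : Nat.iter n MU_op g z = (orbit_prod n z * Nat.iter n (U_op p phi) g z)%C.
Proof.
revert z. induction n as [|n IH]; intros z; [simpl; ring|].
simpl. unfold MU_op at 1. unfold U_op at 1 2. unfold mul_op, comp_op. rewrite IH. ring.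
Qed.

Lemma hol_iter_MU n g : hol 1 g -> hol 1 (Nat.iter n MU_op g).
Proof. intros. induction n; simpl; trivial. now apply hol_MU. Qed.

Lemma hol_iter_U n g : hol 1 g -> hol 1 (Nat.iter n (U_op p phi) g).
Proof. intros. induction n; simpl; trivial. apply hol_U; auto. Qed.

Lemma iter_MU_bounded_iff n g M : hol 1 g -> bounded_means p (Nat.iter n MU_op g) M <->
  bounded_means p g M.
Proof. intros Hg. induction n; simpl; [reflexivity|]. rewrite MU_bounded_iff; trivial.
now apply hol_iter_MU. Qed.

Lemma iter_U_bounded_iff n g M : hol 1 g -> bounded_means p (Nat.iter n (U_op p phi) g) M <->
  bounded_means p g M.
Proof. intros Hg. induction n; simpl; [reflexivity|]. rewrite U_bounded_iff; trivial.
now apply hol_iter_U. Qed.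

Lemma iter_U_surj n g : hol 1 g -> exists h, hol 1 h /\ forall z, Cmod z < 1 ->
  Nat.iter n (U_op p phi) h z = g z.
Proof.
revert g. induction n as [|n IH]; intros g Hg; [now exists g|].
destruct (U_surj p phi g Hp1 Hg) as [g1 [Hg1 E1]]. destruct (IH g1 Hg1) as [h [Hh E]].
exists h. split; trivial. intros z Hz. simpl. rewrite <- E1 by assumption. now apply U_ext.
Qed.
End Operator.

(** * Composition and normalised Blaschke factors *)

Section Comp.
Context (psi phi : disc_aut).
Let l := aut_lam phi. Let a := aut_pt phi. Let m := aut_lam psi. Let b := aut_pt psi.

Definition comp_den : C := (1 - Cconj (- (l * a)) * b)%C.

Lemma comp_den_neq0 : comp_den <> 0.
Proof. apply (aut_den_neq0 (aut_inv phi)). left. apply (aut_ptP psi). Qed.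

Lemma aut_comp_lamP : Cmod (m * l * comp_den / Cconj comp_den) = 1.
Proof.
pose proof (Cconj_neq0 _ comp_den_neq0). pose proof (proj1 (Cmod_gt_0 _) comp_den_neq0).
rewrite Cmod_div, !Cmod_mult, Cmod_conj by assumption. unfold m, l. rewrite 2!aut_lamP. field. lra.
Qed.

(** The zero of psi o phi is the inverse image under phi of the zero of psi. *)
Definition aut_comp : disc_aut := DiscAut _ _ aut_comp_lamP (Cmod_aut_lt (aut_inv phi)
  b (aut_ptP psi)).

Lemma aut_compE z : Cmod z < 1 -> aut_eval aut_comp z = aut_eval psi (aut_eval phi z).
Proof.
intros Hz.
pose proof (aut_den_neq0 aut_comp z ltac:(lra)) as H1.
pose proof (aut_den_neq0 phi z ltac:(lra)) as H2.
pose proof (aut_den_neq0 psi (aut_eval phi z) ltac:(left; now apply Cmod_aut_lt)) as H3.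
pose proof comp_den_neq0 as H4. pose proof (Cconj_neq0 _ H4) as H5.
pose proof (unimod_conj _ (aut_lamP phi)) as Hl.
assert (Hl' : (aut_lam phi)%C <> 0) by (apply Cmod_gt_0; rewrite (aut_lamP phi); lra).
set (d := comp_den) in *.
assert (Ed : d = (1 + Cconj l * Cconj a * b)%C) by (unfold d, comp_den;
  rewrite Cconj_opp, Cmult_conj; ring).
assert (Edc : Cconj d = (1 + l * a * Cconj b)%C).
{ now rewrite Ed, Cconj_plus, !Cmult_conj, !Cconj_invol, Cconj_RtoC. }
assert (Ec : aut_pt aut_comp = (Cconj l * (b + l * a) / d)%C).
{ simpl. unfold aut_eval, d, comp_den; simpl. fold l a b. f_equal. ring. }
assert (Ecc : Cconj (aut_pt aut_comp) = (l * (Cconj b + Cconj l * Cconj a) / Cconj d)%C).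
{ rewrite Ec. unfold Cdiv. rewrite !Cmult_conj, Cconj_invol, Cconj_plus, Cmult_conj.
  now rewrite Cconj_inv. }
assert (E : forall n1 d1 n2 d2 : C, d1 <> 0 -> d2 <> 0 -> (n1 * d2 = n2 * d1)%C ->
  (n1 / d1 = n2 / d2)%C).
{ intros n1 d1 n2 d2 Hd1 Hd2 E. replace n1 with (n2 * d1 / d2)%C by (rewrite <- E; field;
  assumption). field. now split. }
unfold aut_eval at 1 2. apply E; trivial.
rewrite Ecc, Ec. change (aut_lam aut_comp) with (m * l * d / Cconj d)%C. unfold aut_eval.
fold l a b m in H2 |- *.
field_simplify_eq; [|repeat split; assumption].
rewrite Edc, Ed. fold l in Hl. ring [Hl].
Qed.
End Comp.

Fixpoint aut_orbit (psi phi : disc_aut) (n : nat) : disc_aut :=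
  match n with O => psi | S n => aut_comp (aut_orbit psi phi n) phi end.

Lemma aut_orbitE psi phi n z : Cmod z < 1 ->
  aut_eval (aut_orbit psi phi n) z = aut_eval psi (Nat.iter n (aut_eval phi) z).
Proof.
revert z. induction n as [|n IH]; intros z Hz; [reflexivity|].
simpl aut_orbit. rewrite aut_compE by assumption. rewrite IH by now apply Cmod_aut_lt.
now rewrite iter_swap.
Qed.

Lemma aut_zero chi z : Cmod z < 1 -> aut_eval chi z = 0 -> aut_pt chi = z.
Proof.
intros Hz E. unfold aut_eval in E. symmetry. apply Cminus_eq_0.
assert (Hlam : aut_lam chi <> 0) by (apply Cmod_gt_0; rewrite (aut_lamP chi); lra).
pose proof (aut_den_neq0 chi z ltac:(lra)) as Hd.
replace (z - aut_pt chi)%C with (aut_lam chi * (z - aut_pt chi) / (1 - Cconj (aut_pt chi) * z)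
  * ((1 - Cconj (aut_pt chi) * z) / aut_lam chi))%C by (field; split; assumption).
rewrite E. ring.
Qed.

(** The unimodular constant that makes the automorphism positive at 0 if it does not vanish
    there. *)
Definition blaschke_unit (chi : disc_aut) : C :=
  if Ceq_dec (aut_pt chi) 0 then 1 else (- Cconj (aut_lam chi) * Cconj (aut_pt chi)
    / RtoC (Cmod (aut_pt chi)))%C.

Lemma Cmod_blaschke_unit chi : Cmod (blaschke_unit chi) = 1.
Proof.
unfold blaschke_unit. destruct (Ceq_dec _ _) as [H|H]; [apply Cmod_1|]. apply Cmod_gt_0 in H.
rewrite Cmod_div, Cmod_mult, Cmod_opp, !Cmod_conj, Cmod_R, Rabs_pos_eq, (aut_lamP chi) by (try lra;
  intros E; apply RtoC_inj in E; lra).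
field. lra.
Qed.

(** For a <> 0 the expression inside the modulus equals
    (1 - |a|) (|a| + conj a z) / (|a| (1 - conj a z)). *)
Lemma blaschke_unit_near_1 chi z : Cmod z < 1 ->
  Cmod (1 - blaschke_unit chi * aut_eval chi z) <= 2 * (1 - Cmod (aut_pt chi)) / (1 - Cmod z).
Proof.
intros Hz. pose proof (aut_ptP chi) as Ha. unfold unit_disc in Ha.
pose proof (Cmod_ge_0 (aut_pt chi)) as Ha0. pose proof (Cmod_ge_0 z) as Hz0.
pose proof (aut_den_neq0 chi z ltac:(lra)) as Hd.
unfold blaschke_unit. destruct (Ceq_dec _ _) as [H|H].
- eapply Rle_trans; [apply Cmod_minus_le|]. rewrite Cmod_1, Cmod_mult, Cmod_1, H, Cmod_0.
  pose proof (Cmod_aut_lt chi z Hz). apply Rle_trans with 2; [lra|].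
  apply Rmult_le_reg_r with (1 - Cmod z); [lra|]. unfold Rdiv. rewrite Rmult_assoc, Rinv_l; lra.
- assert (Hm : 0 < Cmod (aut_pt chi)) by now apply Cmod_gt_0.
  assert (Hmc : RtoC (Cmod (aut_pt chi)) <> 0) by (intros E; apply RtoC_inj in E; lra).
  pose proof (unimod_conj _ (aut_lamP chi)) as Hl.
  pose proof (Cmod2_conj (aut_pt chi)) as H2. rewrite RtoC_pow in H2.
  unfold aut_eval. set (a := aut_pt chi) in *. set (l := aut_lam chi) in *.
  replace (1 - - Cconj l * Cconj a / RtoC (Cmod a) * (l * (z - a) / (1 - Cconj a * z)))%C
    with (RtoC (1 - Cmod a) * (RtoC (Cmod a) + Cconj a * z) / (RtoC (Cmod a)
      * (1 - Cconj a * z)))%C.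
  2:{ rewrite RtoC_minus. field_simplify_eq; [|split; assumption].
      simpl in H2. assert (H2' : (a * Cconj a = RtoC (Cmod a) * RtoC (Cmod a))%C)
        by (rewrite <- H2; ring).
      ring [Hl H2']. }
  rewrite Cmod_div, !Cmod_mult, !Cmod_R, !Rabs_pos_eq by (lra || now apply Cmult_neq_0).
  pose proof (Cmod_triangle (RtoC (Cmod a)) (Cconj a * z)) as HT.
  rewrite Cmod_R, Rabs_pos_eq, Cmod_mult, Cmod_conj in HT by lra.
  assert (HD : 1 - Cmod z <= Cmod (1 - Cconj a * z)).
  { pose proof (Cmod_triangle_sub 1 (Cconj a * z)) as HD.
    rewrite Cmod_1, Cmod_mult, Cmod_conj in HD. nra. }
  apply Rle_trans with ((1 - Cmod a) * (2 * Cmod a) / (Cmod a * (1 - Cmod z))).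
  + apply Rmult_le_compat; [apply Rmult_le_pos; [lra|apply Cmod_ge_0]|left; apply Rinv_0_lt_compat;
    nra| |].
    * apply Rmult_le_compat_l; nra.
    * apply Rinv_le_contravar; nra.
  + right. field. lra.
Qed.

(** * Locally uniform limits *)

(** The limit is continuous and inherits Cauchy's formula, so it is a Cauchy transform. *)
Theorem weierstrass (F : nat -> C -> C) G (e : nat -> R) :
  (forall n, hol 1 (F n)) -> (forall n, 0 <= e n) -> (forall n z, Cmod z < 1 ->
    Cmod (F n z - G z) <= e n / (1 - Cmod z)) ->
  (forall eps, 0 < eps -> exists n, e n < eps) -> hol 1 G.
Proof.
intros HF He0 HFG He.
assert (HGc : forall z, Cmod z < 1 -> ccont G z).
{ intros z Hz. apply continuous_C_eps. intros eps Heps.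
  destruct (He (eps * (1 - Cmod z) / 6)) as [n Hn]; [apply Rdiv_lt_0_compat; nra|].
  destruct (proj1 (continuous_C_eps _ _) (cdiff_continuous _ _ (HF n z Hz)) (eps / 3) ltac:(lra))
    as [d [Hd Hc]].
  exists (Rmin d ((1 - Cmod z) / 2)). split; [apply Rmin_case; lra|]. intros w Hw.
  pose proof (Rmin_l d ((1 - Cmod z) / 2)). pose proof (Rmin_r d ((1 - Cmod z) / 2)).
  pose proof (Cmod_triangle_sub w z).
  assert (Hb : forall v, 1 - Cmod v >= (1 - Cmod z) / 2 -> Cmod (F n v - G v) < eps / 3).
  { intros v Hv. eapply Rle_lt_trans; [apply HFG; lra|]. apply Rmult_lt_reg_r with (1 - Cmod v);
    [lra|].
    unfold Rdiv at 1. rewrite Rmult_assoc, Rinv_l by lra. nra. }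
  replace (G w - G z)%C with (- (F n w - G w) + (F n w - F n z) + (F n z - G z))%C by ring.
  eapply Rle_lt_trans; [apply Cmod_triangle|]. eapply Rle_lt_trans;
    [apply Rplus_le_compat_r, Cmod_triangle|].
  rewrite Cmod_opp. pose proof (Hb w ltac:(lra)). pose proof (Hb z ltac:(lra)).
  pose proof (Hc w ltac:(lra)). lra. }
intros z Hz. set (R := (1 + Cmod z) / 2). pose proof (Cmod_ge_0 z). pose proof PI_RGT_0.
assert (HR : Cmod z < R < 1) by (unfold R; lra).
assert (CG : ccurve (fun t => G (circ R t))) by (apply (ccurve_comp G R 1); trivial; lra).
assert (CFn : forall n, ccurve (fun t => F n (circ R t))) by (intros n; apply (hol_ccurve _ 1);
  trivial; lra).
assert (Hker : forall w h, Cmod w < R -> ccurve h ->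
  ccurve (fun t => h t * (circ R t / (circ R t - w)))%C).
{ intros w h Hw Hh t. apply continuous_Cmult; [apply Hh|]. now apply (ccurve_cauchy (circ R));
  [|apply ccurve_circ]. }
assert (HGf : forall w, Cmod w < R -> CInt (fun t => G (circ R t)
  * (circ R t / (circ R t - w)))%C 0 (2 * PI) = (RtoC (2 * PI) * G w)%C).
{ intros w Hw. apply Cminus_eq_0, Cmod_small_eq0. intros eps Heps.
  set (K := 2 * PI / (1 - R) * (R / (R - Cmod w)) + 2 * PI / (1 - R)).
  pose proof (Cmod_ge_0 w).
  assert (HK : 0 < K).
  { unfold K. apply Rplus_le_lt_0_compat; [apply Rmult_le_pos; left; apply Rdiv_lt_0_compat;
    lra|apply Rdiv_lt_0_compat; lra]. }
  destruct (He (eps / K)) as [n Hn]; [now apply Rdiv_lt_0_compat|].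
  pose proof (cauchy_formula (F n) 1 R w (HF n) Hw ltac:(lra)) as E. unfold circle_int in E.
  set (X := CInt (fun t => (F n (circ R t) - G (circ R t))
    * (circ R t / (circ R t - w)))%C 0 (2 * PI)).
  assert (EX : X = (RtoC (2 * PI) * F n w - CInt (fun t => G (circ R t)
    * (circ R t / (circ R t - w)))%C 0 (2 * PI))%C).
  { unfold X. rewrite <- E, <- CInt_minus; auto; try (apply ccurve_on, Hker; trivial; apply CFn).
    apply CInt_ext; [auto|]. intros t _. ring. }
  replace (_ - _)%C with (- X + RtoC (2 * PI) * (F n w - G w))%C by (rewrite EX; ring).
  eapply Rle_lt_trans; [apply Cmod_triangle|].
  rewrite Cmod_opp, Cmod_mult, Cmod_R, Rabs_pos_eq by lra.
  assert (Hunif : forall v, Cmod v <= R -> Cmod (F n v - G v) <= e n / (1 - R)).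
  { intros v Hv. eapply Rle_trans; [apply HFG; lra|]. apply Rmult_le_compat_l; [apply He0|].
    apply Rinv_le_contravar; lra. }
  assert (HXb : Cmod X <= (2 * PI - 0) * (e n / (1 - R) * (R / (R - Cmod w)))).
  { apply CInt_bound; [auto| |].
    - apply ccurve_on, Hker; trivial. intros t. apply continuous_Cminus; [apply CFn|apply CG].
    - intros t _. rewrite Cmod_mult. apply Rmult_le_compat; try apply Cmod_ge_0; [apply Hunif;
      rewrite Cmod_circ_pos; lra|].
      rewrite Cmod_div by now apply circ_neq. rewrite Cmod_circ_pos by lra.
      apply Rmult_le_compat_l; [lra|].
      apply Rinv_le_contravar; [lra|now apply circ_dist]. }
  pose proof (Hunif w ltac:(lra)) as Hw2.
  apply Rle_lt_trans with (e n * K).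
  - unfold K. replace (e n * (2 * PI / (1 - R) * (R / (R - Cmod w)) + 2 * PI / (1 - R))) with
     ((2 * PI - 0) * (e n / (1 - R) * (R / (R - Cmod w))) + 2 * PI * (e n / (1 - R))) by (field;
       lra).
    apply Rplus_le_compat; [assumption|]. apply Rmult_le_compat_l; lra.
  - apply Rmult_lt_reg_r with (/ K); [now apply Rinv_0_lt_compat|].
    rewrite Rmult_assoc, Rinv_r by lra. unfold Rdiv in Hn. lra. }
set (g := fun t => (/ RtoC (2 * PI) * (G (circ R t) * circ R t))%C).
assert (Cg : ccurve g).
{ intros t. apply continuous_Cmult; [apply continuous_const|]. apply continuous_Cmult;
  [apply CG|apply ccurve_circ]. }
assert (H2pi : RtoC (2 * PI) <> 0) by (intros E; apply RtoC_inj in E; lra).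
apply cdiff_ext_loc with (cauchy_transform g R) (R - Cmod z); [lra| |apply cdiff_cauchy_transform;
  trivial; lra].
intros w Hw. assert (HwR : Cmod w < R) by (pose proof (Cmod_triangle_sub w z); lra).
replace (G w) with (/ RtoC (2 * PI) * (RtoC (2 * PI) * G w))%C by (field; assumption).
rewrite <- HGf by assumption. unfold cauchy_transform. rewrite <- CInt_scal; auto.
- apply CInt_ext; [auto|]. intros t _. unfold g. field. split; trivial. now apply circ_neq.
- apply ccurve_on, Hker; trivial.
Qed.

(** * Infinite products *)

Fixpoint partial_prod (beta : nat -> C -> C) (n : nat) (z : C) : C :=
  match n with O => 1 | S n => (partial_prod beta n z * beta n z)%C end.

Lemma partial_prod_add beta n m z : partial_prod beta (n + m)
  z = (partial_prod beta n z * partial_prod (fun k => beta (n + k)%nat) m z)%C.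
Proof.
induction m as [|m IH]; [rewrite Nat.add_0_r; simpl; ring|]. rewrite Nat.add_succ_r. simpl.
rewrite IH. ring.
Qed.

Definition tail (x : nat -> R) (n : nat) : R := Series (fun k => x (n + k)%nat).

Lemma ex_series_tail (x : nat -> R) n : ex_series x -> ex_series (fun k => x (n + k)%nat).
Proof. intros H. now apply (ex_series_incr_n (V := R_NormedModule) x n). Qed.

Lemma tail_S (x : nat -> R) n : ex_series x -> tail x n = x n + tail x (S n).
Proof.
intros H. unfold tail. rewrite Series_incr_1 by now apply ex_series_tail. rewrite Nat.add_0_r.
f_equal. apply Series_ext. intros k. f_equal. lia.
Qed.

Lemma tail_tail (x : nat -> R) n m : tail (fun k => x (n + k)%nat) m = tail x (n + m).
Proof. apply Series_ext. intros k. f_equal. lia. Qed.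

Lemma tail_ge0 (x : nat -> R) n : (forall k, 0 <= x k) -> ex_series x -> 0 <= tail x n.
Proof.
intros Hx H. rewrite <- (Rmult_0_l (tail x n)). unfold tail at 1. rewrite <- Series_scal_l.
apply Series_le; [|now apply ex_series_tail]. intros k. specialize (Hx (n + k)%nat). lra.
Qed.

Lemma tail_small (x : nat -> R) : ex_series x -> forall eps, 0 < eps -> exists n, tail x n < eps.
Proof.
intros H eps He. pose proof (Series_correct x H) as Hs.
destruct (proj1 (filterlim_locally _ _) Hs (mkposreal eps He)) as [N HN].
exists (S N). specialize (HN N (Nat.le_refl N)). change (Rabs (sum_n x N - Series x) < eps) in HN.
pose proof (Series_incr_n x (S N) ltac:(lia) H) as E. simpl pred in E.
unfold tail. rewrite sum_n_Reals in HN. apply Rabs_lt_between in HN.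
replace (Series (fun k => x (S N + k)%nat)) with (Series x - sum_f_R0 x N) by (rewrite E; ring).
lra.
Qed.

Lemma Rabs_Series_le (d x : nat -> R) c : (forall k, Rabs (d k) <= c * x k) -> ex_series x ->
  ex_series d /\ Rabs (Series d) <= c * Series x.
Proof.
intros Hd Hx. assert (Hcx : ex_series (fun k => c * x k)) by now apply (ex_series_scal (K :=
  R_AbsRing) (V := R_NormedModule)).
assert (HA : ex_series (fun k => Rabs (d k))).
{ apply (ex_series_le (K := R_AbsRing) (V := R_CompleteNormedModule) _ (fun k => c * x k)); trivial.
  intros k. change (Rabs (Rabs (d k)) <= c * x k). now rewrite Rabs_Rabsolu. }
split; [now apply ex_series_Rabs|].
eapply Rle_trans; [now apply Series_Rabs|]. rewrite <- Series_scal_l. apply Series_le; trivial.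
intros k. split; [apply Rabs_pos|apply Hd].
Qed.

(** The differences of consecutive partial products are dominated by the summable x_k / (1 - |z|),
    so the product is a telescoping series.  The factor 2 comes from summing real and imaginary
    parts separately. *)
Theorem infinite_product (beta : nat -> C -> C) (x : nat -> R) :
  (forall k, hol 1 (beta k)) -> (forall k z, Cmod z < 1 -> Cmod (beta k z) <= 1) ->
  (forall k, 0 <= x k) -> (forall k z, Cmod z < 1 -> Cmod (1 - beta k z) <= x k / (1 - Cmod z)) ->
    ex_series x ->
  exists B, hol 1 B /\ (forall z, Cmod z < 1 -> Cmod (B z) <= 1) /\
    forall n z, Cmod z < 1 -> Cmod (partial_prod beta n z - B z) <= 2 * tail x n / (1 - Cmod z).
Proof.
intros Hhol Hle1 Hx0 Hnear Hx.
assert (HP1 : forall n z, Cmod z < 1 -> Cmod (partial_prod beta n z) <= 1).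
{ induction n as [|n IH]; intros z Hz; simpl; [rewrite Cmod_1; lra|]. rewrite Cmod_mult.
  specialize (IH z Hz). specialize (Hle1 n z Hz). pose proof (Cmod_ge_0 (partial_prod beta n z)).
  pose proof (Cmod_ge_0 (beta n z)). nra. }
assert (HPh : forall n, hol 1 (partial_prod beta n)).
{ induction n as [|n IH]; intros z Hz; simpl; [apply cdiff_const|].
  apply (cdiff_mult (partial_prod beta n) (beta n)); [now apply IH|now apply Hhol]. }
set (d := fun z n => (partial_prod beta (S n) z - partial_prod beta n z)%C).
assert (Hd : forall z n, Cmod z < 1 -> Cmod (d z n) <= / (1 - Cmod z) * x n).
{ intros z n Hz. unfold d. simpl.
  replace (partial_prod beta n z * beta n z - partial_prod beta n z)%C with (- (partial_prod beta n
  z * (1 - beta n z)))%C by ring.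
  rewrite Cmod_opp, Cmod_mult. specialize (HP1 n z Hz). specialize (Hnear n z Hz).
  pose proof (Cmod_ge_0 (1 - beta n z)). pose proof (Cmod_ge_0 (partial_prod beta n z)).
  unfold Rdiv in Hnear. rewrite (Rmult_comm (/ _)). nra. }
set (B := fun z => (1 + (Series (fun k => fst (d z k)), Series (fun k => snd (d z k))))%C).
assert (HB : forall z n, Cmod z < 1 ->
  (B z - partial_prod beta n z)%C = (Series (fun k => fst (d z (n + k)%nat)),
  Series (fun k => snd (d z (n + k)%nat)))).
{ intros z n Hz.
  assert (E1 : ex_series (fun k => fst (d z k))).
  { apply (Rabs_Series_le _ x (/ (1 - Cmod z))); trivial. intros k. eapply Rle_trans;
    [apply Rabs_fst_le|now apply Hd]. }
  assert (E2 : ex_series (fun k => snd (d z k))).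
  { apply (Rabs_Series_le _ x (/ (1 - Cmod z))); trivial. intros k. eapply Rle_trans;
    [apply Rabs_snd_le|now apply Hd]. }
  induction n as [|n IH].
  - unfold B. simpl. unfold Cminus. ring.
  - replace (B z - partial_prod beta (S n) z)%C with ((B z - partial_prod beta n z)
    - d z n)%C by (unfold d; ring).
    rewrite IH. change (Series (fun k => fst (d z (n + k)%nat))) with (tail (fun k => fst (d z k))
      n).
    change (Series (fun k => snd (d z (n + k)%nat))) with (tail (fun k => snd (d z k)) n).
    rewrite (tail_S (fun k => fst (d z k)) n E1), (tail_S (fun k => snd (d z k)) n E2).
    destruct (d z n) as [u v] eqn:Eduv.
    unfold Cminus, Cplus, Copp; cbn [fst snd]. f_equal; unfold tail.
    { ring. } { ring. } }
assert (Hlim : forall n z, Cmod z < 1 ->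
  Cmod (partial_prod beta n z - B z) <= 2 * tail x n / (1 - Cmod z)).
{ intros n z Hz. rewrite Cmod_sub_rev, HB by assumption. eapply Rle_trans; [apply Cmod_pair_le|].
  destruct (Rabs_Series_le (fun k => fst (d z (n + k)%nat)) (fun k => x (n + k)%nat)
    (/ (1 - Cmod z))) as [_ A1];
   [intros k; eapply Rle_trans; [apply Rabs_fst_le|now apply Hd]|now apply ex_series_tail|].
  destruct (Rabs_Series_le (fun k => snd (d z (n + k)%nat)) (fun k => x (n + k)%nat)
    (/ (1 - Cmod z))) as [_ A2];
   [intros k; eapply Rle_trans; [apply Rabs_snd_le|now apply Hd]|now apply ex_series_tail|].
  fold (tail x n) in A1, A2. unfold Rdiv. lra. }
exists B. split; [|split].
- apply (weierstrass (partial_prod beta) B (fun n => 2 * tail x n)); trivial.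
  + intros n. pose proof (tail_ge0 x n Hx0 Hx). lra.
  + intros eps He. destruct (tail_small x Hx (eps / 2) ltac:(lra)) as [n Hn]. exists n. lra.
- intros z Hz. apply Rnot_lt_le. intros Hgt.
  destruct (tail_small x Hx ((Cmod (B z) - 1) * (1 - Cmod z) / 2)) as [n Hn];
    [apply Rdiv_lt_0_compat; nra|].
  pose proof (Hlim n z Hz) as H1. pose proof (HP1 n z Hz). rewrite Cmod_sub_rev in H1.
  pose proof (Cmod_triangle_sub (B z) (partial_prod beta n z)).
  assert (2 * tail x n / (1 - Cmod z) < Cmod (B z) - 1); [|lra].
  apply Rmult_lt_reg_r with (1 - Cmod z); [lra|]. unfold Rdiv. rewrite Rmult_assoc, Rinv_l; lra.
- exact Hlim.
Qed.

(** * Blaschke sequences and the Crownover property *)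

(** Of the two halves of an interval, one misses the next point to be avoided. *)
Lemma avoid_points (a : nat -> C) n : exists x, 0 < x < / 2 /\ forall k, (k < n)%nat ->
  RtoC x <> a k.
Proof.
assert (H : exists u v, 0 < u < v /\ v < / 2 /\ forall x, u < x < v -> forall k, (k < n)%nat ->
  RtoC x <> a k).
{ induction n as [|n [u [v [Huv [Hv H]]]]].
  - exists (/ 8), (/ 4). split; [lra|]. split; [lra|]. intros x _ k Hk. lia.
  - set (c := fst (a n)). destruct (Rle_dec c ((u + v) / 2)) as [h|h].
    + exists ((u + v) / 2), v. split; [lra|]. split; [lra|]. intros x Hx k Hk.
      destruct (Nat.eq_dec k n) as [->|Hkn]; [|apply H; [lra|lia]].
      intros E. unfold c in h. rewrite <- E in h. simpl in h. lra.
    + exists u, ((u + v) / 2). split; [lra|]. split; [lra|]. intros x Hx k Hk.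
      destruct (Nat.eq_dec k n) as [->|Hkn]; [|apply H; [lra|lia]].
      intros E. unfold c in h. rewrite <- E in h. simpl in h. lra. }
destruct H as [u [v [Huv [Hv H]]]]. exists ((u + v) / 2). split; [lra|]. apply H; lra.
Qed.

Section BlaschkeOrbit.
Context (p : R) (phi psi : disc_aut) (a : nat -> C).
Context (Hp1 : 1 <= p).
Context (ha : forall k, unit_disc (a k) /\ aut_eval psi (Nat.iter k (aut_eval phi) (a k)) = RtoC 0).

Let chi := aut_orbit psi phi.

Lemma chi_pt k : aut_pt (chi k) = a k.
Proof. destruct (ha k) as [H1 H2]. apply aut_zero; [exact H1|]. unfold chi. now rewrite aut_orbitE.
Qed.

Lemma orbit_prod_aut n z : Cmod z < 1 ->
  orbit_prod phi psi (S n) z = (orbit_prod phi psi n z * aut_eval (chi n) z)%C.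
Proof. intros Hz. rewrite orbit_prod_S. unfold chi. now rewrite aut_orbitE. Qed.

Definition orbit_factor (k : nat) (z : C) : C := (blaschke_unit (chi k) * aut_eval (chi k) z)%C.

Fixpoint unit_prod (n : nat) : C :=
  match n with O => 1 | S n => (unit_prod n * blaschke_unit (chi n))%C end.

Lemma partial_prod_orbit n z : Cmod z < 1 ->
  partial_prod orbit_factor n z = (unit_prod n * orbit_prod phi psi n z)%C.
Proof.
intros Hz. induction n as [|n IH]; [simpl; ring|].
rewrite orbit_prod_aut by assumption. simpl. rewrite IH. unfold orbit_factor. ring.
Qed.

(** The normalised product B0 of the psi o phi_k is non-zero and lies in every range: the tail
    of the product after n factors is bounded and holomorphic, hence in the range of U_phi^n. *)
Lemma Blaschke_not_Crownover : Blaschke a -> ~ Crownover p (MU_op p phi psi).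
Proof.
intros HB [_ [_ HC]].
set (x := fun k => 2 * (1 - Cmod (a k))).
assert (Hx0 : forall k, 0 <= x k) by (intros k; unfold x; destruct (ha k) as [H _];
  unfold unit_disc in H; lra).
assert (Hx : ex_series x) by now apply (ex_series_scal (K := R_AbsRing) (V := R_NormedModule)
  2 (fun k => 1 - Cmod (a k))).
assert (Hlim : forall n, exists B, hol 1 B /\ (forall z, Cmod z < 1 -> Cmod (B z) <= 1) /\
  forall m z, Cmod z < 1 -> Cmod (partial_prod (fun k => orbit_factor (n + k)%nat) m z - B z)
    <= 2 * tail x (n + m) / (1 - Cmod z)).
{ intros n. destruct (infinite_product (fun k => orbit_factor (n + k)%nat)
  (fun k => x (n + k)%nat)) as [B [H1 [H2 H3]]].
  - intros k z Hz. apply (cdiff_mult (fun _ => blaschke_unit (chi (n + k)))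
    (aut_eval (chi (n + k)))); [apply cdiff_const|apply cdiff_aut; lra].
  - intros k z Hz. unfold orbit_factor. rewrite Cmod_mult, Cmod_blaschke_unit, Rmult_1_l. left.
    now apply Cmod_aut_lt.
  - intros k. apply Hx0.
  - intros k z Hz. unfold orbit_factor, x. rewrite <- chi_pt. now apply blaschke_unit_near_1.
  - now apply ex_series_tail.
  - exists B. split; trivial. split; trivial. intros m z Hz. eapply Rle_trans; [now apply H3|].
    rewrite tail_tail. apply Rle_refl. }
destruct (Hlim 0%nat) as [B0 [HB0h [HB01 HB0]]].
assert (Hfac : forall n B, (forall m z, Cmod z < 1 ->
  Cmod (partial_prod (fun k => orbit_factor (n + k)%nat) m z - B z) <= 2 * tail x (n + m)
  / (1 - Cmod z)) ->
  forall z, Cmod z < 1 -> B0 z = (partial_prod orbit_factor n z * B z)%C).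
{ intros n B Hn z Hz. apply Cminus_eq_0, Cmod_small_eq0. intros eps He.
  assert (Hpz : 0 <= Cmod (partial_prod orbit_factor n z)) by apply Cmod_ge_0.
  set (K := 2 / (1 - Cmod z) * (1 + Cmod (partial_prod orbit_factor n z))).
  assert (HK : 0 < K) by (unfold K; apply Rmult_lt_0_compat; [apply Rdiv_lt_0_compat; lra|lra]).
  destruct (tail_small (fun k => x (n + k)%nat) (ex_series_tail x n Hx) (eps / K)) as [m Hm];
    [now apply Rdiv_lt_0_compat|].
  rewrite tail_tail in Hm. specialize (Hn m z Hz). pose proof (HB0 (n + m)%nat z Hz) as H0.
  simpl plus in H0.
  change (Cmod (partial_prod orbit_factor (n + m) z - B0 z) <= 2 * tail x (n + m) / (1 - Cmod z))
    in H0. rewrite partial_prod_add in H0.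
  set (Q := partial_prod (fun k => orbit_factor (n + k)%nat) m z) in *.
  replace (B0 z - partial_prod orbit_factor n z * B z)%C with (- (partial_prod orbit_factor n z * Q
    - B0 z) + partial_prod orbit_factor n z * (Q - B z))%C by ring.
  eapply Rle_lt_trans; [apply Cmod_triangle|]. rewrite Cmod_opp, Cmod_mult.
  apply Rle_lt_trans with (tail x (n + m) * K).
  - unfold K. replace (tail x (n + m) * (2 / (1 - Cmod z)
    * (1 + Cmod (partial_prod orbit_factor n z)))) with
     (2 * tail x (n + m) / (1 - Cmod z) + Cmod (partial_prod orbit_factor n z)
       * (2 * tail x (n + m) / (1 - Cmod z))) by (field; lra).
    apply Rplus_le_compat; [exact H0|]. now apply Rmult_le_compat_l.
  - apply Rmult_lt_reg_r with (/ K); [now apply Rinv_0_lt_compat|].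
    rewrite Rmult_assoc, Rinv_r by lra. unfold Rdiv in Hm. lra. }
(* B0 = (first N factors) * BN with |1 - BN| < 1 on |z| < 1/2 for large N, and the first N
   factors vanish only at a_0, ..., a_(N-1). *)
destruct (tail_small x Hx (/ 4) ltac:(lra)) as [N HN].
destruct (Hlim N) as [BN [_ [_ HBN]]].
destruct (avoid_points a N) as [t [Ht Hta]].
assert (Hmt : Cmod (RtoC t) = t) by (rewrite Cmod_R, Rabs_pos_eq; lra).
assert (Hne : B0 (RtoC t) <> 0).
{ rewrite (Hfac N BN HBN) by lra. apply Cmult_neq_0.
  - clear HN HBN. induction N as [|N IH]; [simpl; intros E; apply RtoC_inj in E; lra|].
    simpl. apply Cmult_neq_0; [apply IH; intros; apply Hta; lia|]. unfold orbit_factor.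
    apply Cmult_neq_0.
    + apply Cmod_gt_0. rewrite Cmod_blaschke_unit. lra.
    + intros E. apply aut_zero in E; [|lra]. rewrite chi_pt in E. apply (Hta N); [lia|].
      now symmetry.
  - intros E. specialize (HBN 0%nat (RtoC t) ltac:(lra)). rewrite Nat.add_0_r, Hmt, E in HBN.
    simpl in HBN.
    replace (1 - 0)%C with (RtoC 1) in HBN by ring. rewrite Cmod_1 in HBN.
    assert (2 * tail x N / (1 - t) < 1); [|lra].
    apply Rmult_lt_reg_r with (1 - t); [lra|]. unfold Rdiv. rewrite Rmult_assoc, Rinv_l; lra. }
apply Hne. apply (HC B0).
- apply (Hp_bounded p B0 1); trivial.
- intros n _. destruct (Hlim n) as [B [HBh [HB1 HBn]]].
  assert (HcB : hol 1 (fun z => unit_prod n * B z)%C).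
  { intros z Hz. apply (cdiff_mult (fun _ => unit_prod n) B); [apply cdiff_const|now apply HBh]. }
  destruct (iter_U_surj p phi Hp1 n _ HcB) as [g [Hg Eg]].
  exists g. assert (ES : forall z, Cmod z < 1 -> B0 z = Nat.iter n (MU_op p phi psi) g z).
  { intros z Hz. rewrite iter_MU, Eg, (Hfac n B HBn), partial_prod_orbit by assumption. ring. }
  split; [|exact ES]. apply Hp_iff; trivial. split; trivial.
  exists (2 * PI * rpow 1 p). apply (proj1 (iter_MU_bounded_iff p phi psi Hp1 n g _ Hg)).
  apply (bounded_ext p B0 _ _ ES). now apply (bounded_fun p B0 1).
- unfold unit_disc. lra.
Qed.

(** 1 - x <= exp (- x), with |psi(phi_k z)|^2 <= 1 - (1 - |a_k|) (1 - |z|^2) / 4.  The summand is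
    shifted by one so that the sum has the terms k < n. *)
Lemma orbit_prod_le n z : Cmod z < 1 ->
  Cmod (orbit_prod phi psi n z) ^ 2 <= exp (- ((1 - Cmod z ^ 2)
    / 4 * sum_f_R0 (fun k => match k with O => 0 | S k => 1 - Cmod (a k) end) n)).
Proof.
intros Hz. pose proof (Cmod_ge_0 z) as Hz0. induction n as [|n IH].
- simpl. rewrite Cmod_1, Rmult_0_r, Ropp_0, exp_0. lra.
- rewrite orbit_prod_aut, Cmod_mult, Rpow_mult_distr by assumption.
  simpl sum_f_R0. rewrite Rmult_plus_distr_l, Ropp_plus_distr, exp_plus.
  apply Rmult_le_compat; [apply pow2_ge_0|apply pow2_ge_0|exact IH|].
  destruct (ha n) as [Han _]. unfold unit_disc in Han. pose proof (Cmod_ge_0 (a n)) as Ha0.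
  pose proof (Cmod_aut_sqr (chi n) z ltac:(lra)) as E. rewrite chi_pt in E.
  assert (Hd : 0 < Cmod (1 - Cconj (a n) * z) <= 2).
  { split; [rewrite <- chi_pt; apply Cmod_gt_0, aut_den_neq0; lra|]. eapply Rle_trans;
    [apply Cmod_minus_le|].
    rewrite Cmod_1, Cmod_mult, Cmod_conj. nra. }
  assert (Hge : (1 - Cmod z ^ 2) / 4 * (1 - Cmod (a n)) <= 1 - Cmod (aut_eval (chi n) z) ^ 2).
  { rewrite E. replace ((1 - Cmod z ^ 2) / 4 * (1 - Cmod (a n))) with ((1 - Cmod (a n))
    * (1 - Cmod z ^ 2) * / 4) by field.
    assert (0 <= 1 - Cmod z ^ 2) by nra.
    apply Rmult_le_compat; [apply Rmult_le_pos; lra|lra| |].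
    - apply Rmult_le_compat_r; [assumption|nra].
    - apply Rinv_le_contravar; [apply pow_lt; lra|nra]. }
  pose proof (exp_ineq1_le (- ((1 - Cmod z ^ 2) / 4 * (1 - Cmod (a n))))). lra.
Qed.

Lemma not_Blaschke_unbounded : ~ Blaschke a ->
  forall M, exists n, M < sum_f_R0 (fun k => 1 - Cmod (a k)) n.
Proof.
intros HB M. destruct (Classical_Prop.classic (exists n, M < sum_f_R0 (fun k => 1 - Cmod (a k)) n))
  as [h|h]; [exact h|exfalso].
apply HB. unfold Blaschke.
destruct (ex_finite_lim_seq_incr (sum_n (fun k => 1 - Cmod (a k))) M) as [l Hl].
- intros n. rewrite sum_Sn. destruct (ha (S n)) as [H _]. unfold unit_disc in H. unfold plus;
  simpl. lra.
- intros n. rewrite sum_n_Reals. apply Rnot_lt_le. intros H. apply h. now exists n.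
- exists l. exact Hl.
Qed.

Lemma orbit_prod_small z eps : ~ Blaschke a -> Cmod z < 1 -> 0 < eps ->
  exists n, (1 <= n)%nat /\ Cmod (orbit_prod phi psi n z) < eps.
Proof.
intros HB Hz He. pose proof (Cmod_ge_0 z). set (c := (1 - Cmod z ^ 2) / 4).
assert (Hc : 0 < c) by (unfold c; nra).
destruct (not_Blaschke_unbounded HB (- ln (eps ^ 2) / c)) as [n Hn].
exists (S n). split; [lia|]. pose proof (orbit_prod_le (S n) z Hz) as H1. fold c in H1.
assert (Es : forall m, sum_f_R0 (fun k => match k with O => 0 | S k => 1 - Cmod (a k) end) (S m)
  = sum_f_R0 (fun k => 1 - Cmod (a k)) m).
{ induction m as [|m IHm]; [simpl; ring|]. rewrite tech5, IHm. reflexivity. }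
rewrite Es in H1. set (s := sum_f_R0 _ n) in *.
assert (H2 : - (c * s) < ln (eps ^ 2)).
{ apply Rmult_lt_compat_r with (r := c) in Hn; [|assumption]. unfold Rdiv in Hn.
  rewrite Rmult_assoc, Rinv_l in Hn by lra. lra. }
apply exp_increasing in H2. rewrite exp_ln in H2 by (apply pow_lt; lra).
pose proof (Cmod_ge_0 (orbit_prod phi psi (S n) z)). nra.
Qed.

Lemma orbit_prod_le_1 n z : Cmod z < 1 -> Cmod (orbit_prod phi psi n z) <= 1.
Proof.
intros Hz. induction n as [|n IH]; [simpl; rewrite Cmod_1; lra|].
rewrite orbit_prod_aut, Cmod_mult by assumption.
pose proof (Cmod_aut_lt (chi n) z Hz). pose proof (Cmod_ge_0 (orbit_prod phi psi n z)).
pose proof (Cmod_ge_0 (aut_eval (chi n) z)). nra.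
Qed.

(** If f = S^n g, then U^n g has the same bound on its means as f, so [point_bound] gives
    |f(z)|^p <= K |orbit_prod n z| with K independent of n. *)
Lemma not_Blaschke_Crownover : ~ Blaschke a -> Crownover p (MU_op p phi psi).
Proof.
intros HB. split; [now apply MU_isometry|]. split; [now apply MU_codim_one|].
intros f Hf Hran z Hz. unfold unit_disc in Hz. pose proof (Cmod_ge_0 z) as Hz0. pose proof PI_RGT_0.
apply Hp_iff in Hf as [Hf [M HM]]; trivial.
assert (HM0 : 0 <= M) by (apply (bounded_ge0 p f); trivial; lra).
set (R := (1 + Cmod z) / 2). assert (HR : Cmod z < R < 1) by (unfold R; lra).
set (K := (R + Cmod z) / (R - Cmod z) * M / (2 * PI)).
assert (HK0 : 0 <= K) by (unfold K; apply Rdiv_le_0_compat; [|lra]; apply Rmult_le_pos;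
  [apply Rdiv_le_0_compat; lra|assumption]).
assert (Hbd : forall n, (1 <= n)%nat -> rpow (Cmod (f z)) p <= Cmod (orbit_prod phi psi n z) * K).
{ intros n Hn. destruct (Hran n Hn) as [g [Hg Eg]]. apply Hp_iff in Hg as [Hg _]; trivial.
  assert (HgM : bounded_means p g M).
  { exact (proj1 (iter_MU_bounded_iff p phi psi Hp1 n g M Hg) (bounded_ext p f _ M Eg HM)). }
  apply (proj2 (iter_U_bounded_iff p phi Hp1 n g M Hg)) in HgM.
  rewrite Eg, iter_MU, Cmod_mult, rpow_mult by (trivial; apply Cmod_ge_0).
  pose proof (orbit_prod_le_1 n z Hz) as H1. pose proof (Cmod_ge_0 (orbit_prod phi psi n z)) as H0.
  apply Rmult_le_compat; try apply rpow_ge0.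
  - destruct H0 as [H0|H0]; [|rewrite <- H0, rpow_0; lra].
    rewrite rpow_pos by assumption. rewrite <- (Rpower_1 (Cmod (orbit_prod phi psi n z)))
      at 2 by assumption.
    unfold Rpower. assert (Hln : ln (Cmod (orbit_prod phi psi n z)) <= 0).
    { rewrite <- ln_1. destruct H1 as [H1| ->]; [left; apply ln_increasing; lra|lra]. }
    assert (Hl2 : p * ln (Cmod (orbit_prod phi psi n z)) <= 1 * ln (Cmod (orbit_prod phi psi n z)))
      by nra.
    destruct Hl2 as [Hl2| ->]; [left; now apply exp_increasing|lra].
  - pose proof (point_bound p (Nat.iter n (U_op p phi) g) R z Hp1 (hol_iter_U p phi Hp1 n g Hg)
    ltac:(lra) ltac:(lra)) as HP.
    unfold K. apply Rmult_le_reg_l with (2 * PI); [lra|]. eapply Rle_trans; [exact HP|].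
    replace (2 * PI * ((R + Cmod z) / (R - Cmod z) * M / (2 * PI))) with ((R + Cmod z)
      / (R - Cmod z) * M) by (field; lra).
    apply Rmult_le_compat_l; [apply Rdiv_le_0_compat; lra|]. apply HgM. lra. }
destruct (Ceq_dec (f z) 0) as [E|E]; [exact E|exfalso].
apply Cmod_gt_0 in E. pose proof (rpow_gt0 (Cmod (f z)) p E) as Hpos.
destruct (orbit_prod_small z (rpow (Cmod (f z)) p / (K + 1)) HB Hz) as [n [Hn Hs]];
  [apply Rdiv_lt_0_compat; lra|].
specialize (Hbd n Hn). pose proof (Cmod_ge_0 (orbit_prod phi psi n z)).
assert (Cmod (orbit_prod phi psi n z) * (K + 1) < rpow (Cmod (f z)) p).
{ replace (rpow (Cmod (f z)) p) with (rpow (Cmod (f z)) p / (K + 1) * (K + 1)) by (field; lra).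
  apply Rmult_lt_compat_r; lra. }
lra.
Qed.
End BlaschkeOrbit.

Theorem theorem2 (p : R) (hp1 : 1 <= p) (hp2 : p <> 2)
  (phi psi : disc_aut) (a : nat -> C)
  (ha : forall k : nat, unit_disc (a k) /\ aut_eval psi (Nat.iter k (aut_eval phi) (a k)) = RtoC 0) :
  Crownover p (fun f => mul_op (aut_eval psi) (U_op p phi f)) <-> ~ Blaschke a.
Proof.
change (Crownover p (MU_op p phi psi) <-> ~ Blaschke a). split.
- intros HC HB. now apply (Blaschke_not_Crownover p phi psi a hp1 ha HB).
- now apply not_Blaschke_Crownover.
Qed.
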